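(* Let $d\in\mathbb N$, $m\in\mathbb N^d$, let $D\subset\mathbb R^d$ be a bounded domain of $m$-type, $\alpha\in(0,\infty)^d$, $1\le p<\infty$, $1\le\theta\le\infty$, $1<q<\infty$, $\lambda\in\mathbb Z_+^d$ with $\lambda_j\le m_j$ for all $j$, and assume $\alpha_j-1/p>0$ and $\alpha_j-\lambda_j-(1/p-1/q)_+>0$ for all $j$. Let $K$ be the closed unit ball of $(S^\alpha_{p,\theta}B)'(D)$, $\mu=\min_j(\alpha_j-\lambda_j)$, $\gamma=\#\{j:\alpha_j-\lambda_j=\mu\}$, $Q=\max(2,q)$. Then there is $c>0$ such that for all integers $n\ge2$: if $q\le p$ or $2\le p<q$, $$\sigma_n(\partial^\lambda,K,L_q(D))\ge c\,n^{-(\mu-(1/p-1/q)_+)}(\log n)^{(\gamma-1)(\mu-(1/p-1/q)-(1/\theta-1/p)_+-(1/q-1/Q)_+)};$$ if $p<\min(2,q)$, $$\sigma_n(\partial^\lambda,K,L_q(D))\ge c\,n^{-(\mu-(1/p-1/q)_+)}(\log n)^{(\gamma-1)(1/Q-1/\theta)_+}.$$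
   Context: Notation: $e=(1,\dots,1)$; products of vectors componentwise; $t_+=\max(t,0)$; $\mathbb Z_+^d(l)=\{k\in\mathbb Z^d:0\le k_j\le l_j\}$; $I^d=(0,1)^d$, $B^d=[-1,1]^d$; $x^J=(x_j)_{j\in J}$, $\chi_J$ the indicator vector of $J\subset\{1,\dots,d\}$. For an open $G$, $h\in\mathbb R^d$, $l\in\mathbb Z_+^d$: $G^l_h=\{x\in G:x+(t_jl_jh_j)_j\in G\ \forall t\in[0,1]^d\}$, $(\Delta^l_hf)(x)=\sum_{k\in\mathbb Z_+^d(l)}(-1)^{\sum(l_j-k_j)}\prod_j\binom{l_j}{k_j}f(x+kh)$. For $f\in L_p(G)$, nonempty $J$, $t\in(0,\infty)^d$: $\Omega'^{l\chi_J}(f,t^J)_{L_p(G)}=\bigl(\prod_{j\in J}(2t_j)^{-1}\int_{\prod_{j\in J}[-t_j,t_j]}\int_{G^{l\chi_J}_\xi}|\Delta^{l\chi_J}_\xi f|^pdx\,d\xi^J\bigr)^{1/p}$ ($\xi_j=0$ for $j\notin J$). $l=l(\alpha)$ with $l_j=\min\{k\in\mathbb N:\alpha_j<k\}$. For nonempty $J$ let $|f|_J=\bigl(\int_{(0,\infty)^J}\prod_{j\in J}t_j^{-1-\theta\alpha_j}(\Omega'^{l\chi_J}(f,t^J)_{L_p(D)})^\theta dt^J\bigr)^{1/\theta}$ ($\theta<\infty$), resp. $\sup_{t^J}\prod_{j\in J}t_j^{-\alpha_j}\Omega'^{l\chi_J}(f,t^J)_{L_p(D)}$ ($\theta=\infty$).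 $(S^\alpha_{p,\theta}B)'(D)$ is the space of $f\in L_p(D)$ with all $|f|_J<\infty$, normed by $\|f\|=\max(\|f\|_{L_p(D)},\max_J|f|_J)$. Its elements have continuous representatives (used for point evaluation); $\partial^\lambda f$ is the distributional derivative. Domains of $m$-type: $Q_{\kappa,\nu}=2^{-\kappa}\nu+2^{-\kappa}I^d$; $N_\kappa=\{\nu\in\mathbb Z^d:(2^{-\kappa}\nu+2^{-\kappa}(m+e)[0,1]^d)\cap D\ne\emptyset\}$; $\Upsilon^d=\{0,1\}^d$, $s(\epsilon)=\{j:\epsilon_j\neq0\}$; $M_\epsilon(\nu)$ = families $(\mu_j)_{j\in s(\epsilon)}$ of integers, $0\le\mu_j\le m_j+1$, $\nu_j-\mu_j$ even; $\mathfrak n_\epsilon(\nu,\mu)_j=(\nu_j-\mu_j)/2$ for $j\in s(\epsilon)$, $=\nu_j$ otherwise. $D$ is of $m$-type if there exist $K^0\in\mathbb Z_+^d$, $\Gamma^0\in(0,\infty)^d$ and maps $\nu_{K^0+\kappa},n_{K^0+\kappa}:N_{K^0+\kappa}\to\mathbb Z^d$ such that for all $\kappa\in\mathbb Z_+^d,\nu\in N_{K^0+\kappa}$: (1) $Q_{K^0+\kappa,\nu_{K^0+\kappa}(\nu)}\cup Q_{K^0+\kappa,n_{K^0+\kappa}(\nu)}\subset D\cap(2^{-K^0-\kappa}\nu+\Gamma^02^{-K^0-\kappa}B^d)$; (2) for $\epsilon\in\Upsilon^d$ with $s(\epsilon)\subset s(\kappa)$ and $\mu\in M_\epsilon(\nu)$,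 the smallest open axis-parallel box containing $Q_{K^0+\kappa,n_{K^0+\kappa}(\nu)}$ and $Q_{K^0+\kappa-\epsilon,\nu_{K^0+\kappa-\epsilon}(\mathfrak n_\epsilon(\nu,\mu))}$ lies in $D$; (3) for such $\epsilon,\mu$ and $j\notin s(\epsilon)$, $(\nu_{K^0+\kappa-\epsilon}(\mathfrak n_\epsilon(\nu,\mu)))_j=(\nu_{K^0+\kappa}(\nu))_j$. Recovery width: $\sigma_n(\partial^\lambda,K,L_q(D))=\inf\sup_{f\in K}\|\partial^\lambda f-A(f(y^1),\dots,f(y^n))\|_{L_q(D)}$, infimum over all points $y^1,\dots,y^n\in D$ and all (arbitrary) maps $A:\mathbb R^n\to L_q(D)$. *)

(* Defs.v *)
From mathcomp Require Import all_boot all_order all_algebra.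
From mathcomp Require Import all_classical all_reals all_analysis.
Set Implicit Arguments. Unset Strict Implicit. Unset Printing Implicit Defensive.
Import Order.TTheory GRing.Theory Num.Theory.
Local Open Scope classical_set_scope.
Local Open Scope ring_scope.

(* Points of R^d are d-tuples of reals, carrying the product (= Borel)       *)
(* sigma-algebra of the library.                                            *)

Section Defs.
Variable R : realType.
Local Notation RR := (measurableTypeR R).

Definition pt (d : nat) := d.-tuple RR.

Definition mkpt d (F : 'I_d -> R) : pt d := [tuple (F i : RR) | i < d].

Definition coord d (x : pt d) (i : 'I_d) : R := tnth x i.

(* d-dimensional Lebesgue measure, built by iterating the 1-dimensional    *)
(* Lebesgue measure (Tonelli): lebd (n+1) A = int_R lebd n (A_x) dx.        *)
Fixpoint lebd (n : nat) : set (n.-tuple RR) -> \bar R :=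
  match n return set (n.-tuple RR) -> \bar R with
  | 0 => fun A => (\1_A [tuple] : R)%:E
  | n'.+1 => fun A =>
      (\int[@lebesgue_measure R]_x @lebd n' [set t | A (cons_tuple x t)])%E
  end.
Arguments lebd : clear implicits.

Definition Lpn d (D : set (pt d)) (p : R) (f : pt d -> R) : \bar R :=
  poweR (\int[lebd d]_(x in D) (`|f x| `^ p)%:E)%E p^-1.

Definition boxnbhd d (x : pt d) (e : R) : set (pt d) :=
  [set y | forall i, `|coord y i - coord x i| < e].

Definition is_open d (U : set (pt d)) :=
  forall x, U x -> exists2 e, 0 < e & boxnbhd x e `<=` U.

Definition is_connected d (D : set (pt d)) :=
  forall U V : set (pt d), is_open U -> is_open V ->
    D `<=` U `|` V -> D `&` U `&` V = set0 ->
    D `&` U = set0 \/ D `&` V = set0.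

Definition is_domain d (D : set (pt d)) :=
  [/\ is_open D, is_connected D & D !=set0].

Definition is_bounded d (D : set (pt d)) :=
  exists r : R, forall x, D x -> forall i, `|coord x i| <= r.

Definition cont_at d (f : pt d -> R) (x : pt d) :=
  forall e : R, 0 < e -> exists2 del : R, 0 < del &
    forall y, boxnbhd x del y -> `|f y - f x| < e.

Definition cont_on d (D : set (pt d)) (f : pt d -> R) :=
  forall x, D x -> forall e : R, 0 < e -> exists2 del : R, 0 < del &
    forall y, D y -> boxnbhd x del y -> `|f y - f x| < e.

Definition dyad (k : nat) : R := (2^-1) ^+ k.

Definition qlo d (kap : 'I_d -> nat) (nu : 'I_d -> int) j : R :=
  dyad (kap j) * (nu j)%:~R.
Definition qhi d (kap : 'I_d -> nat) (nu : 'I_d -> int) j : R :=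
  dyad (kap j) * ((nu j)%:~R + 1).

Definition Qcube d (kap : 'I_d -> nat) (nu : 'I_d -> int) : set (pt d) :=
  [set x | forall j, qlo kap nu j < coord x j < qhi kap nu j].

Definition Nset d (m : 'I_d -> nat) (D : set (pt d)) (kap : 'I_d -> nat) :
    set ('I_d -> int) :=
  [set nu | exists2 x, D x & forall j,
     dyad (kap j) * (nu j)%:~R <= coord x j <=
     dyad (kap j) * ((nu j)%:~R + (m j).+1%:R)].

Definition hull_box d (k1 : 'I_d -> nat) (n1 : 'I_d -> int)
    (k2 : 'I_d -> nat) (n2 : 'I_d -> int) : set (pt d) :=
  [set x | forall j, Num.min (qlo k1 n1 j) (qlo k2 n2 j) < coord x j <
                     Num.max (qhi k1 n1 j) (qhi k2 n2 j)].

(* D is of m-type.  nuF kap and nF kap stand for the maps nu_{K0+kap} and  *)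
(* n_{K0+kap} (only their values on N_{K0+kap} matter).  An epsilon in     *)
(* Upsilon^d is a boolean vector, s(eps) = {j | eps j}; mu in M_eps(nu) is *)
(* a vector whose coordinates outside s(eps) are irrelevant.               *)
Definition m_type d (m : 'I_d -> nat) (D : set (pt d)) :=
  exists (K0 : 'I_d -> nat) (G0 : 'I_d -> R)
         (nuF nF : ('I_d -> nat) -> ('I_d -> int) -> ('I_d -> int)),
  (forall j, 0 < G0 j) /\
  forall (kap : 'I_d -> nat) (nu : 'I_d -> int),
    let K := fun j => (K0 j + kap j)%N in
    Nset m D K nu ->
    (Qcube K (nuF kap nu) `|` Qcube K (nF kap nu) `<=`
       D `&` [set x | forall j,
                `|coord x j - dyad (K j) * (nu j)%:~R| <= G0 j * dyad (K j)])
    /\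
    forall (eps : 'I_d -> bool) (mu : 'I_d -> int),
      (forall j, eps j -> (0 < kap j)%N) ->
      (forall j, eps j -> (0 <= mu j <= (m j).+1%:Z) /\ (2 %| nu j - mu j)%Z) ->
      let kap' := fun j => (kap j - eps j)%N in
      let nn := fun j => if eps j then ((nu j - mu j) %/ 2)%Z else nu j in
      hull_box K (nF kap nu) (fun j => (K0 j + kap' j)%N) (nuF kap' nn) `<=` D
      /\
      (forall j, ~~ eps j -> nuF kap' nn j = nuF kap nu j).

(* l(alpha)_j = min {k in N | alpha_j < k} *)
Definition l_of d (alpha : 'I_d -> R) (j : 'I_d) : nat :=
  (Num.truncn (alpha j)).+1.

Definition lmax d (l : 'I_d -> nat) : nat := \max_(j < d) l j.

Definition fdiff d (l : 'I_d -> nat) (h : 'I_d -> R) (f : pt d -> R)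
    (x : pt d) : R :=
  \sum_(k : {ffun 'I_d -> 'I_(lmax l).+1} | [forall j, (k j <= l j)%N])
     (-1) ^+ (\sum_(j < d) (l j - k j))%N * (\prod_(j < d) 'C(l j, k j))%:R
     * f (mkpt (fun j => coord x j + (k j)%:R * h j)).

Definition Gset d (G : set (pt d)) (l : 'I_d -> nat) (h : 'I_d -> R) :
    set (pt d) :=
  [set x | G x /\ forall t : 'I_d -> R, (forall j, 0 <= t j <= 1) ->
           G (mkpt (fun j => coord x j + t j * (l j)%:R * h j))].

Definition lchi d (l : 'I_d -> nat) (J : {set 'I_d}) (j : 'I_d) : nat :=
  if j \in J then l j else 0%N.

(* a point of R^J (coordinates listed in the order of enum J), extended to *)
(* a vector of R^d by the default value dflt outside J                     *)
Definition extJ d (J : {set 'I_d}) (s : #|J|.-tuple RR) (dflt : R)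
    (j : 'I_d) : R :=
  if j \in J then (nth 0 (s : seq R) (index j (enum J)) : R) else dflt.

Definition Omega d (G : set (pt d)) (p : R) (l : 'I_d -> nat)
    (J : {set 'I_d}) (f : pt d -> R) (t : 'I_d -> R) : \bar R :=
  poweR
    ((\prod_(j in J) (2 * t j)^-1)%:E *
     \int[lebd #|J|]_(s in [set s : #|J|.-tuple RR |
                            forall j, j \in J -> (`|extJ s 0 j| <= t j)%R])
        (\int[lebd d]_(x in Gset G (lchi l J) (extJ s 0))
            (`|fdiff (lchi l J) (extJ s 0) f x| `^ p)%:E))%E
    p^-1.

Definition semiJ d (D : set (pt d)) (p : R) (theta : \bar R)
    (alpha : 'I_d -> R) (J : {set 'I_d}) (f : pt d -> R) : \bar R :=
  match theta with
  | r%:E =>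
      poweR
       (\int[lebd #|J|]_(s in [set s : #|J|.-tuple RR | forall i, (0 < tnth s i)%R])
          ((\prod_(j in J) extJ s 1 j `^ (-1 - r * alpha j))%:E *
           poweR (Omega D p (l_of alpha) J f (extJ s 1)) r))%E
       r^-1
  | _ =>
      ereal_sup [set ((\prod_(j in J) t j `^ (- alpha j))%:E *
                      Omega D p (l_of alpha) J f t)%E
                 | t in [set t : 'I_d -> R | forall j, (0 < t j)%R]]
  end.

(* K = closed unit ball of (S^alpha_{p,theta}B)'(D), elements being taken *)
(* as their continuous representatives                                     *)
Definition Kball d (D : set (pt d)) (p : R) (theta : \bar R)
    (alpha : 'I_d -> R) : set (pt d -> R) :=
  [set f | [/\ cont_on D f, measurable_fun D f, (Lpn D p f <= 1)%E &
            forall J : {set 'I_d}, J != finset.set0 -> (semiJ D p theta alpha J f <= 1)%E]].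

Definition shift d (x : pt d) (j : 'I_d) (t : R) : pt d :=
  mkpt (fun i => if i == j then coord x i + t else coord x i).

Definition pder d (j : 'I_d) (phi : pt d -> R) (x : pt d) : R :=
  derive1 (fun t : R => phi (shift x j t)) 0.

Fixpoint iter_pder d (s : seq 'I_d) (phi : pt d -> R) : pt d -> R :=
  match s with
  | [::] => phi
  | j :: s' => pder j (iter_pder s' phi)
  end.

Definition smooth d (phi : pt d -> R) :=
  forall (s : seq 'I_d) (x : pt d),
    (forall j, derivable (fun t : R => iter_pder s phi (shift x j t)) 0 1)
    /\ cont_at (iter_pder s phi) x.

(* C_c^infinity(D): smooth, with support compact and contained in D *)
Definition test_fun d (D : set (pt d)) (phi : pt d -> R) :=
  smooth phi /\
  exists (r e : R), 0 < e /\
    forall x, phi x <> 0 -> (forall i, `|coord x i| <= r) /\ boxnbhd x e `<=` D.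

Definition dseq d (lam : 'I_d -> nat) : seq 'I_d :=
  flatten [seq nseq (lam j) j | j <- enum 'I_d].

Definition weak_deriv d (D : set (pt d)) (lam : 'I_d -> nat)
    (f g : pt d -> R) :=
  forall phi, test_fun D phi ->
    (\int[lebd d]_(x in D) (f x * iter_pder (dseq lam) phi x)%:E =
     ((-1) ^+ (\sum_(j < d) lam j)%N)%:E *
       \int[lebd d]_(x in D) (g x * phi x)%:E)%E.

(* || partial^lambda f - h ||_{L_q(D)}  (+oo if partial^lambda f is not in *)
(* L_q(D))                                                                 *)
Definition deriv_err d (D : set (pt d)) (q : R) (lam : 'I_d -> nat)
    (f h : pt d -> R) : \bar R :=
  ereal_inf [set Lpn D q (fun x => g x - h x)
            | g in [set g : pt d -> R | [/\ measurable_fun D g,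
                       (Lpn D q g < +oo)%E & weak_deriv D lam f g]]].

Definition recovery_width d (D : set (pt d)) (lam : 'I_d -> nat)
    (K : set (pt d -> R)) (q : R) (n : nat) : \bar R :=
  ereal_inf
    [set ereal_sup [set deriv_err D q lam f (yA.2 (fun i => f (yA.1 i))) | f in K]
    | yA in [set yA : ('I_n -> pt d) * (('I_n -> R) -> pt d -> R) |
              (forall i, D (yA.1 i)) /\
              (forall v, measurable_fun D (yA.2 v) /\ (Lpn D q (yA.2 v) < +oo)%E)]].

Definition inv_theta (theta : \bar R) : R :=
  match theta with r%:E => r^-1 | _ => 0 end.

Definition posp (x : R) : R := Num.max x 0.

End Defs.

(* Main.v *)
(* A recovery method sees nothing of a function vanishing at its [n] nodes.  By
   duality it is therefore enough to exhibit [f] with [f], [-f] in the unit ball,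
   [f = 0] at the nodes, and a test function [phi] for which the pairing of
   [d^lam f] with [phi], divided by the [L_q'] norm of [phi], is large.

   Both are combinations [sum_i a_i phi_i] of derivatives of tensor-product bumps
   carried by dyadic cells of equal volume [2^-k], of all anisotropic shapes that
   are refined only in the directions where [alpha_j - lam_j] is minimal; there
   are about [k^(gamma-1)] such shapes, whence the logarithms.  Finite-difference
   estimates bound the Besov norm by the level energies [2^-k sum |a_i|^p], and a
   comparison with the orthogonal Haar functions of the same cells bounds the Gram
   matrix of the [phi_i] below by a multiple of [2^-k].

   The coefficients are chosen as follows.  If [q <= p]: random signs projected
   orthogonally onto the kernel of the [n] point evaluations, with [phi] built from
   the same coefficients; Khinchine's inequality controls all norms on average.
   If [2 <= p < q]: the projection of a single unit vector.  If [p < min (2, q)]: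
   random signs on one cell per shape that contains no node. *)

(* The obstacle is that annihilating the point evaluations mixes the shapes: projected coefficients
   are neither sparse nor sorted by level, and atoms of different shapes are not orthogonal. In the
   projected cases the estimates therefore use only sums over all cells. This is possible because
   all cells have the same volume and because, with refinement confined to minimal directions, the
   normalisation of an atom times the factor produced by d^lam is the same number for every cell.
   The pairing is then this number times the quadratic form of the Gram matrix, for which the l_2
   norm of the coefficients is a sufficient lower bound.

   Atoms have mean zero in each variable: a Haar function that is coarser in some direction is
   constant there on the cell of the atom, whence orthogonality. The derivative of order lam_j of
   the bump must not vanish at 1/2, since this value gives the Haar coefficient of the atom on its
   own cell.

   With L shapes, n is of order 2^k L when all cells are used, but of order 2^k when one free cell
   per shape is enough; this explains the two forms of the logarithmic exponent. *)
From HB Require Import structures.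
From mathcomp Require Import all_boot all_order all_algebra.
From mathcomp Require Import all_classical all_reals all_analysis.
From mathcomp Require Import measurable_realfun.
From mathcomp Require Import ring lra zify.
Require Import Defs.
Import Order.TTheory GRing.Theory Num.Theory.
Import numFieldNormedType.Exports.
Set Implicit Arguments.
Unset Strict Implicit.
Unset Printing Implicit Defensive.
Local Open Scope classical_set_scope.
Local Open Scope ring_scope.

(** * Lebesgue measure on tuples *)

Section LebesgueTuple.
Variable R : realType.
Local Notation RR := (measurableTypeR R).
Local Notation leb := (@lebesgue_measure R).

Definition consT n (z : RR * n.-tuple RR) : n.+1.-tuple RR := cons_tuple z.1 z.2.

Lemma measurable_consT n : measurable_fun setT (@consT n).
Proof.
by apply: measurable_cons; [exact: measurable_fst | exact: measurable_snd].
Qed.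

Definition unconsT n (t : n.+1.-tuple RR) : RR * n.-tuple RR :=
  (thead t, [tuple of behead t]).

Lemma measurable_unconsT n : measurable_fun setT (@unconsT n).
Proof.
apply/measurable_fun_pair.
  exact: measurable_tnth.
exact: measurable_behead.
Qed.

Section ConsMeasure.
Variables (n : nat) (m : {sigma_finite_measure set (n.-tuple RR) -> \bar R}).

Definition consM : set (n.+1.-tuple RR) -> \bar R :=
  pushforward (leb \x m)%E (@consT n).

Let mc := @measurable_consT n.

Let consM0 : consM set0 = 0%E.
Proof. by rewrite /consM /pushforward preimage_set0 measure0. Qed.

Let consM_ge0 A : (0 <= consM A)%E.
Proof. exact: measure_ge0. Qed.

Let consM_sigma_additive : semi_sigma_additive consM.
Proof.
move=> F mF tF mUF; rewrite /consM /pushforward preimage_bigcup.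
apply: measure_semi_sigma_additive.
- by move=> i; rewrite -[X in measurable X]setTI; exact: mc.
- apply/trivIsetP => /= i j _ _ ij; rewrite -preimage_setI.
  by move/trivIsetP : tF => /(_ _ _ _ _ ij) ->//; rewrite preimage_set0.
- by rewrite -preimage_bigcup -[X in measurable X]setTI; exact: mc.
Qed.

HB.instance Definition _ := isMeasure.Build _ _ _ consM
  consM0 consM_ge0 consM_sigma_additive.

Lemma consM_sigma_finite : sigma_finite setT consM.
Proof.
have /sigma_finiteP[F [TF ndF Foo]] := sigma_finiteT leb.
have /sigma_finiteP[G [TG ndG Goo]] := sigma_finiteT m.
exists (fun i => @unconsT n @^-1` (F i `*` G i)).
  rewrite -preimage_bigcup (_ : \bigcup_i (F i `*` G i) = setT) ?preimage_setT//.
  apply/seteqP; split => // -[x t] _.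
  have : setT x by []. have : setT t by [].
  rewrite TF TG => -[k _ Gkt] [j _ Fjx]; exists (maxn j k) => //; split.
    by move: x Fjx; exact/subsetPset/ndF/leq_maxl.
  by move: t Gkt; exact/subsetPset/ndG/leq_maxr.
move=> i; have [? ?] := Foo i; have [? ?] := Goo i; split.
  rewrite -[X in measurable X]setTI; apply: measurable_unconsT => //.
  exact: measurableX.
rewrite /consM /= /pushforward -comp_preimage.
rewrite (_ : _ \o _ = id) ?preimage_id; last first.
  by apply/funext => -[x t] /=; congr pair; apply/val_inj.
by rewrite product_measure1E// lte_mul_pinfty// ge0_fin_numE.
Qed.

HB.instance Definition _ := Measure_isSigmaFinite.Build _ _ _ consM consM_sigma_finite.

End ConsMeasure.

(** The iterated integral is the product measure transported by [consT]. Sigma-finiteness is carried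
    through the induction because the next product, and Tonelli's theorem, require it. *)
Lemma lebd_measure n :
  exists m : {sigma_finite_measure set (n.-tuple RR) -> \bar R},
    @lebd R n = m :> (set _ -> \bar R).
Proof.
elim: n => [|n [m mE]].
  exists (dirac ([tuple] : 0.-tuple RR)).
  by apply/funext => A; rewrite /= /dirac.
exists (consM m); apply/funext => A.
rewrite /= /consM /pushforward /product_measure1 /=.
apply: eq_integral => x _; rewrite mE /=; congr (m _).
by apply/seteqP; split => t /=; rewrite /xsection /= inE.
Qed.

Definition lebm n := projT1 (cid (lebd_measure n)).

Lemma lebmE n : @lebd R n = lebm n :> (set _ -> \bar R).
Proof. by rewrite /lebm; case: cid. Qed.

Lemma lebm_consM n A : lebm n.+1 A = consM (lebm n) A.
Proof.
rewrite -lebmE /= /consM /pushforward /product_measure1 /=.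
apply: eq_integral => x _; rewrite lebmE /=; congr (lebm n _).
by apply/seteqP; split => t /=; rewrite /xsection /= inE.
Qed.

Lemma lebm_consE n : lebm n.+1 = consM (lebm n) :> (set _ -> \bar R).
Proof. by apply/funext => A; exact: lebm_consM. Qed.

Lemma lebm0E : lebm 0 = dirac ([tuple] : 0.-tuple RR) :> (set _ -> \bar R).
Proof. by rewrite -lebmE; apply/funext => A; rewrite /= /dirac. Qed.

Lemma ge0_integral_lebm_cons n (f : n.+1.-tuple RR -> \bar R) :
  measurable_fun [set: n.+1.-tuple RR] f -> (forall x, 0 <= f x)%E ->
  (\int[lebm n.+1]_x f x = \int[leb]_x \int[lebm n]_t f (cons_tuple x t))%E.
Proof.
move=> mf f0; rewrite lebm_consE /consM.
rewrite (@ge0_integral_pushforward _ _ _ _ _ _ (@measurable_consT n))//.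
rewrite preimage_setT fubini_tonelli1//.
  exact: (measurableT_comp mf (@measurable_consT n)).
by move=> z; exact: f0.
Qed.

Lemma integral_lebm_cons n (f : n.+1.-tuple RR -> \bar R) :
  measurable_fun [set: n.+1.-tuple RR] f -> (lebm n.+1).-integrable setT f ->
  (\int[lebm n.+1]_x f x = \int[leb]_x \int[lebm n]_t f (cons_tuple x t))%E.
Proof.
move=> mf intf; have If : (leb \x lebm n)%E.-integrable setT (f \o @consT n).
  apply/integrableP; split.
    exact: (measurableT_comp mf (@measurable_consT n)).
  have /integrableP[_] := intf.
  rewrite lebm_consE /consM.
  rewrite (@ge0_integral_pushforward _ _ _ _ _ _ (@measurable_consT n))//.
  exact: measurableT_comp.
rewrite lebm_consE /consM.
rewrite (@integral_pushforward _ _ _ _ _ _ (@measurable_consT n))//.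
by rewrite preimage_setT -(@integral12_prod_meas1 _ _ _ _ _ _ _ _ If).
Qed.

End LebesgueTuple.

(** The integral of a nonnegative function is a supremum over simple functions below it, hence
    monotone without measurability. This serves for the integrands and domains in [Omega] and
    [semiJ], whose measurability is never established. *)
Lemma ge0_le_integral_raw d (T : measurableType d) (R : realType)
    (mu : {measure set T -> \bar R}) (D : set T) (f g : T -> \bar R) :
  (forall x, D x -> 0 <= f x)%E -> (forall x, 0 <= g x)%E ->
  (forall x, D x -> f x <= g x)%E ->
  (\int[mu]_(x in D) f x <= \int[mu]_x g x)%E.
Proof.
move=> f0 g0 fg; rewrite ge0_integralE// ge0_integralTE//.
apply: le_ereal_sup => _ [h hf <-]; exists h => // x.
apply: (le_trans (hf x)); rewrite patchE; case: ifPn => // /[!inE] Dx.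
exact: fg.
Qed.

(** * Tensor products and their integrals *)

Section Tensor.
Variable R : realType.
Local Notation leb := (@lebesgue_measure R).

Definition tens n (g : 'I_n -> R -> R) (x : pt R n) : R :=
  \prod_(j < n) g j (coord x j).

Lemma tens_cons n (g : 'I_n.+1 -> R -> R) (x : R) (t : pt R n) :
  tens g (cons_tuple x t) = g ord0 x * tens (fun j => g (lift ord0 j)) t.
Proof.
rewrite /tens big_ord_recl /coord tnth0; congr (_ * _).
by apply: eq_bigr => j _; rewrite tnthS.
Qed.

Lemma measurable_coord n (j : 'I_n) : measurable_fun setT (fun x : pt R n => coord x j).
Proof. exact: measurable_tnth. Qed.

Lemma measurable_tens n (g : 'I_n -> R -> R) :
  (forall j, measurable_fun setT (g j)) -> measurable_fun setT (tens g).
Proof.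
move=> mg; apply: measurable_prod => j _.
exact: (measurableT_comp (mg j) (measurable_coord j)).
Qed.

Lemma ge0_integral_tens n (g : 'I_n -> R -> R) :
  (forall j, measurable_fun setT (g j)) -> (forall j x, 0 <= g j x) ->
  (\int[lebm R n]_x (tens g x)%:E = \prod_(j < n) \int[leb]_x (g j x)%:E)%E.
Proof.
elim: n g => [|n IH] g mg g0.
  rewrite big_ord0 lebm0E integral_dirac//; last first.
    by apply/measurable_EFinP; exact: measurable_tens.
  by rewrite diracE in_setT mul1e /tens big_ord0.
have tg0 x : 0 <= tens (fun j => g (lift ord0 j)) x.
  by apply: prodr_ge0 => j _; exact: g0.
have t0 x : 0 <= tens g x by apply: prodr_ge0 => j _; exact: g0.
rewrite ge0_integral_lebm_cons; last 2 first.
- by apply/measurable_EFinP; exact: measurable_tens.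
- by move=> x; rewrite lee_fin.
rewrite big_ord_recl -IH//.
rewrite -ge0_integralZr//; last 3 first.
- by apply/measurable_EFinP; exact: mg.
- by move=> x _; rewrite lee_fin.
- by apply: integral_ge0 => x _; rewrite lee_fin.
apply: eq_integral => x _; rewrite -ge0_integralZl//; last 3 first.
- by apply/measurable_EFinP; apply: measurable_tens => j; exact: mg.
- by move=> t _; rewrite lee_fin.
- by rewrite lee_fin.
by apply: eq_integral => t _; rewrite tens_cons EFinM.
Qed.

Lemma normr_tens n (g : 'I_n -> R -> R) x :
  `|tens g x| = tens (fun j y => `|g j y|) x.
Proof. by rewrite /tens normr_prod. Qed.

Lemma integrable_tens n (g : 'I_n -> R -> R) :
  (forall j, leb.-integrable setT (EFin \o g j)) ->
  (lebm R n).-integrable setT (EFin \o tens g).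
Proof.
move=> ig.
have mg j : measurable_fun setT (g j) by have /measurable_int/measurable_EFinP := ig j.
apply/integrableP; split; first by apply/measurable_EFinP; exact: measurable_tens.
under eq_integral do rewrite /= normr_tens.
rewrite ge0_integral_tens//; last by move=> j; exact: measurableT_comp.
rewrite -ge0_fin_numE; last by apply: prode_ge0 => j _; exact: integral_ge0.
apply: prode_fin_num => j _; rewrite ge0_fin_numE; last exact: integral_ge0.
by have /integrableP[_] := ig j.
Qed.

Lemma integral_tens n (g : 'I_n -> R -> R) :
  (forall j, leb.-integrable setT (EFin \o g j)) ->
  (\int[lebm R n]_x (tens g x)%:E = (\prod_(j < n) \int[leb]_x g j x)%R%:E)%E.
Proof.
elim: n g => [|n IH] g ig.
  rewrite big_ord0 lebm0E integral_dirac//; last first.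
    by apply/measurable_EFinP; apply: measurable_tens => j; have /measurable_int/measurable_EFinP := ig j.
  by rewrite diracE in_setT mul1e /tens big_ord0.
have mg j : measurable_fun setT (g j) by have /measurable_int/measurable_EFinP := ig j.
rewrite integral_lebm_cons; last 2 first.
- by apply/measurable_EFinP; exact: measurable_tens.
- exact: integrable_tens.
under eq_integral.
  move=> x _; under eq_integral do rewrite tens_cons EFinM.
  rewrite integralZl//=; last by apply: integrable_tens => j; exact: ig.
  rewrite IH; last by move=> j; exact: ig.
  over.
rewrite integralZr//=; last exact: ig.
by rewrite big_ord_recl EFinM /Rintegral fineK// integrable_fin_num//; exact: ig.
Qed.

End Tensor.

(** * Bumps and Haar functions on the line *)

Section Jets.
Variable R : realType.

(** A smooth function is carried together with the sequence of its derivatives, so that supports and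
    bounds can be stated for all orders at once. *)
Definition jet (u : nat -> R -> R) := forall n (x : R), is_derive x 1 (u n) (u n.+1 x).

Definition supp01 (u : nat -> R -> R) := forall n x, ~~ (0 < x < 1) -> u n x = 0.

Lemma is_derive_quadratic_zero (f : R -> R) (x C : R) :
  f x = 0 -> (forall h, `|f (x + h)| <= C * h ^+ 2) -> is_derive x 1 f 0.
Proof.
move=> fx0 fC.
have C0 : 0 <= C.
  by have := fC 1; rewrite expr1n mulr1; exact: le_trans.
have lim : (fun h => h^-1 *: (f (h *: 1 + x) - f x)) @ 0^' --> (0 : R).
  apply/cvgrPdist_le => e e0.
  have C1 : 0 < C + 1 by rewrite ltr_wpDl.
  near=> h; rewrite fx0 subr0 sub0r normrN.
  have h0 : h != 0 by near: h; exact: nbhs_dnbhs_neq.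
  rewrite -[h *: 1]/(h * 1) mulr1 addrC normrZ normfV.
  have hn : 0 < `|h| by rewrite normr_gt0.
  rewrite mulrC ler_pdivrMr//; apply: (le_trans (fC h)).
  rewrite -real_normK ?num_real// expr2 mulrA ler_pM2r//.
  apply: (@le_trans _ _ ((C + 1) * `|h|)).
    by rewrite ler_pM2r// lerDl.
  rewrite mulrC -ler_pdivlMr//.
  near: h; exact: (dnbhs0_le (divr_gt0 e0 C1)).
apply: DeriveDef.
  by apply/cvg_ex; exists 0.
exact: cvg_lim lim.
Unshelve. all: by end_near. Qed.

Lemma jet_continuous u n : jet u -> continuous (u n).
Proof.
move=> ju x; have [d _] := ju n x.
by apply: differentiable_continuous; exact/derivable1_diffP.
Qed.

Definition bumpY : {poly R} := 'X * (1 - 'X).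

(** The bump is exp(-1/Y) with Y = x(1 - x). Its n-th derivative has the form P_n Y^(-2n) exp(-1/Y),
    and differentiating this form once more gives the recursion for P_n. *)
Fixpoint bumpP n : {poly R} :=
  if n is n'.+1 then
    (bumpP n')^`() * bumpY ^+ 2 - (n'.*2)%:R%:P * (bumpP n' * bumpY^`() * bumpY)
    + bumpP n' * bumpY^`()
  else 1.

Definition bump_core n (x : R) : R :=
  (bumpP n).[x] * (bumpY.[x] ^+ n.*2)^-1 * expR (- (bumpY.[x])^-1).

Definition bump_fun n (x : R) : R := if 0 < x < 1 then bump_core n x else 0.

Lemma bumpPS_horner n x : (bumpP n.+1).[x] =
  (bumpP n)^`().[x] * bumpY.[x] ^+ 2
  - n.*2%:R * ((bumpP n).[x] * bumpY^`().[x] * bumpY.[x])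
  + (bumpP n).[x] * bumpY^`().[x].
Proof.
rewrite /=; move: (bumpP n) bumpY => p q.
by rewrite !(hornerD, hornerN, hornerM, hornerC, horner_exp).
Qed.

Lemma bumpYE x : bumpY.[x] = x * (1 - x).
Proof. by rewrite /bumpY !hornerE. Qed.

Lemma bumpY_gt0 x : 0 < x < 1 -> 0 < bumpY.[x].
Proof. by move=> /andP[x0 x1]; rewrite bumpYE mulr_gt0 ?subr_gt0. Qed.

Lemma is_derive_horner (p : {poly R}) (x : R) : is_derive x 1 (horner p) (p^`()).[x].
Proof.
apply: DeriveDef; first exact: derivable_horner.
by rewrite derivE derive1E.
Qed.

Lemma is_derive_bump_core n (x : R) : 0 < x < 1 ->
  is_derive x 1 (bump_core n) (bump_core n.+1 x).
Proof.
move=> x01; have Y0 := bumpY_gt0 x01.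
have dP := is_derive_horner (bumpP n) x.
have dY := is_derive_horner bumpY x.
have Yn0 : bumpY.[x] != 0 by rewrite gt_eqF.
have dYX := is_deriveX n.*2 dY.
have YXn0 : (horner bumpY ^+ n.*2) x != 0 by rewrite exprfctE expf_neq0.
have dV := is_deriveV YXn0 dYX.
have dYV := is_deriveV Yn0 dY.
have dN := is_deriveN dYV.
have dE : is_derive x 1 (expR \o (- (fun y => bumpY.[y]^-1))) _ :=
  is_derive1_comp (is_derive_expR _) dN.
have := is_deriveM (is_deriveM dP dV) dE.
set g := (X in is_derive x 1 X _) => dg.
have -> : bump_core n = g.
  by apply/funext => y; rewrite /g /bump_core /= exprfctE.
apply: is_derive_eq dg _; rewrite /bump_core bumpPS_horner /= !exprfctE /GRing.scale /=.
set y := bumpY.[x]; set y' := (bumpY^`()).[x]; set P := (bumpP n).[x]; set P' := ((bumpP n)^`()).[x].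
rewrite -[(horner _ * _) x]/(P * (y ^+ n.*2)^-1) -[(- _) x]/(- y^-1).
have -> : n.*2%:R * y ^+ n.*2.-1 = n.*2%:R * y ^+ n.*2 / y.
  by case: (n.*2) => [|k]; rewrite ?mul0r// exprSr/= -mulrA mulfK.
rewrite doubleS !exprSr.
have : y ^+ n.*2 != 0 by rewrite expf_neq0.
set z := y ^+ n.*2; set e := expR _; move=> z0.
by field; rewrite z0 Yn0.
Qed.

(** With t = 1/Y the exponential series gives e^t >= t^(2n+2) / (2n+2)!, which absorbs Y^(-2n) and
    leaves Y^2. The quadratic decay makes the glued function differentiable at the endpoints. *)
Lemma bump_core_bound n : exists2 C : R, 0 <= C &
  forall x, 0 < x < 1 -> `|bump_core n x| <= C * bumpY.[x] ^+ 2.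
Proof.
have [M hM] : exists M : R, forall x, 0 <= x <= 1 -> `|(bumpP n).[x]| <= M.
  have [|M _ HM] := @EVT_max R (fun x => `|(bumpP n).[x]|) 0 1 ler01.
    apply: continuous_subspaceT => x.
    apply: cvg_norm; apply: differentiable_continuous.
    by apply/derivable1_diffP; exact: derivable_horner.
  by exists `|(bumpP n).[M]| => x x01; exact: HM.
exists (M * (n.*2.+2)`!%:R).
  rewrite mulr_ge0// ?ler0n//; apply: le_trans (hM 0 _) => //.
  by rewrite lexx ler01.
move=> x x01; have Y0 := bumpY_gt0 x01.
rewrite /bump_core 2!normrM -mulrA -[leRHS]mulrA.
apply: ler_pM => //.
- by apply: hM; case/andP: x01 => /ltW -> /ltW ->.
set y := bumpY.[x] in Y0 *.
rewrite (ger0_norm (expR_ge0 _)) ger0_norm ?invr_ge0 ?exprn_ge0 ?(ltW Y0)//.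
have yV0 : 0 <= y^-1 by rewrite invr_ge0 ltW.
have := expR_ge1Dxn n.*2.+1 yV0.
set f := (_`!%:R : R) => h.
have f0 : 0 < f by rewrite ltr0n fact_gt0.
have h1 : y ^- n.*2.+2 / f <= expR y^-1.
  by apply: le_trans h; rewrite exprVn lerDr.
move: h1; rewrite expRN ler_pdivrMr// => h1.
rewrite ler_pdivrMr ?expR_gt0//.
have -> : y ^- n.*2 = y ^+ 2 * y ^- n.*2.+2.
  have := gt_eqF Y0; move=> /negbT y0.
  by rewrite !exprSr; field; rewrite y0 expf_neq0.
rewrite [leRHS]mulrAC [leLHS]mulrC ler_pM2r ?exprn_gt0//.
by rewrite mulrC.
Qed.

Lemma bump_jet : jet bump_fun.
Proof.
move=> n x; have [x01|x01] := boolP (0 < x < 1).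
  have dx := is_derive_bump_core n x01; rewrite {2}/bump_fun x01.
  apply: near_eq_is_derive dx.
  have xin : x \in `]0, 1[ by rewrite in_itv.
  apply: filterS (near_in_itvoo xin) => y.
  by rewrite in_itv /bump_fun /= => ->.
rewrite {2}/bump_fun (negbTE x01).
have [C C0 hC] := bump_core_bound n.
apply: (@is_derive_quadratic_zero _ _ C).
  by rewrite /bump_fun (negbTE x01).
move=> h; rewrite /bump_fun; case: ifPn => [/[dup] xh01 /andP[xh0 xh1]|_]; last first.
  by rewrite normr0 mulr_ge0 ?sqr_ge0.
apply: (le_trans (hC _ xh01)); rewrite ler_wpM2l//.
rewrite -[leRHS]real_normK ?num_real//.
rewrite ler_pXn2r ?nnegrE ?(ltW (bumpY_gt0 xh01))//.
(* If [x] lies outside (0,1) and [x + h] inside, the distance of [x + h] to the endpoint between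
   them is at most |h|, and so is Y. *)
rewrite bumpYE; move: x01; rewrite negb_and -!leNgt => /orP[x0|x1].
  rewrite ger0_norm; last by lra.
  nra.
rewrite ler0_norm; last by lra.
nra.
Qed.

Lemma bump_supp : supp01 bump_fun.
Proof. by move=> n x /negbTE x01; rewrite /bump_fun x01. Qed.

Lemma bump_gt0 x : 0 < x < 1 -> 0 < bump_fun 0 x.
Proof.
move=> x01; rewrite /bump_fun x01 /bump_core /= hornerC expr0 invr1 !mul1r.
exact: expR_gt0.
Qed.

Lemma is_derive0_cst (f : R -> R) : (forall x : R, is_derive x 1 f 0) ->
  forall x y, f x = f y.
Proof.
move=> df; suff H x y : x < y -> f x = f y.
  by move=> x y; have [/H|/H|->] := ltgtP x y.
move=> xy; have [|c _] := @MVT R f (fun=> 0) x y xy (fun z _ => df z).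
  apply: continuous_subspaceT => z; have [d _] := df z.
  by apply: differentiable_continuous; exact/derivable1_diffP.
by rewrite mul0r => /eqP; rewrite subr_eq0 => /eqP.
Qed.

(** If the next derivative vanished identically, the present one would be constant, hence equal to
    its value 0 at the origin. *)
Lemma bump_neq0 n : exists x, bump_fun n x != 0.
Proof.
elim: n => [|n [x xn0]].
  exists 2^-1; rewrite gt_eqF// bump_gt0//; lra.
apply: contrapT => /forallNP h.
have h0 y : bump_fun n.+1 y = 0 by apply/eqP; apply: contrapT => /negP; exact: h.
have := @is_derive0_cst (bump_fun n) _ x 0.
rewrite (bump_supp n (x := 0)) ?ltxx// => H; move/eqP: xn0; apply; apply: H => y.
by rewrite -(h0 y); exact: bump_jet.
Qed.

Lemma jet_affine u (s b : R) : jet u -> jet (fun n x => s ^+ n * u n (s * x - b)).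
Proof.
move=> ju n x.
have dl : is_derive x 1 (fun y : R => s * y - b) s.
  have h := is_deriveB (is_deriveZ s (is_derive_id x 1)) (is_derive_cst b x 1).
  by apply: is_derive_eq h _; rewrite /GRing.scale/= mulr1 subr0.
have h := is_deriveZ (s ^+ n) (@is_derive1_comp R (u n) (fun y => s * y - b) x _ _ (ju n _) dl).
by apply: is_derive_eq h _; rewrite /GRing.scale/= exprSr; ring.
Qed.

(* Since some point has nonvanishing [n]-th bump derivative, dilating by 2
   around it moves that point to 1/2 while keeping the support in (0,1). *)
Lemma wavelet_exists n :
  exists w, [/\ jet w, supp01 w & w n 2^-1 != 0].
Proof.
have [x0 x0n] := bump_neq0 n.
have x001 : 0 < x0 < 1 by apply: contraNT x0n => /(bump_supp n) ->.
exists (fun k x => 2 ^+ k * bump_fun k (2 * x - (1 - x0))); split.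
- exact/jet_affine/bump_jet.
- move=> k x x01; rewrite bump_supp ?mulr0//.
  apply: contraNN x01 => /andP[h1 h2]; move/andP: x001 => [h3 h4]; lra.
- rewrite mulf_neq0 ?expf_neq0//.
  by rewrite (_ : 2 * 2^-1 - (1 - x0) = x0)//; field.
Qed.

Lemma jet_bounded u n : jet u -> supp01 u -> exists2 M, 0 <= M & forall x, `|u n x| <= M.
Proof.
move=> ju su.
have [|c _ hc] := @EVT_max R (fun x => `|u n x|) 0 1 ler01.
  apply: continuous_subspaceT => x; apply: cvg_norm.
  exact: jet_continuous.
exists `|u n c| => // x.
have [x01|x01] := boolP (0 < x < 1); last by rewrite su// normr0.
by apply: hc; rewrite in_itv/=; case/andP: x01 => /ltW -> /ltW ->.
Qed.

Lemma jet_measurable u n : jet u -> measurable_fun setT (u n).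
Proof. by move=> ju; apply: continuous_measurable_fun; exact: jet_continuous. Qed.

End Jets.

Section OneDim.
Variable R : realType.
Local Notation leb := (@lebesgue_measure R).

Definition cell (y : R) : R := (0 <= y < 1)%R%:R.

Definition haar (y : R) : R := (0 <= y < 2^-1)%R%:R - (2^-1 <= y < 1)%R%:R.

Lemma indicator_affine (s b u v : R) : 0 < s ->
  (fun x : R => (u <= s * x - b < v)%R%:R : R)
    = \1_(`[(b + u) / s, (b + v) / s[%classic).
Proof.
move=> s0; apply/funext => x; rewrite indicE mem_setE in_itv/=; congr (nat_of_bool _)%:R.
by rewrite ler_pdivrMr// ltr_pdivlMr// lerBrDl ltrBlDl (mulrC x).
Qed.

Lemma integral_indicator_affine (s b u v : R) : 0 < s -> u <= v ->
  (\int[leb]_x ((u <= s * x - b < v)%R%:R : R)%:E = ((v - u) / s)%:E)%E.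
Proof.
move=> s0 uv.
under eq_integral => x _ do rewrite (congr1 (fun f => f x) (indicator_affine b u v s0)).
rewrite integral_indic//= setIT lebesgue_measure_itv/= lte_fin.
case: ifPn => [_|]; first by rewrite -EFinB; congr EFin; field; rewrite gt_eqF.
rewrite -leNgt ler_pM2r ?invr_gt0// lerD2l => vu.
by rewrite (@le_anti _ _ u v) ?uv// subrr mul0r.
Qed.

Lemma measurable_indicator_affine (s b u v : R) : 0 < s ->
  measurable_fun setT (fun x : R => (u <= s * x - b < v)%R%:R : R).
Proof. by move=> s0; rewrite indicator_affine//; exact: measurable_indic. Qed.

Lemma integral_cell (s b : R) : 0 < s ->
  (\int[leb]_x (cell (s * x - b))%:E = (s^-1)%:E)%E.
Proof. by move=> s0; rewrite integral_indicator_affine// subr0 mul1r. Qed.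

Lemma measurable_cell (s b : R) : 0 < s ->
  measurable_fun setT (fun x : R => cell (s * x - b)).
Proof. exact: measurable_indicator_affine. Qed.

Lemma cell_ge0 y : 0 <= cell y.
Proof. by rewrite /cell; case: (_ && _). Qed.

Lemma cell_le1 y : cell y <= 1.
Proof. by rewrite /cell; case: (_ && _). Qed.

Lemma integrable_cell_bound (f : R -> R) (C s b : R) : 0 < s ->
  measurable_fun setT f -> (forall x, `|f x| <= C * cell (s * x - b)) ->
  leb.-integrable setT (EFin \o f).
Proof.
move=> s0 mf hf.
have ic : leb.-integrable setT (fun x => (cell (s * x - b))%:E).
  apply/integrableP; split.
    by apply/measurable_EFinP; exact: measurable_cell.
  under eq_integral do rewrite /= ger0_norm ?cell_ge0//.
  by rewrite integral_cell// ltry.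
apply: (le_integrable measurableT _ _ (integrableZl measurableT C ic)).
  by apply/measurable_EFinP; exact: mf.
move=> x _ /=; rewrite lee_fin; apply: (le_trans (hf x)); exact: ler_norm.
Qed.

Lemma measurable_haar (s b : R) : 0 < s ->
  measurable_fun setT (fun x : R => haar (s * x - b)).
Proof.
move=> s0; apply: measurable_funB; exact: measurable_indicator_affine.
Qed.

Lemma haar_sq y : haar y ^+ 2 = cell y.
Proof.
rewrite /haar /cell.
have [y0|y0] := leP 0 y => /=; last first.
  by rewrite [2^-1 <= y]leNgt (lt_trans y0)//= subr0 expr0n.
have [y1|y1] := ltP y 2^-1 => /=.
  by rewrite (lt_trans y1) ?subr0 ?expr1n//; lra.
by case: (y < 1); rewrite ?subr0 ?sub0r ?sqrrN ?expr1n ?expr0n.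
Qed.

Lemma normr_haar y : `|haar y| = cell y.
Proof.
rewrite -[LHS]sqrtr_sqr haar_sq /cell.
by case: (_ && _); rewrite ?sqrtr1 ?sqrtr0.
Qed.

Lemma integrable_haar (s b : R) : 0 < s ->
  leb.-integrable setT (EFin \o (fun x => haar (s * x - b))).
Proof.
move=> s0; apply: (@integrable_cell_bound _ 1 s b) => //.
  exact: measurable_haar.
by move=> x; rewrite normr_haar mul1r.
Qed.

Lemma integrable_indicator_affine (s b u v : R) : 0 < s -> u <= v ->
  leb.-integrable setT (EFin \o (fun x : R => (u <= s * x - b < v)%R%:R : R)).
Proof.
move=> s0 uv; apply/integrableP; split.
  by apply/measurable_EFinP; exact: measurable_indicator_affine.
under eq_integral do rewrite /= ger0_norm//.
by rewrite integral_indicator_affine// ltry.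
Qed.

Lemma Rintegral_haar (s b : R) : 0 < s -> \int[leb]_x haar (s * x - b) = 0.
Proof.
move=> s0; rewrite /haar RintegralB//; last 2 first.
- by apply: integrable_indicator_affine => //; rewrite invr_ge0.
- by apply: integrable_indicator_affine => //; lra.
rewrite /Rintegral !integral_indicator_affine//=; [|lra..].
by rewrite -mulrBl (_ : (_ - _ = 0)) ?mul0r//; field.
Qed.

(* On a dyadic cell of a finer generation a coarser Haar function is constant. *)
Lemma haar_coarse (g : R -> R) (N : nat) (nu nu' : int) (t : R) :
  (forall y, ~~ (0 <= y < 1) -> g y = 0) -> (0 < N)%N ->
  g (t - nu%:~R) * haar (t / N.*2%:R - nu'%:~R)
  = haar (nu%:~R / N.*2%:R - nu'%:~R) * g (t - nu%:~R).
Proof.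
move=> g0 N0; have [t01|t01] := boolP (0 <= t - nu%:~R < 1); last first.
  by rewrite g0// mul0r mulr0.
rewrite mulrC; congr (_ * _).
have M0 : 0 < N.*2%:R :> R by rewrite ltr0n double_gt0.
have le_int (z : int) : (z%:~R <= t) = (z <= nu).
  move/andP: t01 => [h1 h2]; apply/idP/idP => h.
    rewrite -ltzD1 -(ltr_int R) rmorphD/=.
    by apply: (le_lt_trans h); rewrite -ltrBlDl.
  by apply: (@le_trans _ _ nu%:~R); rewrite ?ler_int// -subr_ge0.
(* In the variable [t] the breakpoints 0, 1/2, 1 of the coarse function become integers, the middle
   one because the ratio of scales is even. Comparing an integer with [t] is the same as comparing
   it with [nu]. *)
have E (z : int) (x : R) : (z%:~R / N.*2%:R <= x / N.*2%:R - nu'%:~R)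
    = ((z + nu' * N.*2%:Z)%:~R <= x).
  rewrite lerBrDr ler_pdivlMr// mulrDl divfK ?gt_eqF// rmorphD rmorphM/=.
  by rewrite -[nu'%:~R * _]mulrC mulrC.
have key (z : int) : (z%:~R / N.*2%:R <= t / N.*2%:R - nu'%:~R)
    = ((z%:~R / N.*2%:R : R) <= nu%:~R / N.*2%:R - nu'%:~R).
  by rewrite (E z t) le_int (E z nu%:~R) ler_int.
have k0 := key 0; have kN := key N%:Z; have kM := key N.*2%:Z.
move: k0 kN kM; rewrite !mul0r.
have -> : (N%:Z%:~R / N.*2%:R = 2^-1 :> R).
  by rewrite -muln2 natrM -pmulrn invfM mulrA mulfV ?mul1r// pnatr_eq0 -lt0n.
have -> : (N.*2%:Z%:~R / N.*2%:R = 1 :> R).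
  by rewrite -pmulrn mulfV// gt_eqF.
move=> k0 kN kM.
by rewrite /haar k0 kN !ltNge kN kM.
Qed.

End OneDim.

(** * Integration by parts and wavelets against Haar functions *)

Section JetIntegrals.
Variable R : realType.
Local Notation RR := (measurableTypeR R).
Local Notation leb := (@lebesgue_measure R).
Implicit Types u v w : nat -> R -> R.

Lemma integral_derivative (F f : R -> R) (a c : R) :
  (forall x : R, is_derive x 1 F (f x)) -> continuous f -> a < c ->
  \int[leb]_x (f x * (a <= x < c)%R%:R) = F c - F a.
Proof.
move=> dF cf ac.
have cF : continuous F.
  move=> x; have [d _] := dF x.
  by apply: differentiable_continuous; exact/derivable1_diffP.
have mu : measurable_fun (setT : set RR) f by exact: continuous_measurable_fun.
have -> : \int[leb]_x (f x * (a <= x < c)%R%:R) = \int[leb]_(x in `[a, c[) f x.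
  rewrite [RHS]Rintegral_mkcond; apply: eq_Rintegral => x _.
  by rewrite patchE mem_setE in_itv/=; case: ifP; rewrite ?mulr1 ?mulr0.
rewrite Rintegral_itv_bndo_bndc//; last first.
  apply: (@integrableS _ _ _ leb `[a, c]%classic) => //.
    by apply: subset_itvl; rewrite bnd_simp.
  apply: continuous_compact_integrable; first exact: segment_compact.
  exact: continuous_subspaceT.
rewrite /Rintegral (@continuous_FTC2 _ _ F)//.
- exact: continuous_subspaceT.
- split; first by move=> x _; have [] := dF x.
  + by apply: cvg_at_right_filter; exact: cF.
  + by apply: cvg_at_left_filter; exact: cF.
- by move=> x _; rewrite derive1E; have [_] := dF x.
Qed.

Definition csupp u (s b : R) := forall n x, ~~ (0 < s * x - b < 1) -> u n x = 0.

Lemma affine_csupp u (s b : R) : supp01 u ->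
  csupp (fun n x => s ^+ n * u n (s * x - b)) s b.
Proof. by move=> su n x h; rewrite su ?mulr0. Qed.

Lemma csupp_integrable (f : R -> R) (s b : R) : 0 < s -> continuous f ->
  (forall x, ~~ (0 < s * x - b < 1) -> f x = 0) ->
  leb.-integrable setT (EFin \o f).
Proof.
move=> s0 cf f0.
have ac : b / s <= (b + 1) / s by rewrite ler_pM2r ?invr_gt0//; lra.
have [|c _ hc] := @EVT_max R (fun x => `|f x|) _ _ ac.
  by apply: continuous_subspaceT => x; apply: cvg_norm; exact: cf.
apply: (@integrable_cell_bound _ _ `|f c| s b) => //.
  exact: continuous_measurable_fun.
move=> x; have [x01|x01] := boolP (0 < s * x - b < 1); last first.
  by rewrite f0// normr0 mulr_ge0// cell_ge0.
have [h0 h1] := andP x01.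
rewrite /cell (ltW h0) h1 mulr1; apply: hc.
by rewrite in_itv/= ler_pdivrMr// ler_pdivlMr// (mulrC x s); apply/andP; split; lra.
Qed.

Lemma integral_csupp_derivative (F f : R -> R) (s b : R) : 0 < s ->
  (forall x : R, is_derive x 1 F (f x)) -> continuous f ->
  (forall x, ~~ (0 < s * x - b < 1) -> F x = 0) ->
  (forall x, ~~ (0 < s * x - b < 1) -> f x = 0) ->
  \int[leb]_x f x = 0.
Proof.
move=> s0 dF cf F0 f0.
have -> : \int[leb]_x f x = \int[leb]_x (f x * (b / s <= x < (b + 1) / s)%R%:R).
  apply: eq_Rintegral => x _; case: (boolP (b / s <= x < (b + 1) / s)) => h; rewrite ?mulr1// mulr0.
  apply: f0; apply: contraNN h => /andP[h0 h1].
  by rewrite ler_pdivrMr// ltr_pdivlMr// (mulrC x s); apply/andP; split; lra.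
rewrite (integral_derivative dF cf); last first.
  by rewrite ltr_pM2r ?invr_gt0//; lra.
have E z : s * (z / s) = z by field; rewrite gt_eqF.
rewrite !F0 ?subrr// E; first by rewrite subrr ltxx.
by rewrite (_ : b + 1 - b = 1) ?ltxx ?andbF//; ring.
Qed.

Lemma jet_byparts u v n m (s b : R) : 0 < s -> jet u -> jet v -> csupp u s b ->
  \int[leb]_x (u n x * v m.+1 x) = - \int[leb]_x (u n.+1 x * v m x).
Proof.
move=> s0 ju jv su.
have cu k : continuous (u k) by exact: jet_continuous.
have cv k : continuous (v k) by exact: jet_continuous.
have cuv k l : continuous (fun x => u k x * v l x).
  by move=> x; apply: cvgM; [exact: cu|exact: cv].
have iuv k l : leb.-integrable setT (EFin \o (fun x => u k x * v l x)).
  apply: (@csupp_integrable _ s b s0 (cuv k l)) => x h.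
  by rewrite su// mul0r.
apply/eqP; rewrite -subr_eq0 opprK addrC -RintegralD//=; apply/eqP.
apply: (@integral_csupp_derivative (fun x => u n x * v m x) _ s b) => //.
- move=> x; have := is_deriveM (ju n x) (jv m x); move=> h.
  by apply: is_derive_eq h _; rewrite /GRing.scale/=; ring.
- by move=> x; apply: cvgD; exact: cuv.
- by move=> x h; rewrite su// mul0r.
- by move=> x h; rewrite !su// !mul0r addr0.
Qed.

Lemma jet_byparts_iter u v n (s b : R) : 0 < s -> jet u -> jet v -> csupp u s b ->
  \int[leb]_x (u 0 x * v n x) = (-1) ^+ n * \int[leb]_x (u n x * v 0 x).
Proof.
move=> s0 ju jv su.
suff H k : \int[leb]_x (u k x * v n x) = (-1) ^+ n * \int[leb]_x (u (k + n)%N x * v 0 x) by rewrite H.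
elim: n k => [|n IH] k; first by rewrite expr0 mul1r addn0.
by rewrite (jet_byparts _ _ s0 ju jv su) IH addSnnS exprS mulN1r mulNr.
Qed.

Section Wavelet.
Variables (w : nat -> R -> R) (lam : nat).
Hypotheses (jw : jet w) (sw : supp01 w).

Lemma continuous_affine_jet n (s b : R) : continuous (fun x => w n (s * x - b)).
Proof.
move=> x; apply: (@continuous_comp _ _ _ (fun x => s * x - b) (w n)).
  apply: cvgB; last exact: cvg_cst.
  by apply: cvgM; [exact: cvg_cst|exact: cvg_id].
exact: jet_continuous.
Qed.

Lemma is_derive_affine_jet n (s b x : R) : 0 < s ->
  is_derive x 1 (fun x : R => s^-1 * w n (s * x - b)) (w n.+1 (s * x - b)).
Proof.
move=> s0; have jA := @jet_affine R w s b jw.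
have h := is_deriveZ (s^-1 * (s ^+ n)^-1) (jA n x).
have sn0 : s ^+ n != 0 by rewrite expf_neq0// gt_eqF.
have s0' : s != 0 by rewrite gt_eqF.
set g := (X in is_derive _ _ X _) in h.
rewrite (_ : (fun x : R => _) = g).
  apply: is_derive_eq h _; rewrite /GRing.scale/= exprSr.
  by field; rewrite sn0 s0'.
apply/funext => y; rewrite /g.
rewrite -[RHS]/(s^-1 * (s ^+ n)^-1 * (s ^+ n * w n (s * y - b))).
by field; rewrite sn0 s0'.
Qed.

Lemma integral_wavelet (s b : R) : 0 < s ->
  \int[leb]_x w lam.+1 (s * x - b) = 0.
Proof.
move=> s0.
apply: (@integral_csupp_derivative (fun x => s^-1 * w lam (s * x - b)) _ s b) => //.
- by move=> x; exact: is_derive_affine_jet.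
- exact: continuous_affine_jet.
- by move=> x h; rewrite sw// mulr0.
- by move=> x h; rewrite sw.
Qed.

(** The fundamental theorem of calculus on the two halves of the cell leaves only the midpoint
    value, counted twice, since the primitive vanishes at both ends. *)
Lemma integral_wavelet_haar (s b : R) : 0 < s ->
  \int[leb]_x (w lam.+1 (s * x - b) * haar (s * x - b)) = 2 * w lam 2^-1 / s.
Proof.
move=> s0.
have E (p q : R) x : (p <= s * x - b < q) = ((b + p) / s <= x < (b + q) / s).
  by rewrite ler_pdivrMr// ltr_pdivlMr// lerBrDl ltrBlDl (mulrC x).
have I (p q : R) : p < q -> \int[leb]_x (w lam.+1 (s * x - b) * (p <= s * x - b < q)%R%:R)
    = s^-1 * w lam q - s^-1 * w lam p.
  move=> pq.
  under eq_Rintegral do rewrite E.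
  have F z : s * ((b + z) / s) - b = z by field; rewrite gt_eqF.
  rewrite (integral_derivative (fun x => is_derive_affine_jet lam b x s0)
    (@continuous_affine_jet _ s b)) ?F//.
  by rewrite ltr_pM2r ?invr_gt0// ltrD2l.
have J (p q : R) : leb.-integrable setT (EFin \o (fun x => w lam.+1 (s * x - b) * (p <= s * x - b < q)%R%:R)).
  have i0 : leb.-integrable setT (EFin \o (fun x => w lam.+1 (s * x - b))).
    apply: (@csupp_integrable _ s b s0 (@continuous_affine_jet _ s b)) => x h.
    by rewrite sw.
  apply: (le_integrable measurableT _ _ i0).
    apply/measurable_EFinP; apply: measurable_funM.
      by have /measurable_int/measurable_EFinP := i0.
    exact: measurable_indicator_affine.
  move=> x _ /=; rewrite lee_fin normrM ler_piMr//.
  by case: (_ && _); rewrite ?normr1 ?normr0.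
rewrite /haar; under eq_Rintegral do rewrite mulrBr.
rewrite RintegralB// !I; [|lra..].
have -> : w lam 0 = 0 by rewrite sw// ltxx.
have -> : w lam 1 = 0 by rewrite sw// ltxx andbF.
by field; rewrite gt_eqF.
Qed.

End Wavelet.

End JetIntegrals.

(** * Besov norms of atomic sums *)

Section FiniteDifferences.
Variable R : realType.
Implicit Types u v w : nat -> R -> R.

Definition fd1 (l : nat) (h : R) (f : R -> R) (x : R) : R :=
  \sum_(k < l.+1) (-1) ^+ (l - k) * 'C(l, k)%:R * f (x + k%:R * h).

Lemma fd1S l h (f : R -> R) x :
  fd1 l.+1 h f x = fd1 l h (fun y => f (y + h) - f y) x.
Proof.
have -> : fd1 l h (fun y => f (y + h) - f y) x = fd1 l h f (x + h) - fd1 l h f x.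
  rewrite /fd1 -sumrB; apply: eq_bigr => k _.
  by rewrite mulrBr; congr (_ * f _ - _); ring.
rewrite /fd1 big_ord_recl.
have -> : \sum_(k < l.+1) (-1) ^+ (l.+1 - lift ord0 k) * 'C(l.+1, lift ord0 k)%:R
      * f (x + (lift ord0 k)%:R * h)
    = \sum_(k < l.+1) (-1) ^+ (l - k) * 'C(l, k)%:R * f (x + h + k%:R * h)
      + \sum_(k < l.+1) (-1) ^+ (l - k) * 'C(l, k.+1)%:R * f (x + k.+1%:R * h).
  rewrite -big_split; apply: eq_bigr => k _ /=.
  rewrite /bump leq0n add1n subSS binS natrD.
  rewrite (_ : x + h + k%:R * h = x + k.+1%:R * h); last by rewrite -natr1; ring.
  by ring.
rewrite addrCA; congr (_ + _).
have C0 : 'C(l, l.+1)%:R = 0 :> R by rewrite bin_small.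
rewrite [in LHS]big_ord_recr /= C0 mulr0 mul0r addr0 [in RHS]big_ord_recl/=.
rewrite opprD !subn0 !bin0 exprS; congr (_ + _); first by ring.
rewrite -sumrN; apply: eq_bigr => k _; rewrite /bump leq0n add1n.
by rewrite -(subnSK (ltn_ord k)) exprS; ring.
Qed.

Lemma fd1_bound_crude l h (f : R -> R) M x : (forall y, `|f y| <= M) ->
  `|fd1 l h f x| <= 2 ^+ l * M.
Proof.
elim: l f M x => [|l IH] f M x hf.
  by rewrite /fd1 big_ord1 subnn bin0 !mul1r.
rewrite fd1S exprSr -mulrA; apply: IH => y.
by rewrite mulrDl mul1r; apply: (le_trans (ler_normB _ _)); exact: lerD.
Qed.

(** A first difference of a jet is again a jet, so induction applies to it; the mean value theorem
    trades each difference for a factor |h| and one derivative. *)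
Lemma fd1_bound_jet l h u M x : jet u -> (forall y, `|u l y| <= M) ->
  `|fd1 l h (u 0) x| <= `|h| ^+ l * M.
Proof.
elim: l u M x => [|l IH] u M x ju hM.
  by rewrite /fd1 big_ord1 subnn bin0 !mul1r mul0r addr0.
rewrite fd1S exprSr -mulrA.
apply: (IH (fun n y => u n (y + h) - u n y)).
  move=> n y.
  have dl : is_derive y 1 (fun y : R => y + h) 1.
    have e := is_deriveD (is_derive_id y 1) (is_derive_cst h y 1).
    by apply: is_derive_eq e _; rewrite addr0.
  have e := is_deriveB (@is_derive1_comp R (u n) (fun y => y + h) y _ _ (ju n _) dl) (ju n y).
  by apply: is_derive_eq e _; rewrite mulr1.
move=> y.
have cu : continuous (u l) by exact: jet_continuous.
have H (a b : R) : a < b -> `|u l b - u l a| <= (b - a) * M.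
  move=> ab; have [|c _ ->] := @MVT R (u l) (u l.+1) a b ab (fun z _ => ju l z).
    exact: continuous_subspaceT.
  rewrite normrM mulrC (gtr0_norm (_ : 0 < b - a)) ?subr_gt0//.
  by rewrite ler_pM2l ?subr_gt0.
have [h0|h0|->] := ltgtP h 0; last by rewrite addr0 subrr normr0 mul0r.
  rewrite distrC; apply: (le_trans (H _ _ _)); first by lra.
  by rewrite ltr0_norm// (_ : y - (y + h) = - h)//; ring.
apply: (le_trans (H _ _ _)); first by lra.
by rewrite gtr0_norm// (_ : (y + h) - y = h)//; ring.
Qed.

(** The crude bound serves for |h| >= 1 and the derivative bound for |h| < 1. The sum of cells
    records that the difference vanishes unless one of its l + 1 nodes meets the support. *)
Lemma fd1_bound w n l : jet w -> supp01 w -> exists2 C, 0 <= C &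
  forall h y, `|fd1 l h (w n) y|
    <= C * Num.min 1 `|h| ^+ l * \sum_(k < l.+1) cell (y + k%:R * h).
Proof.
move=> jw sw.
have [M0 M00 hM0] := jet_bounded n jw sw.
have [Ml Ml0 hMl] := jet_bounded (n + l)%N jw sw.
exists (2 ^+ l * M0 + Ml); first by rewrite addr_ge0// mulr_ge0// exprn_ge0.
move=> h y.
have b1 := fd1_bound_crude l h y hM0.
have b2 : `|fd1 l h (w n) y| <= `|h| ^+ l * Ml.
  have := @fd1_bound_jet l h (fun k => w (n + k)%N) Ml y; rewrite addn0; apply=> //.
  by move=> k x; rewrite addnS; exact: jw.
have b : `|fd1 l h (w n) y| <= (2 ^+ l * M0 + Ml) * Num.min 1 `|h| ^+ l.
  have [h1|h1] := leP 1 `|h|.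
    by rewrite expr1n mulr1 (le_trans b1)// lerDl.
  rewrite mulrC; apply: (le_trans b2); rewrite ler_wpM2l ?exprn_ge0// lerDr.
  by rewrite mulr_ge0// exprn_ge0.
have [/existsP[k hk]|/existsPn nk] := boolP [exists k : 'I_l.+1, 0 < y + k%:R * h < 1].
  apply: (le_trans b); rewrite ler_peMr//.
    by apply: le_trans b.
  rewrite (bigD1 k)//= {1}/cell.
  case/andP: hk => /ltW -> ->; rewrite lerDl sumr_ge0// => i _; exact: cell_ge0.
rewrite /fd1 big1 ?normr0.
  have m0 : 0 <= Num.min 1 `|h| by rewrite le_min ler01 normr_ge0.
  apply: mulr_ge0; last by apply: sumr_ge0 => i _; exact: cell_ge0.
  by apply: mulr_ge0; [apply: addr_ge0 => //; exact: mulr_ge0|exact: exprn_ge0].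
by move=> k _; rewrite sw ?mulr0.
Qed.

End FiniteDifferences.

(** * A decay kernel, summable over dyadic scales and integrable for ds/s *)

Section Decay.
Variable R : realType.
Local Notation RR := (measurableTypeR R).
Local Notation leb := (@lebesgue_measure R).

(* A substitute for [min (s, 1/s) ^ del] with an explicit primitive for [ds / s],
   namely [4 / del * s^del / (1 + s^del)]. *)
Definition decay (del s : R) : R := 4 * s `^ del / (1 + s `^ del) ^+ 2.

Lemma decay_ge0 del s : 0 <= decay del s.
Proof.
by rewrite /decay divr_ge0// ?sqr_ge0// mulr_ge0 ?powR_ge0.
Qed.

Lemma min_le_decay_aux (u : R) : 0 < u -> Num.min u u^-1 <= 4 * u / (1 + u) ^+ 2.
Proof.
move=> u0; have u1 : 0 < (1 + u) ^+ 2 by rewrite exprn_gt0// addr_gt0.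
rewrite ler_pdivlMr// minEle; case: ifPn => h.
  have {}h : u * u <= 1 by rewrite -ler_pdivlMr// mul1r.
  have h1 : u <= 1 by rewrite leNgt; apply/negP => h1; nra.
  nra.
move: h; rewrite -ltNge => h.
have {}h : 1 < u * u by rewrite -ltr_pdivrMr// mul1r.
rewrite mulrC ler_pdivrMr//.
have h1 : 1 <= u by rewrite leNgt; apply/negP => h1; nra.
nra.
Qed.

Lemma decay_aux_le_min (u : R) : 0 < u -> 4 * u / (1 + u) ^+ 2 <= 4 * Num.min u u^-1.
Proof.
move=> u0; have u1 : 0 < (1 + u) ^+ 2 by rewrite exprn_gt0// addr_gt0.
rewrite ler_pdivrMr// -!mulrA ler_pM2l// minEle; case: ifPn => _; first nra.
by rewrite ler_pdivlMl//; nra.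
Qed.

(** For s >= 1 it suffices that a - del >= 0, and for s < 1 that l >= a + del. The gap between the
    order l and the smoothness a thus becomes decay on both sides of s = 1. *)
Lemma smoothness_le_decay (del a : R) (l : nat) (s : R) :
  0 < del -> del <= a -> del <= l%:R - a -> 0 < s ->
  Num.min 1 s ^+ l <= s `^ a * decay del s.
Proof.
move=> d0 da dl s0.
have u0 : 0 < s `^ del by exact: powR_gt0.
apply: (@le_trans _ _ (s `^ a * Num.min (s `^ del) (s `^ del)^-1)); last first.
  by rewrite ler_wpM2l ?powR_ge0//; exact: min_le_decay_aux.
rewrite -powRN.
have [s1|s1] := leP 1 s.
  rewrite expr1n minr_pMr ?powR_ge0// le_min -!powRD ?(gt_eqF s0) ?implybT//.
  by rewrite -(powRr0 s) !ler_powR//; lra.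
rewrite -powR_mulrn ?(ltW s0)//.
rewrite minr_pMr ?powR_ge0// le_min -!powRD ?(gt_eqF s0) ?implybT//.
by rewrite !ger_powR// ?s0 ?(ltW s1)//; lra.
Qed.

(** The kernel lies between min(s, 1/s)^del and 4 times it, and powers of this minimum only change
    the exponent; r <= 1 keeps 4^r below 4. *)
Lemma powR_decay (del s r : R) : 0 < s -> 0 < r -> r <= 1 ->
  decay del s `^ r <= 4 * decay (del * r) s.
Proof.
move=> s0 r0 r1.
have u0 : 0 < s `^ del by exact: powR_gt0.
have v0 : 0 < s `^ (del * r) by exact: powR_gt0.
apply: (@le_trans _ _ ((4 * Num.min (s `^ del) (s `^ del)^-1) `^ r)).
  rewrite ge0_ler_powR ?nnegrE ?(ltW r0) ?decay_ge0//.
    by rewrite mulr_ge0// le_min invr_ge0 !powR_ge0.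
  exact: decay_aux_le_min.
rewrite powRM ?le_min ?invr_ge0 ?powR_ge0//.
apply: ler_pM; rewrite ?powR_ge0//.
  by rewrite ler1_powR// ler1n.
apply: le_trans (min_le_decay_aux v0).
have e1 : (s `^ del) `^ r = s `^ (del * r) by rewrite -powRrM.
have e2 : (s `^ del)^-1 `^ r = (s `^ (del * r))^-1.
  by rewrite -!powRN -powRrM mulNr.
have m0 : 0 <= Num.min (s `^ del) (s `^ del)^-1.
  by rewrite le_min invr_ge0 powR_ge0.
rewrite le_min; apply/andP; split.
  by rewrite -e1 ge0_ler_powR ?nnegrE ?powR_ge0 ?(ltW r0)// ge_min lexx.
by rewrite -e2 ge0_ler_powR ?nnegrE ?invr_ge0 ?powR_ge0 ?(ltW r0)// ge_min lexx orbT.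
Qed.

Definition decayPrim (del s : R) : R := s `^ del / (1 + s `^ del).

Lemma decayPrim_bound del s : 0 <= decayPrim del s <= 1.
Proof.
rewrite /decayPrim; have := powR_ge0 s del => h.
by rewrite divr_ge0//=; [rewrite ler_pdivrMr; lra|lra].
Qed.

(** Doubling [s] raises the bounded primitive by at least a fixed fraction of the kernel, so dyadic
    sums of the kernel telescope. *)
Lemma decay_step (del s : R) : 0 < del -> 0 < s ->
  decay del s <= 4 * 2 `^ del / (2 `^ del - 1) *
    (decayPrim del (2 * s) - decayPrim del s).
Proof.
move=> d0 s0; set r : R := 2 `^ del.
have u0 : 0 < s `^ del by exact: powR_gt0.
have r1 : 1 < r by rewrite -(powRr0 2) /r /powR; case: ifPn => [|_]; [rewrite pnatr_eq0|rewrite ltr_expR mul0r mulr_gt0// ln_gt0// ltr1n].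
rewrite /decayPrim /decay powRM ?(ltW s0)// -/r.
set u := s `^ del in u0 *.
have a0 : 0 < 1 + u by lra.
have b0 : 0 < 1 + r * u by nra.
have -> : 4 * r / (r - 1) * (r * u / (1 + r * u) - u / (1 + u))
    = (4 * u / (1 + u) ^+ 2) * (r * (1 + u) / (1 + r * u)).
  by field; rewrite !gt_eqF//; lra.
rewrite ler_peMr//.
  by rewrite divr_ge0 ?sqr_ge0// mulr_ge0// ltW.
by rewrite ler_pdivlMr//; nra.
Qed.

Lemma sum_decay (del : R) : 0 < del -> exists2 C, 0 <= C &
  forall (n : nat) (s : R), 0 < s -> \sum_(k < n) decay del (2 ^+ k * s) <= C.
Proof.
move=> d0; set r : R := 2 `^ del.
have r1 : 1 < r by rewrite -(powRr0 2) /r /powR; case: ifPn => [|_]; [rewrite pnatr_eq0|rewrite ltr_expR mul0r mulr_gt0// ln_gt0// ltr1n].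
have C0 : 0 <= 4 * r / (r - 1) by rewrite divr_ge0; lra.
exists (4 * r / (r - 1)) => // n s s0.
apply: (@le_trans _ _ (4 * r / (r - 1) * (decayPrim del (2 ^+ n * s) - decayPrim del (2 ^+ 0 * s)))).
  elim: n => [|n IH]; first by rewrite big_ord0 subrr mulr0.
  rewrite big_ord_recr/=.
  have := @decay_step del (2 ^+ n * s) d0; rewrite mulr_gt0 ?exprn_gt0//.
  move=> /(_ isT); rewrite /= -/r mulrA -exprS => h.
  apply: (le_trans (lerD IH h)).
  by rewrite -mulrDr ler_wpM2l//; lra.
rewrite ler_piMr//.
have := decayPrim_bound del (2 ^+ n * s); have := decayPrim_bound del (2 ^+ 0 * s).
by move=> /andP[h1 h2] /andP[h3 h4]; lra.
Qed.

Lemma measurable_decay (del a : R) :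
  measurable_fun setT (fun t : R => decay del (a * t)).
Proof.
rewrite /decay.
have m1 : measurable_fun setT (fun t : R => (a * t) `^ del).
  apply: (measurableT_comp (measurable_powR del)).
  exact: measurable_funM.
apply: measurable_funM; first exact: measurable_funM.
have -> : (fun t : R => ((1 + (a * t) `^ del) ^+ 2)^-1)
    = (fun t => (1 + (a * t) `^ del) `^ (-2%:R)).
  by apply/funext => t; rewrite powR_invn// addr_ge0// powR_ge0.
apply: (measurableT_comp (measurable_powR _)).
exact: measurable_funD.
Qed.

Lemma is_derive_powR_scale (del a t : R) : 0 < a -> 0 < t ->
  is_derive t 1 (fun t : R => (a * t) `^ del) (del * (a * t) `^ del / t).
Proof.
move=> a0 t0; have at0 : 0 < a * t by exact: mulr_gt0.
have dl : is_derive t 1 (fun y : R => a * y) a.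
  have h := is_deriveZ a (is_derive_id t 1).
  by apply: is_derive_eq h _; rewrite /GRing.scale/= mulr1.
have h := @is_derive1_comp R (fun x => x `^ del) (fun y => a * y) t _ _
  (is_derive1_powR del at0) dl.
apply: is_derive_eq h _.
rewrite powRB ?(gt_eqF at0) ?implybT// powRr1 ?(ltW at0)//.
by field; rewrite !gt_eqF.
Qed.

Lemma is_derive_decayPrim (del a t : R) : 0 < del -> 0 < a -> 0 < t ->
  is_derive t 1 (fun t : R => 4 / del * decayPrim del (a * t))
    (t `^ (-1) * decay del (a * t)).
Proof.
move=> d0 a0 t0; have dG := @is_derive_powR_scale del a t a0 t0.
have G0 := powR_ge0 (a * t) del.
have dG1 : is_derive t 1 (fun t : R => 1 + (a * t) `^ del) (del * (a * t) `^ del / t).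
  have h := is_deriveD (is_derive_cst (1 : R) t 1) dG.
  by apply: is_derive_eq h _; rewrite add0r.
have G1 : 1 + (a * t) `^ del != 0 by rewrite gt_eqF//; lra.
have h := is_deriveZ (4 / del) (is_deriveM dG 
  (@is_deriveV R (fun t : R => 1 + (a * t) `^ del) t _ 1 G1 dG1)).
apply: is_derive_eq h _.
rewrite /GRing.scale/= /decay powR_inv1 ?(ltW t0)//.
by field; rewrite !gt_eqF//; lra.
Qed.

Lemma continuous_decay (del a t : R) : 0 < a -> 0 < t ->
  {for t, continuous (fun t : R => t `^ (-1) * decay del (a * t))}.
Proof.
move=> a0 t0; have dG := @is_derive_powR_scale del a t a0 t0.
have cG : {for t, continuous (fun t : R => (a * t) `^ del)}.
  by have [d _] := dG; apply: differentiable_continuous; exact/derivable1_diffP.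
have cP : {for t, continuous (fun t : R => t `^ (-1))}.
  have [d _] := is_derive1_powR (-1) t0.
  by apply: differentiable_continuous; exact/derivable1_diffP.
have G0 := powR_ge0 (a * t) del.
rewrite /decay; apply: cvgM => //; apply: cvgM.
  by apply: cvgM => //; exact: cvg_cst.
apply: cvgV; first by rewrite expf_neq0// gt_eqF//; lra.
rewrite expr2; under eq_fun do rewrite expr2.
by apply: cvgM; apply: cvgD => //; exact: cvg_cst.
Qed.

Lemma integral_decay (del a : R) : 0 < del -> 0 < a ->
  (\int[leb]_(t in `]0%R, +oo[%classic) (t `^ (-1) * decay del (a * t))%:E
    <= (4 / del)%:E)%E.
Proof.
move=> d0 a0.
(* Compact intervals exhausting the half line; starting at 2 keeps them nondegenerate, as the
   fundamental theorem of calculus requires. *)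
pose F n : set RR := `[n.+2%:R^-1, n.+2%:R]%classic.
have F0 n x : F n x -> 0 < x.
  by rewrite /F/= in_itv/= => /andP[+ _]; apply: lt_le_trans; rewrite invr_gt0.
have UF : `]0, +oo[%classic = \bigcup_n F n.
  apply/seteqP; split => x /=; last by move=> [n _ /F0]; rewrite in_itv/= andbT.
  rewrite in_itv/= andbT => x0.
  exists (Num.truncn x^-1 + Num.truncn x)%N => //; rewrite /F/= in_itv/=.
  rewrite -[X in (_ <= X) && _]invrK lef_pV2 ?posrE ?invr_gt0 ?ltr0n//.
  apply/andP; split.
    apply: (le_trans (ltW (truncnS_gt _))); rewrite ler_nat ltnS.
    by rewrite (leq_trans (leq_addr _ _) (leqnSn _)).
  apply: (le_trans (ltW (truncnS_gt _))); rewrite ler_nat ltnS.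
  by rewrite (leq_trans (leq_addl _ _) (leqnSn _)).
have nF : nondecreasing_seq F.
  move=> n m nm; apply/subsetPset => x /=; rewrite /F/= !in_itv/= => /andP[h1 h2].
  apply/andP; split.
    by apply: le_trans h1; rewrite lef_pV2 ?posrE ?ltr0n// ler_nat.
  by apply: (le_trans h2); rewrite ler_nat.
have mf n : measurable_fun (F n : set RR) (fun t => (t `^ (-1) * decay del (a * t))%:E).
  apply/measurable_EFinP; apply: measurable_funTS; apply: measurable_funM.
    exact: measurable_powR.
  exact: measurable_decay.
have f0 n x : F n x -> (0 <= (x `^ (-1) * decay del (a * x))%:E)%E.
  by move=> _; rewrite lee_fin mulr_ge0 ?decay_ge0// powR_ge0.
rewrite UF.
have := @ge0_nondecreasing_set_cvg_integral _ _ _ F _ leb nF _ mf f0.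
move=> /(_ (fun i => measurable_itv _)) h.
rewrite -(cvg_lim _ h)//; apply: lime_le; first by apply/cvg_ex; eexists; exact: h.
near=> n.
have ab : n.+2%:R^-1 < n.+2%:R :> R.
  by rewrite (@lt_trans _ _ 1)// ?invf_lt1 ?ltr0n// ltr1n.
rewrite (@continuous_FTC2 _ _ (fun t : R => 4 / del * decayPrim del (a * t)) _ _ ab).
- rewrite -EFinB lee_fin -mulrBr ler_piMr//; first by rewrite divr_ge0// ltW.
  have := decayPrim_bound del (a * n.+2%:R); have := decayPrim_bound del (a * n.+2%:R^-1).
  by move=> /andP[h1 h2] /andP[h3 h4]; lra.
- apply: continuous_in_subspaceT => x; rewrite inE => /(F0 n) x0.
  exact: continuous_decay.
- have dx (x : R) : 0 < x -> is_derive x 1 (fun t : R => 4 / del * decayPrim del (a * t))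
    (x `^ (-1) * decay del (a * x)) by move=> x0; exact: is_derive_decayPrim.
  have cx (x : R) : 0 < x -> {for x, continuous (fun t : R => 4 / del * decayPrim del (a * t))}.
    by move=> x0; have [d _] := dx x x0; apply: differentiable_continuous; exact/derivable1_diffP.
  split.
  + move=> x; rewrite in_itv/= => /andP[x0 _].
    have [] := dx x => //.
    by apply: lt_trans x0; rewrite invr_gt0.
  + by apply: cvg_at_right_filter; apply: cx; rewrite invr_gt0.
  + by apply: cvg_at_left_filter; exact: cx.
- move=> x; rewrite in_itv/= => /andP[x0 _].
  rewrite derive1E.
  have [] := @is_derive_decayPrim del a x d0 a0 => //.
  by apply: lt_trans x0; rewrite invr_gt0.
Unshelve. all: by end_near. Qed.

End Decay.

Section JensenAndFdiff.
Variable R : realType.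

Lemma powR_tangent (p x m : R) : 1 <= p -> 0 <= x -> 0 <= m ->
  p * x * m `^ (p - 1) - (p - 1) * m `^ p <= x `^ p.
Proof.
move=> p1 x0 m0; have [->|pn1] := eqVneq p 1.
  by rewrite subrr powRr0 mul0r subr0 mul1r mulr1 powRr1.
have {pn1} p1' : 1 < p by rewrite lt_neqAle eq_sym pn1.
have p0 : 0 < p by lra.
have q0 : 0 < p / (p - 1) by rewrite divr_gt0//; lra.
have pq : p^-1 + (p / (p - 1))^-1 = 1.
  by field; rewrite !gt_eqF//; lra.
have := @conjugate_powR R x (m `^ (p - 1)) p (p / (p - 1)) x0 (powR_ge0 _ _) p0 q0 pq.
rewrite -powRrM (_ : (p - 1) * (p / (p - 1)) = p); last by field; rewrite gt_eqF//; lra.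
move=> h.
have : p * (x * m `^ (p - 1)) <= p * (x `^ p / p + m `^ p / (p / (p - 1))) by rewrite ler_pM2l.
rewrite [X in _ <= X](_ : _ = x `^ p + (p - 1) * m `^ p); last first.
  by field; rewrite !gt_eqF//; lra.
by rewrite mulrA; lra.
Qed.

(** The tangent inequality for the p-th power is taken at the weighted mean X / S and summed with
    the weights c; what remains of the left side is S m^p. *)
Lemma jensen_powR (I : finType) (p : R) (c x : I -> R) : 1 <= p ->
  (forall i, 0 <= c i) -> (forall i, 0 <= x i) ->
  (\sum_i c i * x i) `^ p <= (\sum_i c i) `^ (p - 1) * \sum_i c i * x i `^ p.
Proof.
move=> p1 c0 x0; set S := \sum_i c i; set X := \sum_i c i * x i.
have p0 : p != 0 by rewrite gt_eqF//; lra.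
have S0 : 0 <= S by exact: sumr_ge0.
have X0 : 0 <= X by apply: sumr_ge0 => i _; exact: mulr_ge0.
have [Se|Sn] := eqVneq S 0.
  have ci i : c i = 0.
    by apply/eqP; have /eqP := Se; rewrite psumr_eq0// => /allP/(_ i); rewrite mem_index_enum; exact.
  rewrite /X big1 ?powR0//; last by move=> i _; rewrite ci mul0r.
  by rewrite mulr_ge0 ?powR_ge0// sumr_ge0// => i _; rewrite ci mul0r.
have Sp : 0 < S by rewrite lt_neqAle eq_sym Sn.
pose m := X / S; have m0 : 0 <= m by rewrite divr_ge0.
have H : S * m `^ p <= \sum_i c i * x i `^ p.
  apply: (@le_trans _ _ (\sum_i c i * (p * x i * m `^ (p - 1) - (p - 1) * m `^ p))).
    under eq_bigr do rewrite mulrBr.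
    rewrite sumrB -mulr_suml -/S.
    have -> : \sum_i c i * (p * x i * m `^ (p - 1)) = X * (p * m `^ (p - 1)).
      by rewrite /X mulr_suml; apply: eq_bigr => i _; ring.
    have -> : X = S * m by rewrite /m mulrC divfK.
    have -> : m `^ p = m * m `^ (p - 1) by rewrite mulr_powRB1//; lra.
    by rewrite le_eqVlt; apply/orP; left; apply/eqP; ring.
  by apply: ler_sum => i _; rewrite ler_wpM2l// powR_tangent.
apply: (@le_trans _ _ (S `^ (p - 1) * (S * m `^ p))); last first.
  by rewrite ler_wpM2l ?powR_ge0.
rewrite mulrA [S `^ _ * S]mulrC mulr_powRB1//; last by lra.
by rewrite -powRM// /m mulrC divfK.
Qed.

Lemma fdiff_sum d (I : finType) (c : I -> R) (g : I -> pt R d -> R) l h x :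
  fdiff l h (fun x => \sum_i c i * g i x) x = \sum_i c i * fdiff l h (g i) x.
Proof.
rewrite /fdiff.
under [RHS]eq_bigr do rewrite mulr_sumr.
rewrite exchange_big /=; apply: eq_bigr => k _; rewrite mulr_sumr.
by apply: eq_bigr => i _; ring.
Qed.

Lemma fdiff_tens d (g : 'I_d -> R -> R) l h x :
  fdiff l h (tens g) x = \prod_(j < d) fd1 (l j) (h j) (g j) (coord x j).
Proof.
pose F (j : 'I_d) (k : 'I_(lmax l).+1) : R :=
  (-1) ^+ (l j - k) * 'C(l j, k)%:R * g j (coord x j + k%:R * h j).
transitivity (\prod_(j < d) \sum_(k < (lmax l).+1 | (k <= l j)%N) F j k).
  rewrite bigA_distr_big_dep /fdiff; apply: eq_big => [k|k _].
    apply/forallP/familyP => H j; exact: H j.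
  rewrite /tens -prodrXr natr_prod -!big_split /=; apply: eq_bigr => j _.
  by rewrite /F /coord tnth_mktuple.
apply: eq_bigr => j _; rewrite /fd1.
have lj : ((l j).+1 <= (lmax l).+1)%N by rewrite ltnS; exact: leq_bigmax.
by rewrite (big_ord_widen _ (fun k => (-1) ^+ (l j - k) * 'C(l j, k)%:R * g j (coord x j + k%:R * h j)) lj).
Qed.

(** Half-open unit cubes at distinct integer points are disjoint, so at most one product is
    nonzero. *)
Lemma sum_prod_cell_le1 (I : finType) (P : pred I) d (f : I -> 'I_d -> int) (y : 'I_d -> R) :
  (forall i i', P i -> P i' -> f i =1 f i' -> i = i') ->
  \sum_(i | P i) \prod_(j < d) cell (y j - (f i j)%:~R) <= 1.
Proof.
move=> finj.
have [/existsP[i /andP[Pi /forallP hi]]|/existsPn nk] :=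
    boolP [exists i, P i && [forall j, 0 <= y j - (f i j)%:~R < 1]].
  rewrite (bigD1 i)//= [X in _ + X]big1 ?addr0.
    apply: (@le_trans _ _ (\prod_(j < d) (1 : R))); last by rewrite big1.
    apply: ler_prod => j _.
    by rewrite cell_ge0 cell_le1.
  move=> i' /andP[Pi' ne]; apply/eqP; apply: contraNT ne => h.
  apply/eqP; apply: finj => // j.
  have {h} : cell (y j - (f i' j)%:~R) != 0.
    by apply: contraNN h => /eqP h; rewrite (bigD1 j)//= h mul0r.
  rewrite /cell; case: (boolP (_ <= _ < _)) => [|_]; last by rewrite eqxx.
  move: (hi j) => /andP[h1 h2] /andP[h3 h4] _.
  have e1 : (f i j)%:~R < (f i' j)%:~R + 1 :> R by lra.
  have e2 : (f i' j)%:~R < (f i j)%:~R + 1 :> R by lra.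
  move: e1 e2; rewrite -[1]/(1%:~R) -!rmorphD/= !ltr_int !ltzD1 => e1 e2.
  by apply/eqP; rewrite eq_le e1 e2.
rewrite big1// => i Pi; have := nk i; rewrite negb_and Pi/= => /forallPn[j hj].
by rewrite (bigD1 j)//= /cell (negbTE hj) mul0r.
Qed.

(** One coordinate of the estimate for a difference of an atom. The second alternative is for
    coordinates in which no difference is taken: there t = 1 and the decay in [kap] comes from the
    weight alone. *)
Lemma weight_bound (del a rho t xi : R) (kap l l' : nat) :
  0 < del -> del <= a -> del <= l%:R - a -> 0 < rho -> rho <= 1 -> 0 < t ->
  (l' = l /\ `|xi| <= t) \/ (l' = 0%N /\ t = 1) ->
  (2 ^+ kap) `^ (- a) * Num.min 1 `|2 ^+ kap / rho * xi| ^+ l'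
  <= rho^-1 ^+ l * (t `^ a * decay del (2 ^+ kap * t)).
Proof.
move=> d0 da dl r0 r1 t0 H.
have k0 : 0 < 2 ^+ kap :> R by rewrite exprn_gt0.
have kt0 : 0 < 2 ^+ kap * t by exact: mulr_gt0.
have rl : 1 <= rho^-1 ^+ l by rewrite exprn_ege1// invf_ge1.
have h := smoothness_le_decay d0 da dl kt0.
have E : t `^ a * decay del (2 ^+ kap * t)
    = (2 ^+ kap) `^ (- a) * ((2 ^+ kap * t) `^ a * decay del (2 ^+ kap * t)).
  rewrite powRM ?ltW// mulrA; congr (_ * _).
  by rewrite mulrA -powRD ?(gt_eqF k0) ?implybT// addNr powRr0 mul1r.
rewrite E mulrCA ler_wpM2l ?powR_ge0//.
have h' : Num.min 1 (2 ^+ kap * t) ^+ l <= (2 ^+ kap * t) `^ a * decay del (2 ^+ kap * t) by [].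
case: H => [[-> xt]|[-> t1]]; last first.
  rewrite expr0; apply: (le_trans _ (ler_peMl _ rl)); last first.
    by rewrite mulr_ge0 ?powR_ge0 ?decay_ge0.
  by apply: le_trans h'; rewrite t1 mulr1 min_l ?expr1n// exprn_ege1// ler1n.
apply: (@le_trans _ _ (rho^-1 ^+ l * Num.min 1 (2 ^+ kap * t) ^+ l)); last first.
  by rewrite ler_wpM2l// exprn_ge0// invr_ge0 ltW.
have l0 : (0 < l)%N.
  by rewrite lt0n; apply/eqP => l0; move: dl; rewrite l0; lra.
rewrite -exprMn (ler_pXn2r l0) ?nnegrE; last 2 first.
- by rewrite le_min ler01 normr_ge0.
- by rewrite mulr_ge0 ?invr_ge0 ?(ltW r0)// le_min ler01 ltW.
rewrite minr_pMr ?invr_ge0 ?(ltW r0)// le_min; apply/andP; split.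
  by rewrite mulr1 ge_min invf_ge1// r1.
rewrite ge_min; apply/orP; right.
rewrite normrM gtr0_norm ?divr_gt0// mulrAC mulrC ler_wpM2l ?invr_ge0 ?(ltW r0)//.
by rewrite ler_wpM2l// ltW.
Qed.

End JensenAndFdiff.

(** * Atoms and their finite differences *)

Section AtomicSums.
Variables (R : realType) (d : nat).
Variables (x0 : 'I_d -> R) (rho : R) (w : 'I_d -> nat -> R -> R).

Section Family.
Variables (E I : finType) (kp : E -> 'I_d -> nat) (lev : I -> E) (nu : I -> 'I_d -> int).

Definition scale e j : R := 2 ^+ kp e j / rho.
Definition offset i j : R := (nu i j)%:~R + scale (lev i) j * x0 j.

(* [w j n] is the [n]-th derivative of a bump; the shift [.+1] makes the atoms
   orthogonal to constants in each variable. *)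
Definition atom (n : 'I_d -> nat) i : pt R d -> R :=
  tens (fun j y => w j (n j).+1 (scale (lev i) j * y - offset i j)).

(** The normalisation 2^(-kp . alpha), after which the Besov estimates involve the coefficients and
    no longer the shape of the cell. *)
Definition weight (alpha : 'I_d -> R) e : R := \prod_(j < d) (2 ^+ kp e j) `^ (- alpha j).

Definition atomic_sum alpha (a : I -> R) (x : pt R d) : R :=
  \sum_i (a i * weight alpha (lev i)) * atom (fun=> 0%N) i x.

Definition decays del (t : 'I_d -> R) e : R := \prod_(j < d) decay del (2 ^+ kp e j * t j).

(** The common sum [k] fixes the volume of the cells. It also makes each of two distinct levels
    strictly finer than the other in some direction, on which Haar orthogonality rests. *)
Definition wf_family k :=
  [/\ forall e e', kp e =1 kp e' -> e = e',
      forall e, \sum_(j < d) kp e j = k &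
      forall i i', lev i = lev i' -> nu i =1 nu i' -> i = i'].

(** The number of nodes x + n xi, with 0 <= n_j <= l_j, that fall into cell [i]: a majorant for the
    support of a mixed difference of the atom. *)
Definition shifts (l : 'I_d -> nat) (xi : 'I_d -> R) i : pt R d -> R :=
  tens (fun j y => \sum_(k < (l j).+1)
    cell (scale (lev i) j * y - (offset i j - k%:R * (scale (lev i) j * xi j)))).

End Family.

Hypotheses (rho0 : 0 < rho) (rho1 : rho <= 1).
Hypotheses (jw : forall j, jet (w j)) (sw : forall j, supp01 (w j)).

Lemma scale_gt0 (E : finType) (kp : E -> 'I_d -> nat) e j : 0 < scale kp e j.
Proof. by rewrite divr_gt0// exprn_gt0. Qed.

Lemma decays_ge0 (E : finType) (kp : E -> 'I_d -> nat) del t e : 0 <= decays kp del t e.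
Proof. by apply: prodr_ge0 => j _; exact: decay_ge0. Qed.

Lemma kp_le (E I : finType) (kp : E -> 'I_d -> nat) (lev : I -> E) nu k e j :
  wf_family kp lev nu k -> (kp e j <= k)%N.
Proof. by move=> [_ /(_ e) <- _]; rewrite (bigD1 j)//= leq_addr. Qed.

(** Levels are distinct exponent vectors with entries at most k. Extending the sum to the whole grid
    turns it into a product of one-dimensional sums, each bounded independently of k. *)
Lemma sum_decays del : 0 < del -> exists2 C, 0 <= C &
  forall (E I : finType) (kp : E -> 'I_d -> nat) (lev : I -> E) nu k t,
    wf_family kp lev nu k -> (forall j, 0 < t j) ->
    \sum_e decays kp del t e <= C.
Proof.
move=> d0; have [C C0 hC] := sum_decay d0.
exists (C ^+ d); first exact: exprn_ge0.
move=> E I kp lev nu k t wf t0.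
pose h e : {ffun 'I_d -> 'I_k.+1} := [ffun j => inord (kp e j)].
pose F (g : {ffun 'I_d -> 'I_k.+1}) := \prod_(j < d) decay del (2 ^+ g j * t j).
have F0 g : 0 <= F g by apply: prodr_ge0 => j _; exact: decay_ge0.
have hE e j : h e j = kp e j :> nat.
  by rewrite ffunE inordK// ltnS; exact: kp_le wf.
have hinj : injective h.
  move=> e e' /ffunP hh; have [inj _ _] := wf; apply: inj => j.
  by rewrite -!hE hh.
apply: (@le_trans _ _ (\sum_(g in h @: E) F g)).
  rewrite big_imset/=; last by move=> ? ? _ _; exact: hinj.
  by apply: ler_sum => e _; rewrite /decays /F; under [leRHS]eq_bigr do rewrite hE.
apply: (@le_trans _ _ (\sum_g F g)).
  by rewrite [leRHS](bigID (mem (h @: E)))/= lerDl sumr_ge0.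
rewrite /F -(bigA_distr_bigA (fun j (i : 'I_k.+1) => decay del (2 ^+ i * t j))).
rewrite -[in leRHS](card_ord d) -prodr_const.
apply: ler_prod => j _; rewrite sumr_ge0 => [|i _]; last exact: decay_ge0.
exact: hC.
Qed.

Lemma fd1_affine l h (f : R -> R) s b y :
  fd1 l h (fun y => f (s * y - b)) y = fd1 l (s * h) f (s * y - b).
Proof.
by apply: eq_bigr => k _; congr (_ * f _); ring.
Qed.

Lemma fdiff_atom_bound del (alpha : 'I_d -> R) : 0 < del ->
  (forall j, del <= alpha j) ->
  (forall j, del <= (l_of alpha j)%:R - alpha j) ->
  exists2 C, 0 <= C &
  forall (E I : finType) (kp : E -> 'I_d -> nat) (lev : I -> E) nu i
    (J : {set 'I_d}) (xi t : 'I_d -> R) x,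
    (forall j, 0 < t j) -> (forall j, j \in J -> `|xi j| <= t j) ->
    (forall j, j \notin J -> t j = 1) ->
    weight kp alpha (lev i)
      * `|fdiff (lchi (l_of alpha) J) xi (atom kp lev nu (fun=> 0%N) i) x|
    <= C * (\prod_(j < d) t j `^ alpha j) * decays kp del t (lev i)
         * shifts kp lev nu (lchi (l_of alpha) J) xi i x.
Proof.
move=> d0 da dl; set l := l_of alpha.
pose cw j n := projT1 (cid2 (@fd1_bound R (w j) 1 n (jw j) (sw j))).
have cw0 j n : 0 <= cw j n by rewrite /cw; case: cid2.
have hcw j n h y : `|fd1 n h (w j 1) y| <= cw j n * Num.min 1 `|h| ^+ n
    * \sum_(k < n.+1) cell (y + k%:R * h).
  by rewrite /cw; case: cid2 => /= C _ ->.
(* The two constants cover the coordinates in [J], where the order is [l j], and the others, where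
   it is 0. *)
exists (\prod_(j < d) ((cw j (l j) + cw j 0%N) * rho^-1 ^+ l j)).
  by apply: prodr_ge0 => j _; rewrite mulr_ge0 ?addr_ge0// exprn_ge0// invr_ge0 ltW.
move=> E I kp lev nu i J xi t x t0 xit t1.
rewrite fdiff_tens normr_prod /weight -big_split -!big_split /=.
apply: ler_prod => j _; rewrite mulr_ge0 ?powR_ge0//=.
rewrite fd1_affine; set s := scale kp (lev i) j.
have c0 y n : 0 <= \sum_(k < n) cell (y - (offset kp lev nu i j - k%:R * (s * xi j))) :> R.
  by apply: sumr_ge0 => k _; exact: cell_ge0.
apply: (le_trans (ler_wpM2l (powR_ge0 _ _) (hcw j _ _ _))).
set l' := lchi l J j; set b := offset kp lev nu i j.
have -> : \sum_(k < l'.+1) cell (s * coord x j - b + k%:R * (s * xi j))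
    = \sum_(k < l'.+1) cell (s * coord x j - (b - k%:R * (s * xi j))).
  by apply: eq_bigr => k _; congr cell; ring.
set S := \sum_(_ < _) _.
have S0 : 0 <= S by exact: c0.
have hl : cw j l' <= cw j (l j) + cw j 0%N.
  by rewrite /l' /lchi; case: ifP; rewrite ?lerDl ?lerDr.
have hw : (2 ^+ kp (lev i) j) `^ (- alpha j) * Num.min 1 `|s * xi j| ^+ l'
    <= rho^-1 ^+ l j * (t j `^ alpha j * decay del (2 ^+ kp (lev i) j * t j)).
  apply: weight_bound => //.
  rewrite /l' /lchi; case: (boolP (j \in J)) => jJ; [left|right]; split => //.
    exact: xit.
  exact: t1.
have K0 : 0 <= (2 ^+ kp (lev i) j) `^ (- alpha j) * Num.min 1 `|s * xi j| ^+ l'.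
  by rewrite mulr_ge0 ?powR_ge0// exprn_ge0// le_min ler01 normr_ge0.
have := ler_wpM2r S0 (ler_pM (cw0 _ _) K0 hl hw).
by congr (_ <= _); ring.
Qed.

End AtomicSums.

Section IntegratedBound.
Variables (R : realType) (d : nat).
Local Notation RR := (measurableTypeR R).
Variables (x0 : 'I_d -> R) (rho : R) (w : 'I_d -> nat -> R -> R).
Hypotheses (rho0 : 0 < rho) (rho1 : rho <= 1).
Hypotheses (jw : forall j, jet (w j)) (sw : forall j, supp01 (w j)).
Local Notation atom := (atom x0 rho w).
Local Notation shifts := (shifts x0 rho).

Section Shifts.
Variables (E I : finType) (kp : E -> 'I_d -> nat) (lev : I -> E) (nu : I -> 'I_d -> int).
Variable k : nat.
Hypothesis wf : wf_family kp lev nu k.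

Lemma shifts_ge0 l xi i x : 0 <= shifts kp lev nu l xi i x.
Proof. by apply: prodr_ge0 => j _; apply: sumr_ge0 => n _; exact: cell_ge0. Qed.

(** For a fixed node of the difference the cells of one level are disjoint, so each node contributes
    at most 1. *)
Lemma sum_shifts_le l xi e x :
  \sum_(i | lev i == e) shifts kp lev nu l xi i x <= \prod_(j < d) (l j).+1%:R.
Proof.
have widen (F : 'I_d -> nat -> R) : \prod_(j < d) \sum_(n < (l j).+1) F j n
    = \sum_(g : {ffun 'I_d -> 'I_(lmax l).+1} | g \in family (fun j => [pred n : 'I_(lmax l).+1 | n <= l j]%N))
        \prod_(j < d) F j (g j).
  rewrite -(bigA_distr_big_dep (fun j => [pred n : 'I_(lmax l).+1 | n <= l j]%N) (fun j (n : 'I__) => F j n)).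
  apply: eq_bigr => j _.
  have lj : ((l j).+1 <= (lmax l).+1)%N by rewrite ltnS; exact: leq_bigmax.
  by rewrite (big_ord_widen _ (F j) lj).
rewrite /Defs.lmax in widen *.
pose y e' j (n : nat) := scale rho kp e' j * coord x j - scale rho kp e' j * x0 j
   + n%:R * (scale rho kp e' j * xi j).
have E1 i : lev i == e -> shifts kp lev nu l xi i x
    = \prod_(j < d) \sum_(n < (l j).+1) cell (y e j n - (nu i j)%:~R).
  move=> /eqP <-; apply: eq_bigr => j _; apply: eq_bigr => n _; congr cell.
  by rewrite /y /offset; ring.
rewrite (eq_bigr _ E1).
under eq_bigr => i _ do rewrite (widen (fun j n => cell (y e j n - (nu i j)%:~R))).
rewrite exchange_big /=.
have -> : \prod_(j < d) (l j).+1%:R = \prod_(j < d) \sum_(n < (l j).+1) (1 : R).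
  by apply: eq_bigr => j _; rewrite sumr_const card_ord.
rewrite (widen (fun _ _ => 1)); apply: ler_sum => g _.
rewrite [leRHS]big1//; apply: sum_prod_cell_le1 => i i' /eqP hi /eqP hi' hh.
by have [_ _] := wf; apply => //; rewrite hi hi'.
Qed.

Lemma measurable_shifts l xi i : measurable_fun setT (shifts kp lev nu l xi i).
Proof.
apply: measurable_tens => j; apply: measurable_sum => n.
by apply: measurable_cell; exact: scale_gt0.
Qed.

Lemma prod_scaleV e : \prod_(j < d) (scale rho kp e j)^-1 = rho ^+ d * 2^-1 ^+ k.
Proof.
rewrite /scale; under eq_bigr do rewrite invf_div -exprVn.
rewrite big_split/= prodr_const card_ord prodrXr; congr (_ * _ ^+ _).
by have [_ h _] := wf; exact: h.
Qed.

Lemma integral_shifts l xi i :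
  (\int[lebm R d]_x (shifts kp lev nu l xi i x)%:E
   = (rho ^+ d * 2^-1 ^+ k * \prod_(j < d) (l j).+1%:R)%:E)%E.
Proof.
have m1 j n : measurable_fun (setT : set RR) (fun y => cell (scale rho kp (lev i) j * y
      - (offset x0 rho kp lev nu i j - n%:R * (scale rho kp (lev i) j * xi j)))).
  by apply: measurable_cell; exact: scale_gt0.
rewrite ge0_integral_tens; last 2 first.
- by move=> j; apply: measurable_sum => n; exact: m1.
- by move=> j y; apply: sumr_ge0 => n _; exact: cell_ge0.
rewrite -(prod_scaleV (lev i)) -big_split /= -prodEFin; apply: eq_bigr => j _.
under eq_integral do rewrite -sumEFin.
rewrite ge0_integral_sum//; last 2 first.
- by move=> n; apply/measurable_EFinP; exact: m1.
- by move=> n y _; rewrite lee_fin cell_ge0.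
under eq_bigr do rewrite integral_cell ?scale_gt0//.
by rewrite sumEFin sumr_const card_ord mulr_natr.
Qed.

End Shifts.

(** Jensen's inequality is used with weights decay times node count. Their total at a point is
    bounded uniformly in k: the decay sums over levels, disjointness sums within a level. The
    overlap of many levels therefore costs only a constant. *)
Lemma fdiff_integral_bound (alpha : 'I_d -> R) (p del : R) : 0 < del -> 1 <= p ->
  (forall j, del <= alpha j) ->
  (forall j, del <= (l_of alpha j)%:R - alpha j) ->
  exists2 C, 0 < C &
  forall (E I : finType) (kp : E -> 'I_d -> nat) (lev : I -> E) nu k a
    (J : {set 'I_d}) (xi t : 'I_d -> R), wf_family kp lev nu k ->
    (forall j, 0 < t j) -> (forall j, j \in J -> `|xi j| <= t j) ->
    (forall j, j \notin J -> t j = 1) ->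
    (\int[lebm R d]_x
       (`|fdiff (lchi (l_of alpha) J) xi (atomic_sum x0 rho w kp lev nu alpha a) x| `^ p)%:E
     <= (C * (\prod_(j < d) t j `^ alpha j) `^ p
         * \sum_i decays kp del t (lev i) * (2^-1 ^+ k * `|a i| `^ p))%:E)%E.
Proof.
move=> d0 p1 da dl; set l := l_of alpha.
have [C1 C10 hC1] := fdiff_atom_bound x0 rho0 rho1 jw sw d0 da dl.
have [CW CW0 hCW] := @sum_decays R d del d0.
pose N : R := \prod_(j < d) (l j).+1%:R.
have N0 : 0 <= N by apply: prodr_ge0 => j _; exact: ler0n.
pose K := C1 `^ p * (CW * N) `^ (p - 1).
have K0 : 0 <= K by rewrite mulr_ge0 ?powR_ge0.
exists (K * N + 1); first by rewrite ltr_wpDl// mulr_ge0.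
move=> E I kp lev nu k a J xi t wf t0 xit t1.
set A := \prod_(j < d) t j `^ alpha j.
have A0 : 0 <= A by apply: prodr_ge0 => j _; exact: powR_ge0.
set l' := lchi l J.
have hN : \prod_(j < d) (l' j).+1%:R <= N.
  apply: ler_prod => j _; rewrite ler0n ler_nat ltnS /l' /lchi /=.
  by case: ifP => _; rewrite ?leqnn ?leq0n.
pose T i x := shifts kp lev nu l' xi i x.
have T0 i x : 0 <= T i x by exact: shifts_ge0.
have W0 e : 0 <= decays kp del t e by exact: decays_ge0.
have pw x : `|fdiff l' xi (atomic_sum x0 rho w kp lev nu alpha a) x| `^ p
    <= K * A `^ p * \sum_i (decays kp del t (lev i) * `|a i| `^ p) * T i x.
  have -> : atomic_sum x0 rho w kp lev nu alpha a
      = (fun x => \sum_i (a i * weight kp alpha (lev i)) * atom kp lev nu (fun=> 0%N) i x) by [].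
  rewrite fdiff_sum.
  have h1 : `|\sum_i a i * weight kp alpha (lev i) * fdiff l' xi (atom kp lev nu (fun=> 0%N) i) x|
      <= (C1 * A) * \sum_i (decays kp del t (lev i) * T i x) * `|a i|.
    apply: (le_trans (ler_norm_sum _ _ _)); rewrite mulr_sumr; apply: ler_sum => i _.
    have w0 : 0 <= weight kp alpha (lev i) by apply: prodr_ge0 => j _; exact: powR_ge0.
    rewrite 2!normrM (ger0_norm w0) -mulrA.
    apply: (le_trans (ler_wpM2l (normr_ge0 _) (hC1 _ _ kp lev nu i J xi t x t0 xit t1))).
    by rewrite le_eqVlt; apply/orP; left; apply/eqP; rewrite /T /A; ring.
  have p0 : 0 <= p by lra.
  have c0 i : 0 <= decays kp del t (lev i) * T i x by rewrite mulr_ge0.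
  have h2 : 0 <= \sum_i (decays kp del t (lev i) * T i x) * `|a i|.
    by apply: sumr_ge0 => i _; rewrite mulr_ge0.
  apply: (le_trans (ge0_ler_powR p0 _ _ h1)); rewrite ?nnegrE// ?mulr_ge0//.
  rewrite powRM ?mulr_ge0// powRM// /K.
  have -> : C1 `^ p * (CW * N) `^ (p - 1) * A `^ p = C1 `^ p * A `^ p * (CW * N) `^ (p - 1) by ring.
  rewrite -[leRHS]mulrA ler_wpM2l ?mulr_ge0 ?powR_ge0//.
  apply: (le_trans (jensen_powR p1 c0 (fun i => normr_ge0 (a i)))).
  apply: ler_pM; rewrite ?powR_ge0//.
  - by apply: sumr_ge0 => i _; rewrite mulr_ge0 ?powR_ge0.
  - rewrite ge0_ler_powR ?nnegrE ?mulr_ge0 ?subr_ge0//; first exact: sumr_ge0.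
    rewrite (partition_big lev xpredT)//=.
    apply: (@le_trans _ _ (\sum_e decays kp del t e * N)).
      apply: ler_sum => e _.
      rewrite (eq_bigr (fun i => decays kp del t e * T i x)); last by move=> i /eqP ->.
      rewrite -mulr_sumr ler_wpM2l//.
      exact: (le_trans (sum_shifts_le wf l' xi e x)).
    by rewrite -mulr_suml ler_wpM2r//; exact: hCW wf t0.
  - by apply: ler_sum => i _; rewrite mulrAC.
have S0 : 0 <= \sum_i decays kp del t (lev i) * (2^-1 ^+ k * `|a i| `^ p).
  apply: sumr_ge0 => i _; rewrite mulr_ge0// mulr_ge0 ?powR_ge0//.
have tm i x : 0 <= decays kp del t (lev i) * `|a i| `^ p * T i x.
  by rewrite !mulr_ge0 ?powR_ge0.
apply: (@le_trans _ _ (\int[lebm R d]_x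
   (K * A `^ p * \sum_i (decays kp del t (lev i) * `|a i| `^ p) * T i x)%:E)%E).
  apply: ge0_le_integral_raw => x; rewrite ?lee_fin ?powR_ge0//.
  by rewrite !mulr_ge0 ?powR_ge0// sumr_ge0.
under eq_integral do rewrite EFinM -sumEFin.
rewrite ge0_integralZl_EFin//; last 3 first.
- by move=> x _; apply: sume_ge0 => i _; rewrite lee_fin.
- apply: emeasurable_sum => i; apply/measurable_EFinP; apply: measurable_funM => //.
  exact: measurable_shifts.
- by rewrite mulr_ge0 ?powR_ge0.
rewrite ge0_integral_sum//; last 2 first.
- move=> i; apply/measurable_EFinP; apply: measurable_funM => //.
  exact: measurable_shifts.
- by move=> i x _; rewrite lee_fin.
have -> : (\sum_i \int[lebm R d]_x (decays kp del t (lev i) * `|a i| `^ p * T i x)%:E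
   = (\sum_i (decays kp del t (lev i) * `|a i| `^ p)
       * (rho ^+ d * 2^-1 ^+ k * \prod_(j < d) (l' j).+1%:R))%:E)%E.
  rewrite -sumEFin; apply: eq_bigr => i _.
  under eq_integral do rewrite EFinM.
  rewrite ge0_integralZl_EFin//; last 3 first.
  - by move=> x _; rewrite lee_fin.
  - by apply/measurable_EFinP; exact: measurable_shifts.
  - by rewrite mulr_ge0 ?powR_ge0.
  by rewrite (integral_shifts wf) EFinM.
rewrite -EFinM lee_fin.
apply: (@le_trans _ _ (K * N * A `^ p * \sum_i decays kp del t (lev i) * (2^-1 ^+ k * `|a i| `^ p))); last first.
  by rewrite ler_wpM2r// ler_wpM2r ?powR_ge0// lerDl.
have -> : K * N * A `^ p = K * A `^ p * N by ring.
rewrite -[leRHS]mulrA ler_wpM2l ?mulr_ge0 ?powR_ge0//.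
rewrite mulr_sumr; apply: ler_sum => i _.
have rd : rho ^+ d <= 1 by rewrite exprn_ile1// ltW.
have -> : N * (decays kp del t (lev i) * (2^-1 ^+ k * `|a i| `^ p))
  = (decays kp del t (lev i) * `|a i| `^ p) * (1 * 2^-1 ^+ k * N) by ring.
rewrite ler_wpM2l ?mulr_ge0 ?powR_ge0//.
apply: ler_pM => //.
- by rewrite mulr_ge0 ?exprn_ge0 ?invr_ge0// ltW.
- by apply: prodr_ge0 => j _; exact: ler0n.
- by rewrite ler_wpM2r// exprn_ge0// invr_ge0.
Qed.

End IntegratedBound.

(** * Averaged moduli of smoothness and Besov seminorms *)

Section OmegaBound.
Variable R : realType.
Local Notation RR := (measurableTypeR R).
Local Notation leb := (@lebesgue_measure R).

Lemma le_poweR (x y : \bar R) (r : R) : 0 <= r -> (0 <= x)%E -> (x <= y)%E ->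
  (poweR x r <= poweR y r)%E.
Proof.
move=> r0 x0 xy; apply: gt0_ler_poweR => //; rewrite in_itv/= leey andbT//.
exact: le_trans xy.
Qed.

Lemma extJ_enum_val d (J : {set 'I_d}) (s : #|J|.-tuple RR) dflt (i : 'I_#|J|) :
  extJ s dflt (enum_val i) = tnth s i.
Proof.
rewrite /extJ enum_valP; have -> : index (enum_val i) (enum J) = i.
  by rewrite (enum_val_nth (enum_default i)) index_uniq ?enum_uniq// -cardE.
by rewrite (tnth_nth 0).
Qed.

Lemma integral_itv_sym (c : R) : 0 <= c ->
  (\int[leb]_y ((`|y| <= c)%R%:R : R)%:E = (2 * c)%:E)%E.
Proof.
move=> c0.
have -> : (fun y : R => ((`|y| <= c)%R%:R : R)%:E) = (fun y => (\1_(`[- c, c]%classic : set RR) y)%:E).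
  by apply/funext => y; rewrite indicE mem_setE in_itv/= ler_norml.
rewrite integral_indic//= setIT lebesgue_measure_itv/= lte_fin.
case: ifPn => [_|]; first by rewrite -EFinB; congr EFin; ring.
rewrite -leNgt => h; have -> : c = 0 by lra.
by rewrite mulr0.
Qed.

Lemma measurable_itv_sym (c : R) : measurable_fun setT (fun y : R => (`|y| <= c)%R%:R : R).
Proof.
have -> : (fun y : R => (`|y| <= c)%R%:R : R) = \1_(`[- c, c]%classic : set RR).
  by apply/funext => y; rewrite indicE mem_setE in_itv/= ler_norml.
exact: measurable_indic.
Qed.

(** [Omega] is an average over xi, so a bound uniform in xi survives. The outer integrand is
    replaced by B times the indicator of the box, a tensor product whose integral is exactly the
    volume divided out in front. *)
Lemma Omega_le d (G : set (pt R d)) (p : R) l (J : {set 'I_d}) (f : pt R d -> R)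
    (t : 'I_d -> R) (B : R) : 0 < p -> 0 <= B -> (forall j, 0 < t j) ->
  (forall xi, (forall j, j \in J -> `|xi j| <= t j) ->
    (\int[lebm R d]_x (`|fdiff (lchi l J) xi f x| `^ p)%:E <= B%:E)%E) ->
  (Omega G p l J f t <= (B `^ p^-1)%:E)%E.
Proof.
move=> p0 B0 t0 hB; rewrite -poweR_EFin /Omega.
have P0 : 0 <= \prod_(j in J) (2 * t j)^-1.
  by apply: prodr_ge0 => j _; rewrite invr_ge0 mulr_ge0// ltW.
rewrite !lebmE; apply: le_poweR; rewrite ?invr_ge0 ?(ltW p0)//.
  rewrite mule_ge0 ?lee_fin// integral_ge0// => s _.
  by rewrite integral_ge0// => x _; rewrite lee_fin powR_ge0.
pose g (i : 'I_#|J|) (y : R) : R := (`|y| <= t (enum_val i))%R%:R.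
have g0 i y : 0 <= g i y by rewrite ler0n.
have mg i : measurable_fun setT (g i) by exact: measurable_itv_sym.
have tg0 s : 0 <= tens g s by apply: prodr_ge0 => i _.
have H : (\int[lebm R #|J|]_(s in [set s : #|J|.-tuple RR |
      forall j, j \in J -> (`|extJ s 0 j| <= t j)%R])
    \int[lebm R d]_(x in Gset G (lchi l J) (extJ s 0))
       (`|fdiff (lchi l J) (extJ s 0) f x| `^ p)%:E
   <= \int[lebm R #|J|]_s (B%:E * (tens g s)%:E))%E.
  apply: ge0_le_integral_raw => [s _|s|s hs].
  - by apply: integral_ge0 => x _; rewrite lee_fin powR_ge0.
  - by rewrite -EFinM lee_fin mulr_ge0.
  - apply: (@le_trans _ _ B%:E).
      apply: le_trans (hB (extJ s 0) hs).
      by apply: ge0_le_integral_raw => x *; rewrite ?lexx ?lee_fin ?powR_ge0.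
    rewrite -EFinM lee_fin ler_peMr// /tens big1// => i _.
    by rewrite /g /coord -(extJ_enum_val s 0) hs ?enum_valP.
apply: (le_trans (lee_pmul _ _ (lexx _) H)); rewrite ?lee_fin//.
  by rewrite integral_ge0// => s _; rewrite integral_ge0// => x _; rewrite lee_fin powR_ge0.
rewrite ge0_integralZl_EFin//; last 2 first.
- by move=> s _; rewrite lee_fin.
- by apply/measurable_EFinP; exact: measurable_tens.
rewrite ge0_integral_tens// (eq_bigr (fun i : 'I_#|J| => (2 * t (enum_val i))%:E)); last first.
  by move=> i _; rewrite integral_itv_sym// ltW.
rewrite prodEFin -(big_enum_val (fun j => 2 * t j)) -!EFinM lee_fin.
have -> : (\prod_(j in J) (2 * t j)^-1) * (B * \prod_(j in J) (2 * t j))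
  = B * \prod_(j in J) ((2 * t j)^-1 * (2 * t j)).
  by rewrite [in RHS]big_split/=; ring.
rewrite big1 ?mulr1// => j _; rewrite mulVf// mulf_neq0// gt_eqF//.
Qed.

(** Since u <= u^r on [0,1], applying this to u = a/(a+b) and u = b/(a+b) and adding gives
    subadditivity for two terms. *)
Lemma sum_powR_le (I : Type) (s : seq I) (P : pred I) (x : I -> R) (r : R) : 0 < r -> r <= 1 ->
  (forall i, 0 <= x i) -> (\sum_(i <- s | P i) x i) `^ r <= \sum_(i <- s | P i) x i `^ r.
Proof.
move=> r0 r1 x0.
have H (a b : R) : 0 <= a -> 0 <= b -> (a + b) `^ r <= a `^ r + b `^ r.
  move=> a0 b0; have [ab0|ab0] := eqVneq (a + b) 0.
    by rewrite ab0 powR0 ?gt_eqF// addr_ge0 ?powR_ge0.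
  have ab : 0 < a + b by rewrite lt_neqAle eq_sym ab0 addr_ge0.
  have K (z : R) : 0 <= z -> z <= a + b -> z / (a + b) * (a + b) `^ r <= z `^ r.
    move=> z0 zab; have [->|zn] := eqVneq z 0; first by rewrite !mul0r powR_ge0.
    have zp : 0 < z by rewrite lt_neqAle eq_sym zn.
    have -> : z `^ r = (z / (a + b)) `^ r * (a + b) `^ r.
      by rewrite -powRM ?divfK// ?divr_ge0// ltW.
    rewrite ler_wpM2r ?powR_ge0//.
    have : (z / (a + b)) `^ 1 <= (z / (a + b)) `^ r.
      by apply: ger_powR => //; rewrite divr_gt0//= ler_pdivrMr// mul1r.
    by rewrite powRr1// divr_ge0// ltW.
  have := lerD (K a a0 _) (K b b0 _); rewrite lerDl lerDr => /(_ b0 a0).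
  by rewrite -mulrDl -mulrDl mulfV// mul1r.
suff : 0 <= \sum_(i <- s | P i) x i /\
    (\sum_(i <- s | P i) x i) `^ r <= \sum_(i <- s | P i) x i `^ r by case.
elim/big_rec2 : _ => [|i y z _ [z0 IH]]; first by rewrite powR0// gt_eqF.
split; first exact: addr_ge0.
by apply: (le_trans (H _ _ (x0 i) z0)); rewrite lerD2l.
Qed.

Lemma powR_prod (I : Type) (s : seq I) (P : pred I) (x : I -> R) (r : R) :
  (forall i, 0 <= x i) ->
  (\prod_(i <- s | P i) x i) `^ r = \prod_(i <- s | P i) x i `^ r.
Proof.
move=> x0; suff : 0 <= \prod_(i <- s | P i) x i /\
    (\prod_(i <- s | P i) x i) `^ r = \prod_(i <- s | P i) x i `^ r by case.
elim/big_rec2 : _ => [|i y z _ [z0 <-]]; first by rewrite powR1 ler01.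
by rewrite mulr_ge0// powRM.
Qed.

Lemma decay_le1 (del s : R) : decay del s <= 1.
Proof.
have := powR_ge0 s del; rewrite /decay; set u := _ `^ _ => u0.
rewrite ler_pdivrMr ?mul1r; last by rewrite exprn_gt0//; lra.
rewrite -subr_ge0 (_ : _ - _ = (1 - u) ^+ 2) ?sqr_ge0//; ring.
Qed.

End OmegaBound.

Section BesovBound.
Variables (R : realType) (d : nat).
Local Notation RR := (measurableTypeR R).
Local Notation leb := (@lebesgue_measure R).
Variables (x0 : 'I_d -> R) (rho : R) (w : 'I_d -> nat -> R -> R).
Hypotheses (rho0 : 0 < rho) (rho1 : rho <= 1).
Hypotheses (jw : forall j, jet (w j)) (sw : forall j, supp01 (w j)).

(** For a well-formed family this is, up to a constant, the p-th power of the L_p norm of the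
    unweighted part of level [e], whose atoms have disjoint supports. *)
Definition energy (p : R) (E I : finType) (lev : I -> E) k (a : I -> R) e : R :=
  \sum_(i | lev i == e) 2^-1 ^+ k * `|a i| `^ p.

Lemma energy_ge0 p (E I : finType) (lev : I -> E) k a e : 0 <= energy p lev k a e.
Proof.
by apply: sumr_ge0 => i _; rewrite mulr_ge0 ?powR_ge0// exprn_ge0// invr_ge0.
Qed.

Lemma sum_decays_energy p del (E I : finType) kp (lev : I -> E) k a (t : 'I_d -> R) :
  \sum_i decays kp del t (lev i) * (2^-1 ^+ k * `|a i| `^ p)
  = \sum_e decays kp del t e * energy p lev k a e.
Proof.
rewrite (partition_big lev xpredT)//=; apply: eq_bigr => e _.
by rewrite /energy mulr_sumr; apply: eq_bigr => i /eqP ->.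
Qed.

Lemma fdiff_atomic_sum0 (E I : finType) kp (lev : I -> E) nu alpha (a : I -> R) l h x :
  fdiff (lchi l finset.set0) h (atomic_sum x0 rho w kp lev nu alpha a) x
  = atomic_sum x0 rho w kp lev nu alpha a x.
Proof.
rewrite [in LHS](_ : atomic_sum x0 rho w kp lev nu alpha a = fun x => \sum_i (a i * weight kp alpha (lev i)) *
   atom x0 rho w kp lev nu (fun=> 0%N) i x)// fdiff_sum.
apply: eq_bigr => i _; congr (_ * _); rewrite fdiff_tens; apply: eq_bigr => j _.
by rewrite /lchi inE /fd1 big_ord1 subnn bin0 !mul1r mul0r addr0.
Qed.

Lemma prod_powR_J (J : {set 'I_d}) (t alpha : 'I_d -> R) :
  (forall j, j \notin J -> t j = 1) ->
  \prod_(j < d) t j `^ alpha j = \prod_(j in J) t j `^ alpha j.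
Proof.
move=> t1; rewrite (bigID (mem J))/= [X in _ * X]big1 ?mulr1// => j jJ.
by rewrite t1// powR1.
Qed.

Lemma lee_prod (I : Type) (s : seq I) (F G : I -> \bar R) :
  (forall i, (0 <= F i <= G i)%E) -> (\prod_(i <- s) F i <= \prod_(i <- s) G i)%E.
Proof.
move=> FG; suff /andP[] : (0 <= \prod_(i <- s) F i <= \prod_(i <- s) G i)%E by [].
elim/big_rec2 : _ => [|i y z _ /andP[y0 yz]]; first by rewrite lee01 lexx.
by have /andP[f0 fg] := FG i; rewrite mule_ge0// lee_pmul.
Qed.

(** If S(t) is the sum of the energies weighted by decay, then [Omega] is at most a constant times
    t^alpha S(t)^(1/p). For finite theta = r, with sg = min(1, r/p), the power S^(r/p) is split into
    S^(r/p - sg), bounded through the maximal energy, and S^sg, which is subadditive; the decay is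
    then integrated against dt/t. *)
Lemma besov_bound (alpha : 'I_d -> R) (p del : R) (theta : \bar R) : 0 < del -> 1 <= p ->
  (1 <= theta)%E ->
  (forall j, del <= alpha j) ->
  (forall j, del <= (l_of alpha j)%:R - alpha j) ->
  exists2 C, 0 < C &
  forall (D : set (pt R d)) (E I : finType) (kp : E -> 'I_d -> nat) (lev : I -> E) nu k a M,
    wf_family kp lev nu k -> 0 < M -> (forall e, energy p lev k a e <= M) ->
    C * M <= 1 ->
    (forall r, theta = r%:E -> C * M `^ (r / p - Num.min 1 (r / p)) *
       \sum_e energy p lev k a e `^ Num.min 1 (r / p) <= 1) ->
    (Lpn D p (atomic_sum x0 rho w kp lev nu alpha a) <= 1)%E /\
    forall J : {set 'I_d}, J != finset.set0 ->
      (semiJ D p theta alpha J (atomic_sum x0 rho w kp lev nu alpha a) <= 1)%E.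
Proof.
move=> d0 p1 th1 da dl; set l := l_of alpha.
have p0 : 0 < p by lra.
have [C C0 hC] := fdiff_integral_bound x0 rho0 rho1 jw sw d0 p1 da dl.
have [CW CW0 hCW] := @sum_decays R d del d0.
have [r r0 thr] : exists2 r : R, 0 < r & theta = r%:E \/ theta = +oo%E.
  case: theta th1 => [s||]//; last by exists 1 => //; right.
  by rewrite lee_fin => s1; exists s; [lra|left].
pose sg := Num.min 1 (r / p).
have sg0 : 0 < sg by rewrite lt_min ltr01 divr_gt0.
have sg1 : sg <= 1 by rewrite ge_min lexx.
have sgr : sg <= r / p by rewrite ge_min lexx orbT.
(* The summand 1 makes [H] at least 1, so that its power #|J| may be replaced by the power d. *)
pose H : R := 1 + 4 / (del * sg).
have H1 : 1 <= H by rewrite lerDl divr_ge0// ltW// mulr_gt0.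
pose K := C `^ (r / p) * CW `^ (r / p - sg) * 4 ^+ d * H ^+ d.
have K0 : 0 <= K by rewrite !mulr_ge0 ?powR_ge0 ?exprn_ge0//; lra.
exists (C * CW + K + 1); first by rewrite ltr_wpDl// addr_ge0// mulr_ge0// ltW.
move=> D E I kp lev nu k a M wf M0 hM hCM hCr.
set f := atomic_sum _ _ _ _ _ _ _ _.
set A := energy p lev k a.
have A0 e : 0 <= A e by exact: energy_ge0.
have CM : C * CW * M <= 1.
  by apply: le_trans hCM; rewrite ler_wpM2r ?(ltW M0)// -addrA lerDl addr_ge0.
pose S t := \sum_e decays kp del t e * A e.
have S0 t : 0 <= S t by apply: sumr_ge0 => e _; rewrite mulr_ge0// decays_ge0.
have SM t : (forall j, 0 < t j) -> S t <= CW * M.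
  move=> t0; apply: (@le_trans _ _ (\sum_e decays kp del t e * M)).
    by apply: ler_sum => e _; rewrite ler_wpM2l// decays_ge0.
  by rewrite -mulr_suml ler_wpM2r ?(ltW M0)//; exact: hCW wf t0.
have IB (J : {set 'I_d}) (xi t : 'I_d -> R) : (forall j, 0 < t j) ->
    (forall j, j \in J -> `|xi j| <= t j) -> (forall j, j \notin J -> t j = 1) ->
    (\int[lebm R d]_x (`|fdiff (lchi l J) xi f x| `^ p)%:E
     <= (C * (\prod_(j in J) t j `^ alpha j) `^ p * S t)%:E)%E.
  move=> t0 xit t1; rewrite -(prod_powR_J alpha t1) /S -sum_decays_energy.
  exact: hC.
split.
  have t0 (j : 'I_d) : 0 < (1 : R) by [].
  have := IB finset.set0 (fun=> 0) (fun=> 1) t0; rewrite big_set0 powR1 mulr1.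
  have e0 j : j \in (finset.set0 : {set 'I_d}) -> `|(0 : R)| <= 1 by rewrite inE.
  have e1 (j : 'I_d) : j \notin (finset.set0 : {set 'I_d}) -> (1 : R) = 1 by [].
  move=> /(_ e0 e1).
  under eq_integral do rewrite fdiff_atomic_sum0.
  move=> h; rewrite /Lpn lebmE -(poweR1r p^-1); apply: le_poweR.
  - by rewrite invr_ge0 ltW.
  - by apply: integral_ge0 => x _; rewrite lee_fin powR_ge0.
  - apply: le_trans (ge0_le_integral_raw _ _ _ _) (le_trans h _).
    + by move=> x _; rewrite lee_fin powR_ge0.
    + by move=> x; rewrite lee_fin powR_ge0.
    + by [].
    + rewrite lee_fin; apply: le_trans CM; rewrite -mulrA ler_wpM2l ?(ltW C0)//.
      exact: SM.
move=> J J0.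
have OM (t : 'I_d -> R) (t' : 'I_d -> R) : (forall j, 0 < t j) -> (forall j, 0 < t' j) ->
    (forall j, j \in J -> t' j = t j) -> (forall j, j \notin J -> t' j = 1) ->
    (Omega D p l J f t <=
     (C `^ p^-1 * (\prod_(j in J) t j `^ alpha j) * S t' `^ p^-1)%:E)%E.
  move=> t0 t'0 tt' t'1.
  set P := \prod_(j in J) t j `^ alpha j.
  have P0 : 0 <= P by apply: prodr_ge0 => j _; exact: powR_ge0.
  have -> : C `^ p^-1 * P * S t' `^ p^-1 = (C * P `^ p * S t') `^ p^-1.
    rewrite !powRM ?mulr_ge0 ?powR_ge0 ?(ltW C0)//.
    by rewrite -powRrM mulfV ?gt_eqF// powRr1.
  apply: Omega_le => //; first by rewrite !mulr_ge0 ?powR_ge0// ltW.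
  move=> xi hxi; have := IB J xi t' t'0; rewrite /P.
  rewrite (eq_bigr (fun j => t j `^ alpha j)); last by move=> j /tt' ->.
  by apply => // j jJ; rewrite tt'// hxi.
have St t : (forall j, 0 < t j) -> C * S t <= 1.
  move=> t0; apply: le_trans CM; rewrite -mulrA ler_wpM2l ?(ltW C0)//.
  exact: SM.
case: thr => th; last first.
  rewrite th /semiJ; apply: ge_ereal_sup => _ [t t0 <-].
  (* The supremum ranges over vectors of R^d; outside [J] they are reset to the default 1 for which
     the difference bound is available. *)
  pose t' j := if j \in J then t j else 1.
  have t'0 j : 0 < t' j by rewrite /t'; case: ifP.
  have t'J j : j \in J -> t' j = t j by rewrite /t' => ->.
  have t'N j : j \notin J -> t' j = 1 by rewrite /t' => /negbTE ->.
  have P0 : 0 <= \prod_(j in J) t j `^ (- alpha j).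
    by apply: prodr_ge0 => j _; exact: powR_ge0.
  apply: (le_trans (lee_pmul _ _ (lexx _) (OM t t' t0 t'0 t'J t'N))).
  - by rewrite lee_fin.
  - exact: poweR_ge0.
  rewrite -EFinM lee_fin [leLHS](_ : _ = (C * S t') `^ p^-1).
    apply: (@le_trans _ _ (1 `^ p^-1)); last by rewrite powR1.
    rewrite ge0_ler_powR ?nnegrE ?invr_ge0 ?(ltW p0) ?mulr_ge0 ?(ltW C0)//.
    exact: St.
  rewrite powRM ?(ltW C0)// -mulrA mulrCA; congr (_ * _).
  rewrite mulrA -big_split/= big1 ?mul1r// => j _.
  by rewrite -powRD ?addNr ?powRr0// (gt_eqF (t0 j)) implybT.
have {}hCr := hCr r th; rewrite th /semiJ lebmE.
(* The indicator of the half line is built into the factor, so that the integral over the positive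
   orthant becomes that of a tensor product over the whole space. *)
pose g e (i : 'I_#|J|) (y : R) : R :=
  (0 < y)%R%:R * (y `^ (-1) * decay (del * sg) (2 ^+ kp e (enum_val i) * y)).
have g0 e i y : 0 <= g e i y.
  by rewrite mulr_ge0 ?ler0n// mulr_ge0 ?powR_ge0// decay_ge0.
have gE e i y : ((g e i y)%:E = ((fun y => (y `^ (-1) * decay (del * sg) (2 ^+ kp e (enum_val i) * y))%:E) \_ (`]0%R, +oo[%classic : set RR)) y)%E.
  rewrite patchE /g mem_setE in_itv/= andbT; case: ifP; rewrite ?mul1r// mul0r.
  by [].
have mg e i : measurable_fun (setT : set RR) (g e i).
  apply: measurable_funM.
    have -> : (fun y : R => (0 < y)%R%:R : R) = \1_(`]0, +oo[%classic : set RR).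
      by apply/funext => y; rewrite indicE mem_setE in_itv/= andbT.
    exact: measurable_indic.
  apply: measurable_funM; first exact: measurable_powR.
  exact: measurable_decay.
have ig e i : (\int[leb]_y (g e i y)%:E <= H%:E)%E.
  under eq_integral do rewrite gE.
  rewrite -integral_mkcond; apply: (le_trans (integral_decay _ _)).
  - exact: mulr_gt0.
  - exact: exprn_gt0.
  - by rewrite lee_fin lerDr.
pose Kc := C `^ (r / p) * (CW * M) `^ (r / p - sg) * 4 ^+ d.
have Kc0 : 0 <= Kc by rewrite !mulr_ge0 ?powR_ge0 ?exprn_ge0.
have tgs0 e s : 0 <= tens (g e) s by apply: prodr_ge0 => i _.
have sum0 s : 0 <= \sum_e A e `^ sg * tens (g e) s.
  by apply: sumr_ge0 => e _; rewrite mulr_ge0 ?powR_ge0.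
have pw (s : #|J|.-tuple RR) : (forall i, 0 < tnth s i) ->
    ((\prod_(j in J) extJ s 1 j `^ (-1 - r * alpha j))%:E
      * poweR (Omega D p l J f (extJ s 1)) r
     <= (Kc * \sum_e A e `^ sg * tens (g e) s)%:E)%E.
  move=> s0; set t := extJ s 1.
  have tE i : t (enum_val i) = tnth s i by exact: extJ_enum_val.
  have t1 j : j \notin J -> t j = 1 by rewrite /t /extJ => /negbTE ->.
  have t0 j : 0 < t j.
    have [jJ|jJ] := boolP (j \in J); last by rewrite t1.
    by rewrite -(enum_rankK_in jJ jJ) tE.
  have P0 : 0 <= \prod_(j in J) t j `^ (-1 - r * alpha j).
    by apply: prodr_ge0 => j _; exact: powR_ge0.
  have Q0 : 0 <= \prod_(j in J) t j `^ alpha j.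
    by apply: prodr_ge0 => j _; exact: powR_ge0.
  have O0 : (0 <= Omega D p l J f t)%E by exact: poweR_ge0.
  have hO := OM t t t0 t0 (fun j _ => erefl) t1.
  apply: (le_trans (lee_pmul _ (poweR_ge0 _ _) (lexx _) (le_poweR (ltW r0) O0 hO))).
    by rewrite lee_fin.
  rewrite poweR_EFin -EFinM lee_fin.
  rewrite !powRM ?mulr_ge0 ?powR_ge0// -!powRrM [p^-1 * r]mulrC.
  rewrite powR_prod; last by move=> j; exact: powR_ge0.
  have -> : (\prod_(j in J) t j `^ (-1 - r * alpha j)) *
     (C `^ (r / p) * (\prod_(j in J) t j `^ alpha j `^ r) * S t `^ (r / p))
    = C `^ (r / p) * (S t `^ (r / p) * \prod_(j in J) t j `^ (-1)).
    have <- : (\prod_(j in J) t j `^ (-1 - r * alpha j))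
        * (\prod_(j in J) t j `^ alpha j `^ r) = \prod_(j in J) t j `^ (-1).
      rewrite -big_split; apply: eq_bigr => j _ /=.
      rewrite -powRrM -powRD; last by rewrite (gt_eqF (t0 j)) implybT.
      by congr (_ `^ _); ring.
    by ring.
  rewrite /Kc -!mulrA ler_wpM2l ?powR_ge0//.
  have -> : S t `^ (r / p) = S t `^ (r / p - sg) * S t `^ sg.
    by rewrite -powRD subrK// gt_eqF// divr_gt0.
  rewrite -mulrA; apply: ler_pM; rewrite ?powR_ge0//.
  - by rewrite mulr_ge0 ?powR_ge0// prodr_ge0// => j _; exact: powR_ge0.
  - rewrite ge0_ler_powR ?nnegrE ?subr_ge0 ?mulr_ge0 ?(ltW M0)//.
    exact: SM.
  apply: (le_trans (ler_wpM2r _ (sum_powR_le _ _ sg0 sg1 _))).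
  - by apply: prodr_ge0 => j _; exact: powR_ge0.
  - by move=> e; rewrite mulr_ge0// decays_ge0.
  rewrite mulr_suml mulr_sumr; apply: ler_sum => e _.
  have hD : decays kp del t e `^ sg
      <= 4 ^+ d * \prod_(j in J) decay (del * sg) (2 ^+ kp e j * t j).
    rewrite /decays powR_prod; last by move=> j; exact: decay_ge0.
    apply: (@le_trans _ _ (\prod_(j < d) (4 * decay (del * sg) (2 ^+ kp e j * t j)))).
      apply: ler_prod => j _; rewrite powR_ge0 powR_decay//.
      by rewrite mulr_gt0// exprn_gt0.
    rewrite big_split/= prodr_const card_ord ler_wpM2l ?exprn_ge0//.
    rewrite (bigID (mem J))/= ler_piMr//.
      by apply: prodr_ge0 => j _; exact: decay_ge0.
    apply: (@le_trans _ _ (\prod_(j < d | j \notin J) (1 : R))); last by rewrite big1.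
    by apply: ler_prod => j _; rewrite decay_ge0 decay_le1.
  have tgE : tens (g e) s = (\prod_(j in J) t j `^ (-1))
       * \prod_(j in J) decay (del * sg) (2 ^+ kp e j * t j).
    rewrite -big_split /= big_enum_val /tens; apply: eq_bigr => i _.
    by rewrite /g /coord tE s0 mul1r.
  have B0 : 0 <= \prod_(j in J) t j `^ (-1).
    by apply: prodr_ge0 => j _; exact: powR_ge0.
  rewrite tgE powRM ?decays_ge0//.
  have := ler_wpM2r B0 (ler_wpM2r (powR_ge0 (A e) sg) hD).
  by congr (_ <= _); ring.
rewrite -(poweR1r r^-1); apply: le_poweR; first by rewrite invr_ge0 ltW.
  apply: integral_ge0 => s _; rewrite mule_ge0 ?poweR_ge0// lee_fin.
  by apply: prodr_ge0 => j _; exact: powR_ge0.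
apply: (@le_trans _ _ (\int[lebm R #|J|]_s (Kc * \sum_e A e `^ sg * tens (g e) s)%:E)%E).
  apply: ge0_le_integral_raw => [s _|s|s hs]; last exact: pw.
  - rewrite mule_ge0 ?poweR_ge0// lee_fin.
    by apply: prodr_ge0 => j _; exact: powR_ge0.
  - by rewrite lee_fin mulr_ge0.
under eq_integral do rewrite EFinM -sumEFin.
have tm e s : (0 <= (A e `^ sg * tens (g e) s)%:E)%E by rewrite lee_fin mulr_ge0 ?powR_ge0.
have mt e : measurable_fun setT (fun s : pt R #|J| => (A e `^ sg * tens (g e) s)%:E).
  apply/measurable_EFinP; apply: measurable_funM => //.
  by apply: measurable_tens => i; exact: mg.
rewrite ge0_integralZl_EFin//; last 2 first.
- by move=> s _; apply: sume_ge0 => e _; exact: tm.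
- by apply: emeasurable_sum.
rewrite ge0_integral_sum//.
apply: (@le_trans _ _ (Kc%:E * \sum_e (A e `^ sg * H ^+ d)%:E)%E).
  apply: lee_pmul; rewrite ?lee_fin//.
    by apply: sume_ge0 => e _; apply: integral_ge0 => s _; exact: tm.
  apply: lee_sum => e _; under eq_integral do rewrite EFinM.
  rewrite ge0_integralZl_EFin ?powR_ge0//; last 2 first.
  - by move=> s _; rewrite lee_fin.
  - by apply/measurable_EFinP; apply: measurable_tens => i; exact: mg.
  rewrite EFinM; apply: lee_pmul; rewrite ?lee_fin ?powR_ge0//.
    by apply: integral_ge0 => s _; rewrite lee_fin.
  rewrite ge0_integral_tens//; last by move=> j; exact: mg.
  apply: (@le_trans _ _ (\prod_(i < #|J|) H%:E)%E).
    apply: lee_prod => i; rewrite ig andbT.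
    by apply: integral_ge0 => y _; rewrite lee_fin.
  rewrite prodEFin prodr_const card_ord lee_fin.
  rewrite ler_weXn2l//; rewrite -[leqRHS](card_ord d); exact: max_card.
rewrite sumEFin -mulr_suml -EFinM lee_fin.
apply: le_trans hCr; rewrite -/sg -/A mulrA mulrAC.
rewrite ler_wpM2r ?sumr_ge0//; first by move=> e _; exact: powR_ge0.
rewrite /Kc powRM ?(ltW M0)//.
have -> : C `^ (r / p) * (CW `^ (r / p - sg) * M `^ (r / p - sg)) * 4 ^+ d * H ^+ d
   = K * M `^ (r / p - sg) by rewrite /K; ring.
rewrite ler_wpM2r ?powR_ge0//.
by rewrite -addrA addrCA lerDl addr_ge0// mulr_ge0// ltW.
Qed.

End BesovBound.

(** * Duality *)

Section Smoothness.
Variable R : realType.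
Local Notation RR := (measurableTypeR R).

(** The filter behind [cont_at]; through it the rules for limits of sums and products apply to
    functions on tuples. *)
Definition box_filter d (x : pt R d) : set_system (pt R d) :=
  [set A | exists2 del : R, 0 < del & boxnbhd x del `<=` A].

Instance box_filter_filter d (x : pt R d) : Filter (box_filter x).
Proof.
split.
- by exists 1.
- move=> A B [e e0 eA] [e' e'0 eB]; exists (Num.min e e'); first by rewrite lt_min e0.
  move=> y hy; split; [apply: eA|apply: eB] => i.
    by apply: (lt_le_trans (hy i)); rewrite ge_min lexx.
  by apply: (lt_le_trans (hy i)); rewrite ge_min lexx orbT.
- by move=> A B AB [e e0 eA]; exists e => // y /eA /AB.
Qed.

Lemma cont_atP d (f : pt R d -> R) x : cont_at f x <-> f @ box_filter x --> f x.
Proof.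
split.
- move=> cf; apply/cvgrPdist_lt => e e0; have [del d0 h] := cf e e0.
  by exists del => // y /h; rewrite distrC.
- move=> cf e e0; have /cvgrPdist_lt/(_ e e0)[del d0 h] := cf.
  by exists del => // y /h /=; rewrite distrC.
Qed.

Lemma cont_at_tens d (g : 'I_d -> R -> R) x :
  (forall j, continuous (g j)) -> cont_at (tens g) x.
Proof.
move=> cg; apply/cont_atP; rewrite /tens.
have cj j : (fun y : pt R d => g j (coord y j)) @ box_filter x --> g j (coord x j).
  apply/cvgrPdist_lt => e e0.
  have /cvgrPdist_lt/(_ e e0)[del /= d0 h] := cg j (coord x j).
  exists del => // y /(_ j) hy; apply: h => /=.
  by rewrite distrC.
elim: (index_enum _) => [|j s IH].
  under eq_fun do rewrite big_nil; rewrite big_nil; exact: cvg_cst.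
under eq_fun do rewrite big_cons; rewrite big_cons; exact: cvgM.
Qed.

Lemma cont_at_sum d (I : finType) (c : I -> R) (f : I -> pt R d -> R) x :
  (forall i, cont_at (f i) x) -> cont_at (fun x => \sum_i c i * f i x) x.
Proof.
move=> cf; apply/cont_atP; elim: (index_enum _) => [|i s IH].
  under eq_fun do rewrite big_nil; rewrite big_nil; exact: cvg_cst.
under eq_fun do rewrite big_cons; rewrite big_cons; apply: cvgD => //.
by apply: cvgM; [exact: cvg_cst|exact/cont_atP].
Qed.

Lemma cont_at_cont_on d (D : set (pt R d)) f : (forall x, cont_at f x) -> cont_on D f.
Proof.
move=> cf x _ e e0; have [del d0 h] := cf x e e0.
by exists del => // y _; exact: h.
Qed.

Section TensorJets.
Variables (d : nat) (I : finType) (c : I -> R) (v : I -> 'I_d -> nat -> R -> R).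
Hypothesis jv : forall i j, jet (v i j).

(** Combinations of tensor products of jets are stable under partial derivatives, which merely raise
    an entry of [n]. Atomic sums and probes both have this form. *)
Definition jsum (n : 'I_d -> nat) (x : pt R d) : R :=
  \sum_i c i * tens (fun j => v i j (n j)) x.

Lemma is_derive_jsum n j x :
  is_derive (0 : R) 1 (fun t : R => jsum n (shift x j t))
    (jsum (fun i => ((j == i) + n i)%N) x).
Proof.
have H i : is_derive (0 : R) 1 (fun t : R => tens (fun j => v i j (n j)) (shift x j t))
    (tens (fun k => v i k ((j == k) + n k)%N) x).
  have dl : is_derive (0 : R) 1 (fun t : R => coord x j + t) 1.
    have h := is_deriveD (is_derive_cst (coord x j) (0 : R) 1) (is_derive_id (0 : R) 1).
    by apply: is_derive_eq h _; rewrite add0r.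
  have h0 : is_derive (coord x j + 0) 1 (v i j (n j)) (v i j (n j).+1 (coord x j)).
    by rewrite addr0; exact: jv.
  have h := is_deriveZ (\prod_(k < d | k != j) v i k (n k) (coord x k))
     (@is_derive1_comp R (v i j (n j)) (fun t => coord x j + t) 0 _ _ h0 dl).
  have -> : (fun t : R => tens (fun j => v i j (n j)) (shift x j t)) =
    (\prod_(k < d | k != j) v i k (n k) (coord x k)) \*: (v i j (n j) \o (fun t : R => coord x j + t)).
    apply/funext => t; rewrite /tens (bigD1 j)//= mulrC; congr (_ * _).
      apply: eq_bigr => k /negbTE kj.
      by rewrite /coord tnth_mktuple kj.
    by rewrite /coord tnth_mktuple eqxx.
  apply: is_derive_eq h _.
  rewrite /GRing.scale/= mulr1 /tens [RHS](bigD1 j)//= eqxx add1n mulrC; congr (_ * _).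
  by apply: eq_bigr => k; rewrite eq_sym => /negbTE ->.
rewrite /jsum; elim: (index_enum _) => [|i s IH].
  under eq_fun do rewrite big_nil; rewrite big_nil; exact: is_derive_cst.
under eq_fun do rewrite big_cons; rewrite big_cons.
exact: is_deriveD (is_deriveZ (c i) (H i)) IH.
Qed.

Lemma iter_pder_jsum s :
  iter_pder s (jsum (fun=> 0%N)) = jsum (fun i => count_mem i s).
Proof.
elim: s => [//|j s IH]; apply/funext => x /=; rewrite IH /pder.
have [_] := is_derive_jsum (fun i => count_mem i s) j x.
by rewrite derive1E.
Qed.

Lemma jsum_cont n x : cont_at (jsum n) x.
Proof.
apply: cont_at_sum => i; apply: cont_at_tens => j.
exact: jet_continuous.
Qed.

Lemma jsum_smooth : smooth (jsum (fun=> 0%N)).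
Proof.
move=> s x; rewrite iter_pder_jsum; split; last exact: jsum_cont.
by move=> j; have [] := is_derive_jsum (fun i => count_mem i s) j x.
Qed.

End TensorJets.

Lemma count_dseq d (lam : 'I_d -> nat) i : count_mem i (dseq lam) = lam i.
Proof.
rewrite /dseq count_flatten -map_comp sumnE big_map.
rewrite (bigD1_seq i) ?enum_uniq ?mem_enum//= big1 ?addn0.
  by rewrite count_nseq/= eqxx mul1n.
by move=> j /negbTE ji; rewrite count_nseq/= ji mul0n.
Qed.

Lemma open_measurable_pt d (D : set (pt R d)) : is_open D -> measurable (D : set (d.-tuple RR)).
Proof.
move=> oD.
pose B (c : {ffun 'I_d -> rat}) (n : nat) : set (pt R d) :=
  [set x | forall j, `|coord x j - ratr (c j)| < n.+1%:R^-1].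
have mB c n : measurable (B c n : set (d.-tuple RR)).
  have -> : B c n = \big[setI/setT]_(j < d) ((fun x : pt R d => coord x j) @^-1`
      `]ratr (c j) - n.+1%:R^-1, ratr (c j) + n.+1%:R^-1[%classic).
    rewrite -bigcap_seq; apply/seteqP; split => x /= h j.
      by move=> _; rewrite /= in_itv/= -ltr_distl; exact: h.
    by have := h j; rewrite /= mem_index_enum in_itv/= -ltr_distl; apply.
  apply: bigsetI_measurable => j _; rewrite -[X in measurable X]setTI.
  by apply: (measurable_coord j) => //; exact: measurable_itv.
have -> : D = \bigcup_(cn in [set cn : {ffun 'I_d -> rat} * nat | B cn.1 cn.2 `<=` D]) B cn.1 cn.2.
  apply/seteqP; split => x; last by move=> [cn /= h]; exact: h.
  move=> Dx; have [e e0 eD] := oD x Dx.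
  (* Twice the radius 1/(n+1) has to stay below [e], because points of the box are compared with [x]
     through its rational centre. *)
  pose n := Num.truncn (2 / e).
  have n0 : 0 < n.+1%:R^-1 :> R by rewrite invr_gt0 ltr0n.
  have ne : 2 * n.+1%:R^-1 < e.
    rewrite ltr_pdivrMr ?ltr0n// mulrC -ltr_pdivrMr//.
    exact: truncnS_gt.
  have hq j : exists q : rat, `|coord x j - ratr q| < n.+1%:R^-1.
    have [|q] := @rat_in_itvoo R (coord x j - n.+1%:R^-1) (coord x j + n.+1%:R^-1).
      by rewrite ltrD2l; apply: lt_trans n0; rewrite oppr_lt0.
    rewrite in_itv/= -ltr_distl => hq; exists q; by rewrite distrC.
  pose c : {ffun 'I_d -> rat} := [ffun j => projT1 (cid (hq j))].
  have hc j : `|coord x j - ratr (c j)| < n.+1%:R^-1 by rewrite ffunE; case: cid.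
  exists (c, n) => //= y hy; apply: eD => j.
  have -> : coord y j - coord x j = (coord y j - ratr (c j)) - (coord x j - ratr (c j)) by ring.
  apply: (le_lt_trans (ler_normB _ _)); apply: lt_le_trans (ltW ne).
  by rewrite mulr2n mulrDl mul1r; apply: ltrD; [exact: hy|exact: hc].
rewrite bigcup_mkcond; apply: countable_bigcupT_measurable; first exact: countableP.
by move=> cn; case: ifP => _; [exact: mB|exact: measurable0].
Qed.

End Smoothness.

(** * Pairing of atomic sums with probes *)

Section Duality.
Variables (R : realType) (d : nat).
Local Notation leb := (@lebesgue_measure R).

Lemma integral_sum_tens n (I : finType) (c : I -> R) (g : I -> 'I_n -> R -> R) :
  (forall i j, leb.-integrable setT (EFin \o g i j)) ->
  (lebm R n).-integrable setT (fun x => (\sum_i c i * tens (g i) x)%:E) /\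
  (\int[lebm R n]_x (\sum_i c i * tens (g i) x)%:E
   = (\sum_i c i * \prod_(j < n) \int[leb]_y g i j y)%R%:E)%E.
Proof.
move=> ig.
have it i : (lebm R n).-integrable setT (fun x => (c i)%:E * (tens (g i) x)%:E)%E.
  by apply: integrableZl => //; exact: integrable_tens.
have E : (fun x => (\sum_i c i * tens (g i) x)%:E)
    = (fun x => \sum_i ((c i)%:E * (tens (g i) x)%:E))%E.
  by apply/funext => x; rewrite -sumEFin; apply: eq_bigr => i _; rewrite EFinM.
split; first by rewrite E; exact: integrable_sum.
rewrite E integral_sum// -sumEFin; apply: eq_bigr => i _.
rewrite integralZl//; last exact: integrable_tens.
by rewrite integral_tens.
Qed.

Lemma tensM n (g h : 'I_n -> R -> R) x :
  tens g x * tens h x = tens (fun j y => g j y * h j y) x.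
Proof. by rewrite /tens -big_split. Qed.

Variables (x0 : 'I_d -> R) (rho : R) (w : 'I_d -> nat -> R -> R).
Hypotheses (rho0 : 0 < rho).
Hypotheses (jw : forall j, jet (w j)) (sw : forall j, supp01 (w j)).
Variables (E I : finType) (kp : E -> 'I_d -> nat) (lev : I -> E) (nu : I -> 'I_d -> int).
Variable lam : 'I_d -> nat.

Local Notation sc i j := (scale rho kp (lev i) j).
Local Notation off i j := (offset x0 rho kp lev nu i j).

(** Derivative sequences of the coordinate factors of an atom ([jetf]) and of a probe ([jett]). The
    second starts at order lam j + 1 of the wavelet, without the powers of the scale that lam j
    differentiations would produce. *)
Definition jetf i j n y := sc i j ^+ n * w j n.+1 (sc i j * y - off i j).
Definition jett i j n y := sc i j ^+ n * w j (lam j + n).+1 (sc i j * y - off i j).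

Let sc0 i j : 0 < sc i j. Proof. exact: scale_gt0. Qed.

Lemma jet_jetf i j : jet (jetf i j).
Proof.
by apply: (@jet_affine R (fun n => w j n.+1)) => n x; exact: jw.
Qed.

Lemma jet_jett i j : jet (jett i j).
Proof.
apply: (@jet_affine R (fun n => w j (lam j + n).+1)) => n x.
by rewrite addnS; exact: jw.
Qed.

Lemma csupp_jetf i j : csupp (jetf i j) (sc i j) (off i j).
Proof. by apply: (@affine_csupp R (fun n => w j n.+1)) => n x; exact: sw. Qed.

Definition probe (b : I -> R) : pt R d -> R :=
  fun x => \sum_i b i * atom x0 rho w kp lev nu lam i x.

Lemma probe_jsum b : probe b = jsum b jett (fun=> 0%N).
Proof.
apply/funext => x; apply: eq_bigr => i _; congr (_ * _).
by apply: eq_bigr => j _; rewrite /jett expr0 mul1r addn0.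
Qed.

Lemma atomic_sum_jsum alpha a : atomic_sum x0 rho w kp lev nu alpha a
  = jsum (fun i => a i * weight kp alpha (lev i)) jetf (fun=> 0%N).
Proof.
apply/funext => x; apply: eq_bigr => i _; congr (_ * _).
by apply: eq_bigr => j _; rewrite /jetf expr0 mul1r.
Qed.

Definition gram i i' : R := \prod_(j < d)
  \int[leb]_y (w j (lam j).+1 (sc i j * y - off i j) * w j (lam j).+1 (sc i' j * y - off i' j)).

Lemma integrable_jetM i j n (f : R -> R) : continuous f ->
  leb.-integrable setT (EFin \o (fun y => jetf i j n y * f y)).
Proof.
move=> cf; apply: (@csupp_integrable _ _ (sc i j) (off i j)) => //.
  move=> y; apply: cvgM; last exact: cf.
  by apply: jet_continuous; exact: jet_jetf.
by move=> y h; rewrite csupp_jetf// mul0r.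
Qed.

(** Integration by parts in each coordinate moves the lam derivatives onto the atoms. This releases
    the factor scale^lam and leaves the same wavelet, of order lam + 1, on both sides, hence a Gram
    matrix. *)
Lemma pairing_jsum alpha (a b : I -> R) :
  (\int[lebm R d]_x (atomic_sum x0 rho w kp lev nu alpha a x
       * iter_pder (dseq lam) (probe b) x)%:E
   = ((-1) ^+ (\sum_(j < d) lam j) *
      \sum_i \sum_i' (a i * weight kp alpha (lev i) * (\prod_(j < d) sc i j ^+ lam j))
         * b i' * gram i i')%:E)%E.
Proof.
rewrite probe_jsum iter_pder_jsum; last by move=> i j; exact: jet_jett.
rewrite (_ : (fun i => count_mem i (dseq lam)) = lam); last first.
  by apply/funext => i; exact: count_dseq.
rewrite atomic_sum_jsum.
pose g (ii : I * I) j y := jetf ii.1 j 0 y * jett ii.2 j (lam j) y.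
have cj i j n : continuous (jett i j n) by apply: jet_continuous; exact: jet_jett.
have ig ii j : leb.-integrable setT (EFin \o g ii j) by exact: integrable_jetM.
pose c (ii : I * I) := a ii.1 * weight kp alpha (lev ii.1) * b ii.2.
have [_ H] := integral_sum_tens c ig.
under eq_integral => x _.
  rewrite (_ : jsum _ _ _ x * _ = \sum_ii c ii * tens (g ii) x); last first.
    rewrite /jsum mulr_suml; under eq_bigr do rewrite mulr_sumr.
    rewrite pair_bigA; apply: eq_bigr => -[i i'] _ /=.
    by rewrite /c /g /= -tensM /=; ring.
  over.
rewrite H; congr EFin; rewrite mulr_sumr.
under [RHS]eq_bigr do rewrite mulr_sumr.
rewrite pair_bigA; apply: eq_bigr => -[i i'] _ /=.
have -> : \prod_(j < d) \int[leb]_y g (i, i') j y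
   = (-1) ^+ (\sum_(j < d) lam j) * ((\prod_(j < d) sc i j ^+ lam j) * gram i i').
  rewrite /gram -prodrXr -!big_split /=; apply: eq_bigr => j _.
  rewrite (jet_byparts_iter _ (sc0 i j) (@jet_jetf i j) (@jet_jett i' j) (@csupp_jetf i j)).
  congr (_ * _); rewrite -RintegralZl//; last first.
    apply: (@csupp_integrable _ _ (sc i j) (off i j)) => //.
      by move=> y; apply: cvgM; exact: continuous_affine_jet.
    by move=> y h; rewrite sw// mul0r.
  by apply: eq_Rintegral => y _; rewrite /jetf /jett expr0 mul1r addn0 mulrA.
by rewrite /c /=; ring.
Qed.

End Duality.

(** * From a dual pair to the recovery width *)

Section RecoveryLowerBound.
Variables (R : realType) (d : nat).
Local Notation RR := (measurableTypeR R).

Lemma young_scaled (u v U Z q q' : R) : 0 <= u -> 0 <= v -> 0 < U -> 0 < Z ->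
  0 < q -> 0 < q' -> q^-1 + q'^-1 = 1 ->
  u * v <= U * Z * (u `^ q / (U `^ q * q) + v `^ q' / (Z `^ q' * q')).
Proof.
move=> u0 v0 U0 Z0 q0 q'0 qq'.
have := @conjugate_powR R (u / U) (v / Z) q q' (divr_ge0 u0 (ltW U0)) (divr_ge0 v0 (ltW Z0)) q0 q'0 qq'.
have E (x X s : R) : 0 <= x -> 0 < X -> (x / X) `^ s / s = x `^ s / (X `^ s * s).
  move=> x_ge0 X0; rewrite powRM ?invr_ge0 ?(ltW X0)// -powR_inv1 ?(ltW X0)// -powRrM.
  by rewrite mulN1r powRN invfM mulrA.
rewrite !E// => h.
have UZ : 0 < U * Z by exact: mulr_gt0.
rewrite -ler_pdivrMl//; apply: le_trans h.
by rewrite le_eqVlt; apply/orP; left; apply/eqP; field; rewrite !gt_eqF.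
Qed.

(** Integrating Young's inequality for u/U and phi/Z gives Hölder's inequality together with
    integrability. Positive bounds U and Z replace the norms, which could vanish. *)
Lemma pairing_bound (D : set (pt R d)) (u phi : pt R d -> R) (q q' U Z : R) :
  measurable (D : set (d.-tuple RR)) -> measurable_fun D u -> measurable_fun D phi ->
  0 < q -> 0 < q' -> q^-1 + q'^-1 = 1 -> 0 < U -> 0 < Z ->
  (\int[lebm R d]_(x in D) (`|u x| `^ q)%:E <= (U `^ q)%:E)%E ->
  (\int[lebm R d]_(x in D) (`|phi x| `^ q')%:E <= (Z `^ q')%:E)%E ->
  (lebm R d).-integrable D (fun x => (u x * phi x)%:E) /\
  (`|\int[lebm R d]_(x in D) (u x * phi x)%:E| <= (U * Z)%:E)%E.
Proof.
move=> mD mu mphi q0 q'0 qq' U0 Z0 hu hphi.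
have Uq : 0 < U `^ q by exact: powR_gt0.
have Zq : 0 < Z `^ q' by exact: powR_gt0.
pose cu := U * Z / (U `^ q * q); pose cp := U * Z / (Z `^ q' * q').
have cu0 : 0 <= cu by rewrite divr_ge0 ?mulr_ge0 ?ltW// mulr_gt0.
have cp0 : 0 <= cp by rewrite divr_ge0 ?mulr_ge0 ?ltW// mulr_gt0.
have mup : measurable_fun D (fun x => (u x * phi x)%:E).
  by apply/measurable_EFinP; exact: measurable_funM.
have muq : measurable_fun D (fun x => (`|u x| `^ q)%:E).
  apply/measurable_EFinP; apply: (measurableT_comp (measurable_powR q)).
  exact: measurableT_comp.
have mpq : measurable_fun D (fun x => (`|phi x| `^ q')%:E).
  apply/measurable_EFinP; apply: (measurableT_comp (measurable_powR q')).
  exact: measurableT_comp.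
have H : (\int[lebm R d]_(x in D) `|(u x * phi x)%:E| <= (U * Z)%:E)%E.
  apply: (@le_trans _ _ (\int[lebm R d]_(x in D)
     (cu%:E * (`|u x| `^ q)%:E + cp%:E * (`|phi x| `^ q')%:E))%E).
    apply: ge0_le_integral => //.
    - exact: measurableT_comp.
    - by apply: emeasurable_funD; apply: measurable_funeM.
    - move=> x _; rewrite -!EFinM -EFinD lee_fin normrM.
      apply: (le_trans (young_scaled (normr_ge0 _) (normr_ge0 _) U0 Z0 q0 q'0 qq')).
      by rewrite le_eqVlt; apply/orP; left; apply/eqP; rewrite /cu /cp; ring.
  rewrite ge0_integralD//; last 4 first.
  - by move=> x _; rewrite -EFinM lee_fin mulr_ge0 ?powR_ge0.
  - exact: measurable_funeM.
  - by move=> x _; rewrite -EFinM lee_fin mulr_ge0 ?powR_ge0.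
  - exact: measurable_funeM.
  rewrite !ge0_integralZl_EFin//; try by move=> x _; rewrite lee_fin powR_ge0.
  apply: (@le_trans _ _ (cu%:E * (U `^ q)%:E + cp%:E * (Z `^ q')%:E)%E).
    by apply: leeD; apply: lee_wpmul2l; rewrite ?lee_fin.
  rewrite -!EFinM -EFinD lee_fin.
  have -> : cu * U `^ q + cp * Z `^ q' = U * Z * (q^-1 + q'^-1).
    by rewrite /cu /cp; field; rewrite !gt_eqF.
  by rewrite qq' mulr1.
split; last exact: (le_trans (le_abse_integral _ mD mup) H).
by apply/integrableP; split => //; apply: (le_lt_trans H); rewrite ltry.
Qed.

Lemma Lpn_le (D : set (pt R d)) (q U : R) u : 0 < q -> 0 <= U ->
  (Lpn D q u <= U%:E)%E -> (\int[lebm R d]_(x in D) (`|u x| `^ q)%:E <= (U `^ q)%:E)%E.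
Proof.
move=> q0 U0; rewrite /Lpn lebmE => h.
have I0 : (0 <= \int[lebm R d]_(x in D) (`|u x| `^ q)%:E)%E.
  by apply: integral_ge0 => x _; rewrite lee_fin powR_ge0.
rewrite -[leLHS]poweRe1// -[X in poweR _ X](@mulVf _ q) ?gt_eqF// poweRrM.
rewrite -poweR_EFin; apply: le_poweR => //; first exact: ltW.
exact: poweR_ge0.
Qed.

(** Both functions yield zero data, hence the same output h. If both errors were below dl, each
    would pair with phi to at most dl Z in absolute value, whereas the two pairings differ by 2X. *)
Lemma recovery_width_ge (D : set (pt R d)) lam (K : set (pt R d -> R)) (q q' : R) n (dl : R) :
  is_open D -> 0 < q -> 0 < q' -> q^-1 + q'^-1 = 1 -> 0 < dl ->
  (forall y : 'I_n -> pt R d, (forall i, D (y i)) ->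
    exists (f f' phi : pt R d -> R) (Z X : R),
    [/\ K f, K f', (forall i, f (y i) = 0) & (forall i, f' (y i) = 0)] /\
    [/\ test_fun D phi, measurable_fun setT phi, 0 < Z &
      (\int[lebm R d]_(x in D) (`|phi x| `^ q')%:E <= (Z `^ q')%:E)%E] /\
    [/\ (\int[lebm R d]_(x in D) (f x * iter_pder (dseq lam) phi x)%:E
           = ((-1) ^+ (\sum_(j < d) lam j)%N * X)%:E)%E,
        (\int[lebm R d]_(x in D) (f' x * iter_pder (dseq lam) phi x)%:E
           = ((-1) ^+ (\sum_(j < d) lam j)%N * - X)%:E)%E &
        dl * Z < X]) ->
  (dl%:E <= recovery_width D lam K q n)%E.
Proof.
move=> oD q0 q'0 qq' dl0 hyp; have mD := open_measurable_pt oD.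
apply: le_ereal_inf_tmp => _ [[y A] [/= Dy mA] <-].
have [f [f' [phi [Z [X [[Kf Kf' fy f'y] [[tphi mphi Z0 hZ] [If If' hX]]]]]]]] := hyp y Dy.
rewrite leNgt; apply/negP => hsup.
have v0 : (fun i => f (y i)) = (fun=> 0) by apply/funext => i; exact: fy.
have v0' : (fun i => f' (y i)) = (fun=> 0) by apply/funext => i; exact: f'y.
set h := A (fun=> 0).
have [mh Lh] := mA (fun=> 0).
have lt1 : (deriv_err D q lam f h < dl%:E)%E.
  apply: le_lt_trans hsup; rewrite /h -v0; apply: ereal_sup_ubound.
  by exists f; [exact: Kf|reflexivity].
have lt2 : (deriv_err D q lam f' h < dl%:E)%E.
  apply: le_lt_trans hsup; rewrite /h -v0'; apply: ereal_sup_ubound.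
  by exists f'; [exact: Kf'|reflexivity].
have mphiD : measurable_fun D phi by exact: measurable_funTS.
have key g0 s : (deriv_err D q lam g0 h < dl%:E)%E ->
   (\int[lebm R d]_(x in D) (g0 x * iter_pder (dseq lam) phi x)%:E
           = ((-1) ^+ (\sum_(j < d) lam j)%N * s)%:E)%E ->
   exists g, [/\ (lebm R d).-integrable D (fun x => (g x * phi x)%:E),
      (\int[lebm R d]_(x in D) (g x * phi x)%:E = s%:E)%E,
      (lebm R d).-integrable D (fun x => ((g x - h x) * phi x)%:E) &
      (`|\int[lebm R d]_(x in D) ((g x - h x) * phi x)%:E| <= (dl * Z)%:E)%E].
  move=> /ereal_inf_lt[_ [g [mg Lg wg] <-] hg] Is; exists g.
  have [i1 b1] : (lebm R d).-integrable D (fun x => ((g x - h x) * phi x)%:E) /\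
      (`|\int[lebm R d]_(x in D) ((g x - h x) * phi x)%:E| <= (dl * Z)%:E)%E.
    apply: (pairing_bound mD _ mphiD q0 q'0 qq' dl0 Z0 _ hZ).
      exact: measurable_funB.
    by apply: Lpn_le => //; exact: ltW.
  have [i2 _] : (lebm R d).-integrable D (fun x => (g x * phi x)%:E) /\
      (`|\int[lebm R d]_(x in D) (g x * phi x)%:E| <= ((fine (Lpn D q g) + 1) * Z)%:E)%E.
    have L0 : (0 <= Lpn D q g)%E by exact: poweR_ge0.
    (* Only integrability of g phi is wanted here; adding 1 supplies a positive bound even if g has
       norm zero. *)
    have L1 : 0 < fine (Lpn D q g) + 1 by rewrite ltr_wpDl// fine_ge0.
    apply: (pairing_bound mD mg mphiD q0 q'0 qq' L1 Z0 _ hZ).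
    apply: Lpn_le => //; first exact: ltW.
    rewrite EFinD fineK ?ge0_fin_numE//; by rewrite leeDl.
  split => //.
  have := wg phi tphi; rewrite lebmE Is.
  have fin := integrable_fin_num mD i2.
  move: fin; case: (\int[lebm R d]_(x in D) (g x * phi x)%:E)%E => // r _.
  rewrite -EFinM => -[/(congr1 (fun z => (-1) ^+ (\sum_(j < d) lam j)%N * z))].
  by rewrite !mulrA -expr2 sqrr_sign !mul1r => ->.
have [g1 [i1 e1 j1 b1]] := key f X lt1 If.
have [g2 [i2 e2 j2 b2]] := key f' (- X) lt2 If'.
have : (\int[lebm R d]_(x in D) (((g1 x - h x) * phi x)%:E - ((g2 x - h x) * phi x)%:E)
   = \int[lebm R d]_(x in D) ((g1 x * phi x)%:E - (g2 x * phi x)%:E))%E.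
  by apply: eq_integral => x _; rewrite -!EFinB; congr EFin; ring.
rewrite !integralB// e1 e2 => E.
have f1 := integrable_fin_num mD j1; have f2 := integrable_fin_num mD j2.
move: E b1 b2; rewrite -(fineK f1) -(fineK f2).
set r1 := fine _; set r2 := fine _.
rewrite -!EFinB => -[E]; rewrite !abse_EFin !lee_fin => b1 b2.
have := ler_norm r1; have := ler_norm (- r2); rewrite normrN; lra.
Qed.

End RecoveryLowerBound.

(** * Projections, random signs and Gram matrices *)

Section Projection.
Variable R : realType.

Lemma row_sqr_eq0 n (v : 'rV[R]_n) : v *m v^T = 0 -> v = 0.
Proof.
move=> /matrixP/(_ 0 0); rewrite !mxE => h; apply/rowP => j; rewrite mxE.
have : \sum_j v 0 j ^+ 2 = 0.
  by rewrite -[RHS]h; apply: eq_bigr => k _; rewrite mxE expr2.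
move=> /eqP; rewrite psumr_eq0; last by move=> k _; exact: sqr_ge0.
by move=> /allP/(_ j); rewrite mem_index_enum /= sqrf_eq0 => /(_ isT)/eqP.
Qed.

(** [Q] is the orthogonal projection onto the row space of [B0], and its trace is the rank. Passing
    to a row basis first makes the Gram matrix [S] invertible. *)
Lemma exists_projection_mx n N (B0 : 'M[R]_(n, N)) : exists P : 'M[R]_N,
  [/\ P^T = P, P *m P = P, B0 *m P = 0 & N%:R - n%:R <= \tr P].
Proof.
have [r [B [fB B0B rn]]] : exists r (B : 'M[R]_(r, N)),
    [/\ row_free B, (B0 <= B)%MS & (r <= n)%N].
  exists (\rank B0), (row_base B0); split; rewrite ?row_base_free ?eq_row_base//.
  exact: rank_leq_row.
pose S := B *m B^T.
have uS : S \in unitmx.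
  rewrite -row_free_unit; apply: inj_row_free => v hv.
  apply: (row_free_inj fB); rewrite mul0mx; apply: row_sqr_eq0.
  by rewrite trmx_mul mulmxA -(mulmxA v) -/S hv mul0mx.
have sS : S^T = S by rewrite /S trmx_mul trmxK.
pose Q := B^T *m invmx S *m B.
have QT : Q^T = Q by rewrite /Q !trmx_mul trmxK trmx_inv sS mulmxA.
have BQ : B *m Q = B by rewrite /Q !mulmxA -/S mulmxV// mul1mx.
have QQ : Q *m Q = Q by rewrite {1}/Q -mulmxA BQ.
exists (1%:M - Q); split.
- by rewrite linearB/= trmx1 QT.
- by rewrite mulmxBl !mulmxBr !mul1mx mulmx1 QQ subrr subr0.
- have /submxP[X ->] := B0B.
  by rewrite mulmxBr mulmx1 -mulmxA BQ subrr.
- rewrite linearB/= mxtrace1 /Q -mulmxA mxtrace_mulC -mulmxA -/S mulVmx// mxtrace1.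
  by rewrite lerD2l lerN2 ler_nat.
Qed.

Lemma exists_projection (I : finType) n (c : 'I_n -> I -> R) :
  exists P : I -> I -> R,
  [/\ forall i j, P i j = P j i,
      forall i j, \sum_k P i k * P k j = P i j,
      forall t j, \sum_i c t i * P i j = 0 &
      #|I|%:R - n%:R <= \sum_i P i i].
Proof.
have [P [PT PP BP tP]] := exists_projection_mx (\matrix_(t < n, i < #|I|) c t (enum_val i)).
exists (fun i j => P (enum_rank i) (enum_rank j)); split.
- by move=> i j; rewrite -{1}PT mxE.
- move=> i j; rewrite -[in RHS]PP mxE (reindex (@enum_rank I)).
    by [].
  by exists enum_val => x _; rewrite ?enum_rankK ?enum_valK.
- move=> t j; have /matrixP/(_ t (enum_rank j)) := BP; rewrite !mxE => h.
  rewrite -[RHS]h (reindex (@enum_rank I)) /=.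
    by apply: eq_bigr => i _; rewrite mxE enum_rankK.
  by exists enum_val => x _; rewrite ?enum_rankK ?enum_valK.
- apply: le_trans tP _; rewrite /mxtrace (reindex (@enum_rank I))//=.
  by exists enum_val => x _; rewrite ?enum_rankK ?enum_valK.
Qed.

End Projection.

(** * Random signs *)

Section Signs.
Variables (R : realType).

Definition sgnf (I : finType) (e : {ffun I -> bool}) (i : I) : R := (-1) ^+ e i.

Lemma sum_sign_pair (I : finType) (i j : I) :
  \sum_(e : {ffun I -> bool}) sgnf e i * sgnf e j = (i == j)%:R * #|{ffun I -> bool}|%:R.
Proof.
have [<-|ij] := eqVneq i j.
  under eq_bigr do rewrite -expr2 sqrr_sign.
  by rewrite sumr_const mul1r.
rewrite mul0r.
pose F (k : I) (b : bool) : R := (if k == i then (-1) ^+ b else 1) * (if k == j then (-1) ^+ b else 1).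
transitivity (\sum_(e : {ffun I -> bool}) \prod_k F k (e k)).
  apply: eq_bigr => e _; rewrite /F big_split /=.
  by rewrite -!big_mkcond !big_pred1_eq.
rewrite -bigA_distr_bigA (bigD1 i)//= big_bool /F eqxx (negbTE ij) expr1 expr0.
by rewrite /= !mulr1 addNr mul0r.
Qed.

Lemma expR_le_quadratic (c : R) : `|c| <= 2^-1 -> expR c <= 1 + c + 2 * c ^+ 2.
Proof.
rewrite ler_norml => /andP[c1 c2].
have h := expR_ge1Dx (- c).
have e0 : 0 < 1 - c by lra.
have : expR c <= (1 - c)^-1.
  by rewrite -[expR c]invrK -expRN lef_pV2 ?posrE ?expR_gt0.
move=> /le_trans; apply; rewrite -[leLHS]mul1r ler_pdivrMr//.
rewrite -subr_ge0 (_ : _ - 1 = c ^+ 2 * (1 - 2 * c)); last by ring.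
by rewrite mulr_ge0 ?sqr_ge0//; lra.
Qed.

Lemma powR_le_expR (r : R) : 0 < r ->
  exists2 C, 0 < C & forall x : R, `|x| `^ r <= C * (expR x + expR (- x)).
Proof.
move=> r0; pose n := Num.truncn r.
exists (1 + (n.+1)`!%:R); first by rewrite ltr_pwDl.
move=> x.
have h : expR `|x| <= expR x + expR (- x).
  have [x0|x0] := ger0P x; first by rewrite lerDl expR_ge0.
  by rewrite lerDr expR_ge0.
apply: (@le_trans _ _ ((1 + (n.+1)`!%:R) * expR `|x|)); last by rewrite ler_wpM2l.
rewrite mulrDl mul1r.
have [x1|x1] := leP `|x| 1.
  apply: (@le_trans _ _ 1).
    apply: (@le_trans _ _ (1 `^ r)); last by rewrite powR1.
    by apply: ge0_ler_powR; rewrite ?nnegrE ?(ltW r0).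
  apply: (@le_trans _ _ (expR `|x|)); last by rewrite lerDl mulr_ge0// expR_ge0.
  by rewrite -expR0 ler_expR.
apply: (@le_trans _ _ (`|x| `^ n.+1%:R)).
  by apply: ler_powR; [exact: ltW|exact/ltW/truncnS_gt].
rewrite powR_mulrn//.
have := expR_ge1Dxn n (normr_ge0 x) => h2.
apply: (@le_trans _ _ ((n.+1)`!%:R * expR `|x|)); last by rewrite lerDr expR_ge0.
rewrite -ler_pdivrMl ?ltr0n ?fact_gt0//.
by apply: le_trans h2; rewrite mulrC lerDr.
Qed.

(** Powers are dominated by exponentials, and the exponential moment of a sum of independent signs
    factors over [I]; a bounded moment after normalisation suffices by homogeneity. *)
Lemma khinchine_upper (r : R) : 0 < r -> exists2 C, 0 < C &
  forall (I : finType) (c : I -> R),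
    \sum_(e : {ffun I -> bool}) `|\sum_i c i * sgnf e i| `^ r
    <= C * #|{ffun I -> bool}|%:R * (\sum_i c i ^+ 2) `^ (r / 2).
Proof.
move=> r0; have [C C0 hC] := powR_le_expR r0.
exists (2 `^ r * (C * (2 * expR (2^-1)))).
  by rewrite !mulr_gt0 ?powR_gt0 ?expR_gt0.
move=> I c; set v := \sum_i c i ^+ 2.
have v0 : 0 <= v by apply: sumr_ge0 => i _; exact: sqr_ge0.
have [vz|vn] := eqVneq v 0.
  have cz i : c i = 0.
    apply/eqP; rewrite -sqrf_eq0; have /eqP := vz; rewrite psumr_eq0.
      by move=> /allP/(_ i); rewrite mem_index_enum; exact.
    by move=> k _; exact: sqr_ge0.
  rewrite big1; first by rewrite !mulr_ge0 ?powR_ge0 ?expR_ge0// ltW.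
  move=> e _; rewrite big1 ?normr0 ?powR0 ?gt_eqF//.
  by move=> i _; rewrite cz mul0r.
have vp : 0 < v by rewrite lt_neqAle eq_sym vn.
pose s := Num.sqrt v; have s0 : 0 < s by rewrite sqrtr_gt0.
have sv : s ^+ 2 = v by rewrite sqr_sqrtr.
(* The squares now sum to 1/4, so each coefficient is at most 1/2 in absolute value, the range of
   the quadratic bound for exp. *)
pose c' i := c i / (2 * s).
have c'v : \sum_i c' i ^+ 2 = 4^-1.
  rewrite /c'; under eq_bigr do rewrite expr_div_n.
  by rewrite -mulr_suml -/v exprMn sv; field; rewrite gt_eqF.
have c'1 i : `|c' i| <= 2^-1.
  rewrite -(@ler_pXn2r _ 2)// ?nnegrE// real_normK ?num_real//.
  rewrite (_ : 2^-1 ^+ 2 = 4^-1); last by field.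
  rewrite -c'v (bigD1 i)//= lerDl sumr_ge0// => k _; exact: sqr_ge0.
have E e : `|\sum_i c i * sgnf e i| `^ r = (2 * s) `^ r * `|\sum_i c' i * sgnf e i| `^ r.
  rewrite -powRM// ?mulr_ge0 ?(ltW s0)//; congr (_ `^ _).
  rewrite -[X in X * _](ger0_norm (_ : 0 <= 2 * s)) ?mulr_ge0 ?(ltW s0)//.
  rewrite -normrM mulr_sumr; congr (`|_|); apply: eq_bigr => i _.
  by rewrite /c'; field; rewrite gt_eqF.
under eq_bigr do rewrite E.
rewrite -mulr_sumr powRM ?(ltW s0)//.
have -> : s `^ r = v `^ (r / 2).
  by rewrite -sv -powR_mulrn ?(ltW s0)// -powRrM; congr (_ `^ _); field.
have expS (z : R) : z = 1 \/ z = -1 -> \sum_(e : {ffun I -> bool}) expR (z * \sum_i c' i * sgnf e i)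
    <= #|{ffun I -> bool}|%:R * expR 2^-1.
  move=> hz.
  have -> : \sum_(e : {ffun I -> bool}) expR (z * \sum_i c' i * sgnf e i)
      = \prod_i \sum_(b : bool) expR (z * (c' i * (-1) ^+ b)).
    rewrite bigA_distr_bigA; apply: eq_bigr => e _; rewrite mulr_sumr.
    by rewrite expR_sum.
  (* Averaging over the sign cancels the linear terms, and 1 + 2 c^2 <= exp(2 c^2). *)
  apply: (@le_trans _ _ (\prod_i (2 * expR (2 * c' i ^+ 2)))).
    apply: ler_prod => i _; rewrite big_bool /= expr1 expr0 addr_ge0 ?expR_ge0//=.
    have q (y : R) : `|y| = `|c' i| -> expR y <= 1 + y + 2 * c' i ^+ 2.
      move=> hy; have -> : c' i ^+ 2 = y ^+ 2.
        by rewrite -[LHS]real_normK ?num_real// -hy real_normK ?num_real.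
      by apply: expR_le_quadratic; rewrite hy.
    apply: (@le_trans _ _ ((1 + z * (c' i * -1) + 2 * c' i ^+ 2) + (1 + z * (c' i * 1) + 2 * c' i ^+ 2))).
      apply: lerD; apply: q; case: hz => ->.
      - by rewrite mul1r mulrN1 normrN.
      - by rewrite mulrN1 mulN1r opprK.
      - by rewrite mul1r mulr1.
      - by rewrite mulr1 mulN1r normrN.
    have := expR_ge1Dx (2 * c' i ^+ 2); lra.
  rewrite big_split /= prodr_const -expR_sum -mulr_sumr c'v.
  rewrite card_ffun card_bool natrX (_ : 2 * 4^-1 = 2^-1)//; by field.
rewrite -!mulrA ler_wpM2l ?powR_ge0// [v `^ _ * _]mulrC !mulrA ler_wpM2r ?powR_ge0//.
apply: (@le_trans _ _ (\sum_(e : {ffun I -> bool}) C *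
   (expR (1 * \sum_i c' i * sgnf e i) + expR (-1 * \sum_i c' i * sgnf e i)))).
  by apply: ler_sum => e _; rewrite mul1r mulN1r; exact: hC.
rewrite -mulr_sumr -!mulrA ler_wpM2l ?(ltW C0)// big_split /=.
have h1 := expS 1 (or_introl erefl); have h2 := expS (-1) (or_intror erefl).
apply: (le_trans (lerD h1 h2)).
by rewrite le_eqVlt; apply/orP; left; apply/eqP; ring.
Qed.

(* Pigeonhole on averages: an index for which [X] is large compared with
   [A^(1/q) B^(1/q')].  Adding the means [A0], [B0] keeps both factors positive. *)
Lemma average_selection (T : finType) (X A B : T -> R) (x0 A0 B0 q q' : R) :
  (0 < #|T|)%N -> 0 < q -> 0 < q' -> q^-1 + q'^-1 = 1 ->
  (forall e, 0 <= A e) -> (forall e, 0 <= B e) -> 0 < A0 -> 0 < B0 -> 0 < x0 ->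
  \sum_e A e <= #|T|%:R * A0 -> \sum_e B e <= #|T|%:R * B0 ->
  #|T|%:R * x0 <= \sum_e X e ->
  exists e, x0 * ((A e + A0) `^ q^-1 * (B e + B0) `^ q'^-1)
    <= X e * ((2 * A0) `^ q^-1 * (2 * B0) `^ q'^-1).
Proof.
move=> T0 q0 q'0 qq' A_ge0 B_ge0 A00 B00 x00 hA hB hX.
apply: contrapT => /forallNP H.
set W := (2 * A0) `^ q^-1 * (2 * B0) `^ q'^-1.
have W0 : 0 < W by rewrite mulr_gt0 ?powR_gt0 ?mulr_gt0.
have Tp : 0 < #|T|%:R :> R by rewrite ltr0n.
have lt e : X e * W < x0 * ((A e + A0) `^ q^-1 * (B e + B0) `^ q'^-1).
  by rewrite ltNge; apply/negP; exact: H.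
have Y e : (A e + A0) `^ q^-1 * (B e + B0) `^ q'^-1
    <= W * ((A e + A0) / (2 * A0 * q) + (B e + B0) / (2 * B0 * q')).
  have := @young_scaled R ((A e + A0) `^ q^-1) ((B e + B0) `^ q'^-1)
    ((2 * A0) `^ q^-1) ((2 * B0) `^ q'^-1) q q'.
  have pV (x s : R) : 0 <= x -> 0 < s -> (x `^ s^-1) `^ s = x.
    by move=> x_ge0 s0; rewrite -powRrM mulVf ?gt_eqF// powRr1.
  have hA0 : 0 <= A e + A0 by rewrite addr_ge0// ltW.
  have hB0 : 0 <= B e + B0 by rewrite addr_ge0// ltW.
  have hA2 : 0 < 2 * A0 by rewrite mulr_gt0.
  have hB2 : 0 < 2 * B0 by rewrite mulr_gt0.
  rewrite !pV ?(ltW hA2) ?(ltW hB2)//.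
  by apply; rewrite ?powR_ge0 ?powR_gt0.
have s1 : \sum_e (A e + A0) <= 2 * A0 * #|T|%:R.
  by rewrite big_split/= sumr_const -mulr_natr; lra.
have s2 : \sum_e (B e + B0) <= 2 * B0 * #|T|%:R.
  by rewrite big_split/= sumr_const -mulr_natr; lra.
have : #|T|%:R * x0 * W < #|T|%:R * x0 * W.
  apply: (@le_lt_trans _ _ (\sum_e X e * W)).
    by rewrite -mulr_suml ler_wpM2r// ltW.
  apply: (@lt_le_trans _ _ (\sum_e x0 * ((A e + A0) `^ q^-1 * (B e + B0) `^ q'^-1))).
    have /card_gt0P[e0 _] := T0.
    rewrite (bigD1 e0)//= [ltRHS](bigD1 e0)//=; apply: ltr_leD; first exact: lt.
    by apply: ler_sum => e _; exact/ltW/lt.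
  rewrite -mulr_sumr.
  have s3 : \sum_e W * ((A e + A0) / (2 * A0 * q) + (B e + B0) / (2 * B0 * q'))
      <= W * #|T|%:R.
    rewrite -mulr_sumr ler_wpM2l ?(ltW W0)// big_split/= -!mulr_suml.
    apply: (@le_trans _ _ (2 * A0 * #|T|%:R / (2 * A0 * q) + 2 * B0 * #|T|%:R / (2 * B0 * q'))).
      by apply: lerD; rewrite ler_wpM2r// invr_ge0 !mulr_ge0// ltW.
    rewrite [leLHS](_ : _ = #|T|%:R * (q^-1 + q'^-1)).
      by rewrite qq' mulr1.
    by field; rewrite !gt_eqF.
  apply: (le_trans (ler_wpM2l (ltW x00) (le_trans (ler_sum _ (fun e _ => Y e)) s3))).
  by rewrite le_eqVlt; apply/orP; left; apply/eqP; ring.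
by rewrite ltxx.
Qed.

End Signs.

(** * The Gram matrix compared with Haar functions *)

Section GramLowerBound.
Variables (R : realType) (d : nat).
Local Notation RR := (measurableTypeR R).
Local Notation leb := (@lebesgue_measure R).
Variables (x0 : 'I_d -> R) (rho : R) (w : 'I_d -> nat -> R -> R).
Hypotheses (rho0 : 0 < rho).
Hypotheses (jw : forall j, jet (w j)) (sw : forall j, supp01 (w j)).
Variables (E I : finType) (kp : E -> 'I_d -> nat) (lev : I -> E) (nu : I -> 'I_d -> int).
Variables (lam : 'I_d -> nat) (k : nat).
Hypothesis wf : wf_family kp lev nu k.

Local Notation sc i j := (scale rho kp (lev i) j).
Local Notation off i j := (offset x0 rho kp lev nu i j).
Local Notation gram := (gram x0 rho w kp lev nu lam).

Let sc0 i j : 0 < sc i j. Proof. exact: scale_gt0. Qed.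

(** Were [e] nowhere finer than [e'], the equal sums would force all exponents to agree. *)
Lemma wf_finer e e' : e != e' -> exists j, (kp e' j < kp e j)%N.
Proof.
move=> ee'; apply: contrapT => /forallNP H.
have [inj sm _] := wf.
have le j : (kp e j <= kp e' j)%N by rewrite leqNgt; apply/negP; exact: H.
case/eqP: ee'; apply: inj => j.
have := sm e; rewrite -(sm e') => /eqP.
rewrite (bigD1 j)//= [X in _ == X](bigD1 j)//= => /eqP h.
have h2 : (\sum_(i < d | i != j) kp e i <= \sum_(i < d | i != j) kp e' i)%N.
  by apply: leq_sum.
have h3 := le j; apply/eqP; rewrite eqn_leq h3 /= leqNgt; apply/negP => h4.
by move: h; apply/eqP; rewrite neq_ltn -addSn leq_add.
Qed.

Lemma affine_var i j y : sc i j * y - off i j = 2 ^+ kp (lev i) j * ((y - x0 j) / rho) - (nu i j)%:~R.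
Proof. by rewrite /offset /scale; field; rewrite gt_eqF. Qed.

(** On one level the cells are disjoint in some coordinate. On different levels there is a direction
    where [i] is strictly finer; there the Haar function of [i'] is constant on the cell of [i],
    where g has mean zero. *)
Lemma haar_orthogonal (g : 'I_d -> R -> R) i i' : i != i' ->
  (forall j y, ~~ (0 <= y < 1) -> g j y = 0) ->
  (forall j, leb.-integrable setT (EFin \o (fun y => g j (sc i j * y - off i j)))) ->
  (forall j, \int[leb]_y g j (sc i j * y - off i j) = 0) ->
  \prod_(j < d) \int[leb]_y (g j (sc i j * y - off i j) * haar (sc i' j * y - off i' j)) = 0.
Proof.
move=> ii' g0 ig sg.
suff [j hj] : exists j, \int[leb]_y (g j (sc i j * y - off i j) * haar (sc i' j * y - off i' j)) = 0.
  by rewrite (bigD1 j)//= hj mul0r.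
have [ee|/wf_finer[j hj]] := eqVneq (lev i) (lev i').
  have [_ _ inj] := wf.
  have [j nj] : exists j, nu i j != nu i' j.
    apply: contrapT => /forallNP H; case/eqP: ii'; apply: inj => // j.
    by apply/eqP; rewrite -[_ == _]negbK; apply/negP; exact: H.
  exists j; rewrite /Rintegral integral0_eq// => y _.
  rewrite !affine_var -ee; set t := 2 ^+ _ * _.
  have [h1|h1] := boolP (0 <= t - (nu i j)%:~R < 1); last by rewrite g0// mul0r.
  have [h2|h2] := boolP (0 <= t - (nu i' j)%:~R < 1); last first.
    have -> : haar (t - (nu i' j)%:~R) = 0; last by rewrite mulr0.
    by apply/eqP; rewrite -normr_eq0 normr_haar /cell (negbTE h2).
  case/eqP: nj; move: h1 h2 => /andP[h1 h2] /andP[h3 h4].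
  have e1 : (nu i j)%:~R < (nu i' j)%:~R + 1 :> R by lra.
  have e2 : (nu i' j)%:~R < (nu i j)%:~R + 1 :> R by lra.
  move: e1 e2; rewrite -[1]/(1%:~R) -!rmorphD/= !ltr_int !ltzD1 => e1 e2.
  by apply/eqP; rewrite eq_le e1 e2.
exists j.
(* Half the ratio of the two scales; the ratio is even because the exponents differ by at least
   1. *)
pose N := (2 ^ (kp (lev i) j - kp (lev i') j).-1)%N.
have N2 : N.*2%:R = 2 ^+ (kp (lev i) j) / 2 ^+ (kp (lev i') j) :> R.
  rewrite /N -mul2n -expnS prednK ?subn_gt0// natrX -expfB//.
pose c := haar ((nu i j)%:~R / N.*2%:R - (nu i' j)%:~R) : R.
under eq_Rintegral => y _.
  rewrite (_ : _ * _ = c * g j (sc i j * y - off i j)); last first.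
    rewrite !affine_var; set t := (y - x0 j) / rho.
    have -> : 2 ^+ kp (lev i') j * t = (2 ^+ kp (lev i) j * t) / N.*2%:R.
      by rewrite N2; field; rewrite !expf_neq0.
    by rewrite haar_coarse//; [exact: g0|rewrite expn_gt0].
  over.
by rewrite RintegralZl// sg mulr0.
Qed.

Lemma haar_gram i i' :
  \prod_(j < d) \int[leb]_y (haar (sc i j * y - off i j) * haar (sc i' j * y - off i' j))
  = (i == i')%:R * (rho ^+ d * 2^-1 ^+ k).
Proof.
have [<-|ii'] := eqVneq i i'.
  rewrite mul1r -(prod_scaleV rho wf (lev i)); apply: eq_bigr => j _.
  under eq_Rintegral do rewrite -expr2 haar_sq.
  by rewrite /Rintegral integral_cell.
rewrite mul0r (@haar_orthogonal (fun=> @haar R))// => j.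
- move=> y h; apply/eqP; rewrite -normr_eq0 normr_haar /cell (negbTE h)//.
- exact: integrable_haar.
- exact: Rintegral_haar.
Qed.

(** The inner product of a probe atom with the Haar function of its own cell, divided by the volume
    of the cell. *)
Definition wmass := \prod_(j < d) (2 * w j (lam j) 2^-1).

Lemma wavelet_haar_gram i i' :
  \prod_(j < d) \int[leb]_y (w j (lam j).+1 (sc i j * y - off i j) * haar (sc i' j * y - off i' j))
  = (i == i')%:R * (wmass * (rho ^+ d * 2^-1 ^+ k)).
Proof.
have [<-|ii'] := eqVneq i i'.
  rewrite mul1r -(prod_scaleV rho wf (lev i)) /wmass -big_split; apply: eq_bigr => j _ /=.
  by rewrite (integral_wavelet_haar _ (jw j) (sw j)).
rewrite mul0r (@haar_orthogonal (fun j => w j (lam j).+1))// => j.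
- by move=> y h; rewrite sw//; apply: contraNN h => /andP[/ltW -> ->].
- apply: (@csupp_integrable _ _ (sc i j) (off i j)) => //.
    exact: continuous_affine_jet.
  by move=> y h; rewrite sw.
- exact: (integral_wavelet _ (jw j) (sw j)).
Qed.

(* Integrate [(sum_i b_i (phi_i - wmass h_i))^2 >= 0], where the Haar functions [h_i]
   are orthogonal to each other and to [phi_i'] for [i' <> i]. *)
Lemma gram_ge (b : I -> R) :
  wmass ^+ 2 * (rho ^+ d * 2^-1 ^+ k) * (\sum_i b i ^+ 2)
  <= \sum_i \sum_i' b i * b i' * gram i i'.
Proof.
set gm := rho ^+ d * 2^-1 ^+ k.
(* The boolean selects the wavelet or the Haar function, so that the square becomes one double sum
   over I x bool. *)
pose f (z : I * bool) (j : 'I_d) (y : R) : R :=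
  if z.2 then w j (lam j).+1 (sc z.1 j * y - off z.1 j) else haar (sc z.1 j * y - off z.1 j).
pose c (z : I * bool) : R := if z.2 then b z.1 else - wmass * b z.1.
have [M [M0 hM]] : exists M : 'I_d -> R, (forall j, 0 <= M j) /\ forall j y, `|w j (lam j).+1 y| <= M j.
  pose M j := projT1 (cid2 (jet_bounded (lam j).+1 (jw j) (sw j))).
  by exists M; split => j; rewrite /M; case: cid2.
have mf z j : measurable_fun (setT : set RR) (f z j).
  rewrite /f; case: z.2; last exact: measurable_haar.
  by apply: continuous_measurable_fun; exact: continuous_affine_jet.
have bf z j y : `|f z j y| <= (M j + 1) * cell (sc z.1 j * y - off z.1 j).
  rewrite /f; case: z.2; last first.
    by rewrite normr_haar ler_peMl ?cell_ge0// lerDr.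
  set u := sc z.1 j * y - _; have [u01|u01] := boolP (0 < u < 1); last first.
    by rewrite sw// normr0 mulr_ge0 ?cell_ge0// addr_ge0.
  rewrite /cell; case/andP: u01 => /ltW -> ->; rewrite mulr1.
  by apply: (le_trans (hM _ _)); rewrite lerDl.
have iff' z z' j : leb.-integrable setT (EFin \o (fun y => f z j y * f z' j y)).
  have bg y : `|f z j y * f z' j y| <= (M j + 1) * (M j + 1) * cell (sc z.1 j * y - off z.1 j).
    rewrite normrM mulrAC; apply: ler_pM => //.
    by apply: (le_trans (bf z' j y)); rewrite ler_piMr ?cell_le1// addr_ge0.
  apply: (integrable_cell_bound (sc0 z.1 j) _ bg).
  by apply: measurable_funM; exact: mf.
pose g (zz : (I * bool) * (I * bool)) j y := f zz.1 j y * f zz.2 j y.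
have [_ H] := integral_sum_tens (fun zz : (I * bool) * (I * bool) => c zz.1 * c zz.2)
  (fun zz j => iff' zz.1 zz.2 j : leb.-integrable setT (EFin \o g zz j)).
have H0 : (0 <= \int[lebm R d]_x
   (\sum_zz (c zz.1 * c zz.2) * tens (g zz) x)%:E)%E.
  apply: integral_ge0 => x _; rewrite lee_fin.
  rewrite (_ : \sum_zz _ = (\sum_z c z * tens (f z) x) ^+ 2) ?sqr_ge0//.
  rewrite expr2 mulr_suml; under [RHS]eq_bigr do rewrite mulr_sumr.
  rewrite pair_bigA; apply: eq_bigr => -[z z'] _ /=.
  by rewrite -tensM; ring.
move: H0; rewrite H lee_fin.
rewrite -(pair_bigA _ (fun z z' => c z * c z' * \prod_(j < d) \int[leb]_y (f z j y * f z' j y))) /=.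
rewrite -(pair_bigA _ (fun i bb => \sum_z' c (i, bb) * c z' * \prod_(j < d) \int[leb]_y (f (i, bb) j y * f z' j y))) /=.
under eq_bigr => i _.
  under eq_bigr => bb _.
    rewrite -(pair_bigA _ (fun i' bb' => c (i, bb) * c (i', bb') * \prod_(j < d) \int[leb]_y (f (i, bb) j y * f (i', bb') j y))) /=.
    under eq_bigr => i' _ do rewrite big_bool /=.
    over.
  rewrite big_bool /= /c /f /=.
  over.
have hw i' i : \prod_(j < d) \int[leb]_y (haar (sc i j * y - off i j) * w j (lam j).+1 (sc i' j * y - off i' j))
   = (i == i')%:R * (wmass * gm).
  rewrite eq_sym -wavelet_haar_gram; apply: eq_bigr => j _.
  by apply: eq_Rintegral => y _; rewrite mulrC.
under eq_bigr => i _.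
  under eq_bigr do rewrite wavelet_haar_gram -/(gram _ _).
  under [X in _ + X]eq_bigr do rewrite hw haar_gram.
  rewrite -big_split /=.
  (* Each of the two mixed terms contributes - wmass^2 gm b_i^2, and the Haar square gives this
     amount back once. *)
  rewrite (_ : \sum_i' _ = \sum_i' b i * b i' * gram i i' - wmass ^+ 2 * gm * b i ^+ 2); last first.
    rewrite -/gm [RHS](_ : _ = \sum_i' (b i * b i' * gram i i'
      - wmass ^+ 2 * gm * b i * ((i == i')%:R * b i'))).
      by apply: eq_bigr => i' _; ring.
    rewrite sumrB -mulr_sumr; congr (_ - _); rewrite (bigD1 i)//= eqxx mul1r.
    rewrite big1 ?addr0; first by ring.
    by move=> i' /negbTE ii'; rewrite eq_sym ii' mul0r.
  over.
by rewrite sumrB subr_ge0 -mulr_sumr.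
Qed.

End GramLowerBound.

(** * Choice of coefficients *)

Section KballScaled.
Variables (R : realType) (d : nat).
Local Notation RR := (measurableTypeR R).

Lemma sum_powR_concave (I : finType) (x : I -> R) s : 0 < s -> s <= 1 ->
  (forall i, 0 <= x i) ->
  \sum_i x i `^ s <= #|I|%:R `^ (1 - s) * (\sum_i x i) `^ s.
Proof.
move=> s0 s1 x_ge0.
have S0 : 0 <= \sum_i x i by exact: sumr_ge0.
have Y0 : 0 <= \sum_i x i `^ s by apply: sumr_ge0 => i _; exact: powR_ge0.
have V1 : 1 <= s^-1 by rewrite invf_ge1.
have := @jensen_powR R I s^-1 (fun=> 1) (fun i => x i `^ s) V1 (fun=> ler01)
  (fun i => powR_ge0 _ _).
under eq_bigr do rewrite mul1r.
under [X in _ <= _ * X -> _]eq_bigr do rewrite mul1r -powRrM mulfV ?gt_eqF// powRr1//.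
rewrite sumr_const => h.
have h2 := ge0_ler_powR (ltW s0) _ _ h.
rewrite -powRrM mulVf ?gt_eqF// powRr1// in h2.
apply: (le_trans (h2 _ _)); rewrite ?nnegrE ?powR_ge0 ?mulr_ge0 ?powR_ge0//.
by rewrite powRM ?powR_ge0// -powRrM mulrBl mulVf ?gt_eqF// mul1r.
Qed.

Variables (x0 : 'I_d -> R) (rho : R) (w : 'I_d -> nat -> R -> R).
Hypotheses (rho0 : 0 < rho) (rho1 : rho <= 1).
Hypotheses (jw : forall j, jet (w j)) (sw : forall j, supp01 (w j)).

Lemma energy_scale p (E I : finType) (lev : I -> E) k (a : I -> R) t e : 0 < t ->
  energy p lev k (fun i => t * a i) e = t `^ p * energy p lev k a e.
Proof.
move=> t0; rewrite /energy mulr_sumr; apply: eq_bigr => i _.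
by rewrite normrM gtr0_norm// powRM ?(ltW t0)// mulrCA.
Qed.

Lemma cont_atomic_sum (E I : finType) (kp : E -> 'I_d -> nat) (lev : I -> E) nu alpha a x :
  cont_at (atomic_sum x0 rho w kp lev nu alpha a) x.
Proof. by rewrite atomic_sum_jsum; apply: jsum_cont => i j; exact: jet_jetf. Qed.

Lemma measurable_jsum (I : finType) (c : I -> R) (v : I -> 'I_d -> nat -> R -> R) n :
  (forall i j, jet (v i j)) -> measurable_fun [set: d.-tuple RR] (jsum c v n).
Proof.
move=> jv; apply: measurable_sum => i; apply: measurable_funM => //.
by apply: measurable_tens => j; exact: jet_measurable.
Qed.

Lemma measurable_atomic_sum (E I : finType) (kp : E -> 'I_d -> nat) (lev : I -> E) nu alpha a :
  measurable_fun [set: d.-tuple RR] (atomic_sum x0 rho w kp lev nu alpha a).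
Proof. by rewrite atomic_sum_jsum; apply: measurable_jsum => i j; exact: jet_jetf. Qed.

Lemma measurable_probe (E I : finType) (kp : E -> 'I_d -> nat) (lev : I -> E) nu lam b :
  measurable_fun [set: d.-tuple RR] (probe x0 rho w kp lev nu lam b).
Proof. by rewrite probe_jsum; apply: measurable_jsum => i j; exact: jet_jett. Qed.

(** Two costs are kept apart: [m] bounds the energy of every level, and [V] absorbs the loss from
    summing over levels in l_theta. The admissible multiplier [t] is of order 1 / (m V). *)
Lemma kball_scaled (alpha : 'I_d -> R) (p : R) (theta : \bar R) : 1 <= p ->
  (1 <= theta)%E -> (forall j, 0 < alpha j) ->
  exists2 c1, 0 < c1 &
  forall (D : set (pt R d)) (E I : finType) (kp : E -> 'I_d -> nat) (lev : I -> E) nu k a m V t,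
    wf_family kp lev nu k -> 0 < m -> 1 <= V -> 0 < t ->
    (forall e, energy p lev k a e <= m `^ p) ->
    (forall r, theta = r%:E ->
       \sum_e energy p lev k a e `^ Num.min 1 (r / p)
       <= m `^ (p * Num.min 1 (r / p)) * V `^ r) ->
    t * m * V <= c1 ->
    Kball D p theta alpha (atomic_sum x0 rho w kp lev nu alpha (fun i => t * a i)).
Proof.
move=> p1 th1 al0.
have p0 : 0 < p by exact: lt_le_trans p1.
have [del del0 [da dl]] : exists2 del, 0 < del & (forall j, del <= alpha j) /\
    (forall j, del <= (l_of alpha j)%:R - alpha j).
  exists (\big[Num.min/1]_(j < d) Num.min (alpha j) ((l_of alpha j)%:R - alpha j)).
    elim/big_ind : _ => // [x y x1 y1|j _]; first by rewrite lt_min x1.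
    by rewrite lt_min al0 subr_gt0 /l_of truncnS_gt.
  split => j; (apply: (@le_trans _ _ (Num.min (alpha j) ((l_of alpha j)%:R - alpha j)));
    [exact: bigmin_le_cond|by rewrite ge_min lexx ?orbT]).
have [C C0 hC] := besov_bound x0 rho0 rho1 jw sw del0 p1 th1 da dl.
(* With [C'] at least 1, quantities below 1 / C' are at most 1, and raising them to a power p or r
   >= 1 does not enlarge them. *)
pose C' := Num.max C 1; have C'1 : 1 <= C' by rewrite le_max lexx orbT.
have CC' : C <= C' by rewrite le_max lexx.
have C'0 : 0 < C' by exact: lt_le_trans C'1.
exists C'^-1; first by rewrite invr_gt0.
move=> D E I kp lev nu k a m V t wf m0 V1 t0 hE hS tmV.
have tm0 : 0 < t * m by exact: mulr_gt0.
have c1' : C'^-1 <= 1 by rewrite invf_le1.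
have bnd (s r : R) : 0 <= s -> s <= C'^-1 -> 1 <= r -> C * s `^ r <= 1.
  move=> s0 sC r1; apply: (@le_trans _ _ (C' * C'^-1)); last by rewrite mulfV ?gt_eqF.
  apply: ler_pM => //; rewrite ?(ltW C0) ?powR_ge0//.
  apply: (le_trans _ sC); have [->|sn] := eqVneq s 0.
    by rewrite powR0// gt_eqF// (lt_le_trans _ r1).
  have sp : 0 < s by rewrite lt_neqAle eq_sym sn.
  by apply: ge1r_powR => //; rewrite sp (le_trans sC).
have tm1 : t * m <= C'^-1 by apply: le_trans tmV; rewrite ler_peMr ?(ltW tm0).
have {hC} := hC D E I kp lev nu k (fun i => t * a i) ((t * m) `^ p) wf (powR_gt0 _ tm0)
  _ (bnd _ _ (ltW tm0) tm1 p1) _.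
case.
- by move=> e; rewrite energy_scale// powRM ?(ltW t0) ?(ltW m0)// ler_wpM2l ?powR_ge0.
- move=> r thr; have r1 : 1 <= r by rewrite -lee_fin -thr.
  set sg := Num.min 1 (r / p).
  under eq_bigr do rewrite energy_scale// powRM ?powR_ge0 ?energy_ge0// -powRrM.
  rewrite -mulr_sumr.
  apply: (@le_trans _ _ (C * (t * m * V) `^ r)); last first.
    by apply: bnd => //; rewrite mulr_ge0 ?(ltW tm0) ?(le_trans ler01).
  rewrite -mulrA ler_wpM2l ?(ltW C0)//.
  apply: (@le_trans _ _ ((t * m) `^ p `^ (r / p - sg) *
     (t `^ (p * sg) * (m `^ (p * sg) * V `^ r)))).
    by rewrite !ler_wpM2l ?powR_ge0// hS.
  have eq1 : (t * m) `^ r = (t * m) `^ (p * (r / p - sg)) * (t `^ (p * sg) * m `^ (p * sg)).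
    rewrite -powRM ?(ltW t0) ?(ltW m0)// -powRD; last by rewrite (gt_eqF tm0) implybT.
    by congr (_ `^ _); field; rewrite gt_eqF.
  rewrite [leRHS]powRM ?(ltW tm0) ?(le_trans ler01)// eq1 -powRrM.
  by rewrite le_eqVlt; apply/orP; left; apply/eqP; ring.
move=> L S; split => //; first by apply: cont_at_cont_on; exact: cont_atomic_sum.
apply: measurable_funS (@measurableT _ _) (@subsetT _ _) _.
exact: measurable_atomic_sum.
Qed.

End KballScaled.

(** * Supports and overlap of cells *)

Section Support.
Variables (R : realType) (d : nat).
Local Notation RR := (measurableTypeR R).
Variables (x0 : 'I_d -> R) (rho : R) (w : 'I_d -> nat -> R -> R).
Hypotheses (rho0 : 0 < rho) (rho1 : rho <= 1).
Hypotheses (jw : forall j, jet (w j)) (sw : forall j, supp01 (w j)).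

Definition cube : set (pt R d) := [set x | forall j, x0 j < coord x j < x0 j + rho].

Section Family.
Variables (E I : finType) (kp : E -> 'I_d -> nat) (lev : I -> E) (nu : I -> 'I_d -> int).

Local Notation sc i j := (scale rho kp (lev i) j).
Local Notation off i j := (offset x0 rho kp lev nu i j).

Definition in_range := forall i j, 0 <= nu i j < (2 ^ kp (lev i) j)%:Z.

Let affE i j y : sc i j * y - off i j = 2 ^+ kp (lev i) j * ((y - x0 j) / rho) - (nu i j)%:~R.
Proof. by rewrite /offset /scale; field; rewrite gt_eqF. Qed.

Lemma atom_support n i x : in_range -> ~ cube x -> atom x0 rho w kp lev nu n i x = 0.
Proof.
move=> nur ncx; apply/eqP/negP => /negP ax; apply: ncx => j.
have : w j (n j).+1 (sc i j * coord x j - off i j) != 0.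
  by move: ax; rewrite /atom /tens (bigD1 j)//= mulf_eq0 negb_or => /andP[].
move=> wn0; have : 0 < sc i j * coord x j - off i j < 1.
  by apply: contraNT wn0 => h; rewrite sw.
rewrite affE; set s := 2 ^+ _; set t := (_ - _) / rho => /andP[h1 h2].
have s0 : 0 < s by exact: exprn_gt0.
have /andP[n0 n1] := nur i j.
have n0' : 0 <= (nu i j)%:~R :> R by rewrite ler0z.
have n1' : (nu i j)%:~R + 1 <= s.
  by rewrite /s -natrX -[_%:R]/((2 ^ kp (lev i) j)%:Z%:~R) -[1]/(1%:~R) -rmorphD/= ler_int lezD1.
have t0 : 0 < t by rewrite -(pmulr_rgt0 _ s0); lra.
have t1 : t < 1 by rewrite -(ltr_pM2l s0); lra.
have -> : coord x j = x0 j + t * rho by rewrite /t; field; rewrite gt_eqF.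
rewrite ltrDl mulr_gt0//= ltrD2l -[ltRHS]mul1r ltr_pM2r//.
Qed.

Lemma atomic_sum_support alpha a x : in_range -> ~ cube x ->
  atomic_sum x0 rho w kp lev nu alpha a x = 0.
Proof. by move=> h1 h2; apply: big1 => i _; rewrite atom_support ?mulr0. Qed.

Lemma probe_support lam b x : in_range -> ~ cube x -> probe x0 rho w kp lev nu lam b x = 0.
Proof. by move=> h1 h2; apply: big1 => i _; rewrite atom_support ?mulr0. Qed.

Lemma probe_test_fun (D : set (pt R d)) e lam b : in_range -> 0 < e ->
  (forall x, cube x -> boxnbhd x e `<=` D) ->
  test_fun D (probe x0 rho w kp lev nu lam b).
Proof.
move=> nur e0 cD; split; first by rewrite probe_jsum; apply: jsum_smooth => i j; exact: jet_jett.
exists (\sum_j `|x0 j| + 1), e; split => // x px.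
have cx : cube x by apply: contrapT => /(probe_support lam b nur).
split; last exact: cD.
move=> i; have /andP[h1 h2] := cx i.
have : `|x0 i| <= \sum_j `|x0 j| by rewrite (bigD1 i)//= lerDl sumr_ge0.
have : `|coord x i| <= `|x0 i| + 1.
  have -> : coord x i = x0 i + (coord x i - x0 i) by ring.
  apply: (le_trans (ler_normD _ _)); rewrite lerD2l ger0_norm ?subr_ge0 ?(ltW h1)// lerBlDl.
  by apply: (le_trans (ltW h2)); rewrite lerD2l.
move=> h3 h4; apply: (le_trans h3); rewrite lerD2r//.
Qed.

Definition active i (x : pt R d) : R :=
  tens (fun j y => cell (sc i j * y - off i j)) x.

Lemma active_bool i x : active i x = 0 \/ active i x = 1.
Proof.
rewrite /active /tens; elim/big_rec : _ => [|j z _]; first by right.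
rewrite /cell; case: (_ && _); rewrite ?mul1r ?mul0r//.
by left.
Qed.

Lemma active_ge0 i x : 0 <= active i x.
Proof. by have [->|->] := active_bool i x. Qed.

Lemma measurable_active i : measurable_fun [set: d.-tuple RR] (active i).
Proof. by apply: measurable_tens => j; apply: measurable_cell; exact: scale_gt0. Qed.

Lemma sum_active_level k e x : wf_family kp lev nu k ->
  \sum_(i | lev i == e) active i x <= 1.
Proof.
move=> [_ _ inj].
rewrite (_ : \sum_(i | _) _ = \sum_(i | lev i == e)
   \prod_(j < d) cell (2 ^+ kp e j * ((coord x j - x0 j) / rho) - (nu i j)%:~R)); last first.
  by apply: eq_bigr => i /eqP <-; apply: eq_bigr => j _; rewrite affE.
apply: (@sum_prod_cell_le1 R I (fun i => lev i == e) d nu) => i i' /eqP h1 /eqP h2.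
by apply: inj; rewrite h1 h2.
Qed.

Lemma sum_active k x : wf_family kp lev nu k -> \sum_i active i x <= #|E|%:R.
Proof.
move=> wf; rewrite (partition_big lev xpredT)//=.
apply: (@le_trans _ _ (\sum_(e : E) 1)).
  by apply: ler_sum => e _; exact: (sum_active_level e x wf).
by rewrite sumr_const.
Qed.

Lemma integral_active k i : wf_family kp lev nu k ->
  (\int[lebm R d]_x (active i x)%:E = (rho ^+ d * 2^-1 ^+ k)%:E)%E.
Proof.
move=> wf; rewrite /active ge0_integral_tens.
- under eq_bigr do rewrite integral_cell ?scale_gt0//.
  by rewrite prodEFin (prod_scaleV rho wf).
- by move=> j; apply: measurable_cell; exact: scale_gt0.
- by move=> j x; exact: cell_ge0.
Qed.

(* The number of active cells is a natural number, so small powers of it do not exceed it. *)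
Lemma powR_sum_active k x s : wf_family kp lev nu k -> 0 < s ->
  (\sum_i active i x) `^ s <= #|E|%:R `^ Num.max (s - 1) 0 * \sum_i active i x.
Proof.
move=> wf s0; set S := \sum_i _.
have [Sz|S1] : S = 0 \/ 1 <= S.
  have [[i ai]|] := pselect (exists i, active i x = 1).
    by right; rewrite /S (bigD1 i)//= ai lerDl sumr_ge0// => j _; exact: active_ge0.
  move=> /forallNP H; left; apply: big1 => i _.
  by have [|/H] := active_bool i x.
  by rewrite Sz powR0 ?gt_eqF// mulr0.
have S0 : 0 < S by exact: lt_le_trans S1.
have SE : S <= #|E|%:R by exact: sum_active wf.
have -> : S `^ s = S `^ (s - 1) * S.
  by rewrite -[X in _ * X]powRr1 ?(ltW S0)// -powRD ?subrK// (gt_eqF S0) implybT.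
rewrite ler_wpM2r ?(ltW S0)//.
apply: (@le_trans _ _ (S `^ Num.max (s - 1) 0)).
  by apply: ler_powR => //; rewrite le_max lexx.
by apply: ge0_ler_powR; rewrite ?nnegrE ?le_max ?lexx ?orbT ?(ltW S0).
Qed.

End Family.

Lemma atom_bound (lam : 'I_d -> nat) : exists2 M, 0 < M &
  forall (E I : finType) (kp : E -> 'I_d -> nat) (lev : I -> E) nu i x,
   `|atom x0 rho w kp lev nu lam i x| <= M * active kp lev nu i x.
Proof.
pose M j := projT1 (cid2 (jet_bounded (lam j).+1 (jw j) (sw j))) + 1.
have hM j : 0 < M j /\ forall y, `|w j (lam j).+1 y| <= M j.
  rewrite /M; case: cid2 => /= N N0 hN; split; first by rewrite ltr_wpDl.
  by move=> y; apply: (le_trans (hN y)); rewrite lerDl.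
exists (\prod_(j < d) M j); first by apply: prodr_gt0 => j _; have [] := hM j.
move=> E I kp lev nu i x; rewrite /atom normr_tens /active /tens -big_split /=.
apply: ler_prod => j _; rewrite normr_ge0/=.
set u := _ * _ - _; have [M0 hMj] := hM j.
have [u01|u01] := boolP (0 < u < 1); last by rewrite sw// normr0 mulr_ge0 ?cell_ge0 ?ltW.
by rewrite /cell; case/andP: u01 => /ltW -> ->; rewrite mulr1.
Qed.

End Support.

Lemma cube_in_domain (R : realType) d (D : set (pt R d)) : is_open D -> D !=set0 ->
  exists (x0 : 'I_d -> R) (rho e : R), [/\ 0 < rho, rho <= 1, 0 < e &
    forall x, cube x0 rho x -> boxnbhd x e `<=` D].
Proof.
move=> oD [z /oD [e e0 zD]].
exists (coord z), (Num.min 1 (e / 2)), (e / 2); split.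
- by rewrite lt_min ltr01 divr_gt0.
- by rewrite ge_min lexx.
- by rewrite divr_gt0.
move=> x cx y xy; apply: zD => j.
have /andP[h1 h2] := cx j; have h3 := xy j.
have h4 : Num.min 1 (e / 2) <= e / 2 by rewrite ge_min lexx orbT.
move: h3; rewrite !ltr_distl => /andP[h5 h6]; apply/andP; split; lra.
Qed.

(** * Reduction to a choice of coefficients *)

Section Reduction.
Variables (R : realType) (d : nat).
Variables (x0 : 'I_d -> R) (rho : R) (w : 'I_d -> nat -> R -> R).
Hypotheses (rho0 : 0 < rho) (rho1 : rho <= 1).
Hypotheses (jw : forall j, jet (w j)) (sw : forall j, supp01 (w j)).
Variables (D : set (pt R d)) (marg : R).
Hypotheses (oD : is_open D) (marg0 : 0 < marg).
Hypothesis cubeD : forall x, cube x0 rho x -> boxnbhd x marg `<=` D.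
Variables (alpha : 'I_d -> R) (p : R) (theta : \bar R) (q q' : R) (lam : 'I_d -> nat).
Hypotheses (p1 : 1 <= p) (th1 : (1 <= theta)%E) (al0 : forall j, 0 < alpha j).
Hypotheses (q0 : 0 < q) (q'0 : 0 < q') (qq' : q^-1 + q'^-1 = 1).

Lemma sub_cube_domain : cube x0 rho `<=` D.
Proof. by move=> x cx; apply: (cubeD cx) => j; rewrite subrr normr0. Qed.

Lemma pairing_atomic (E I : finType) (kp : E -> 'I_d -> nat) (lev : I -> E) nu W (a b : I -> R) s :
  in_range kp lev nu ->
  (forall i, weight kp alpha (lev i) * (\prod_(j < d) scale rho kp (lev i) j ^+ lam j) = W) ->
  (\int[lebm R d]_(x in D) (atomic_sum x0 rho w kp lev nu alpha (fun i => (s * a i)%R) x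
       * iter_pder (dseq lam) (probe x0 rho w kp lev nu lam b) x)%:E
   = ((-1) ^+ (\sum_(j < d) lam j) *
      (s * (W * \sum_i \sum_i' a i * b i' * gram x0 rho w kp lev nu lam i i')))%:E)%E.
Proof.
move=> nur hW; rewrite integral_mkcond.
transitivity ((\int[lebm R d]_x (atomic_sum x0 rho w kp lev nu alpha (fun i => (s * a i)%R) x
       * iter_pder (dseq lam) (probe x0 rho w kp lev nu lam b) x)%:E)%E).
  apply: eq_integral => x _; rewrite patchE; case: ifPn => // xD.
  have nc : ~ cube x0 rho x by move=> /sub_cube_domain; move: xD; rewrite notin_setE.
  by rewrite atomic_sum_support ?mul0r.
rewrite pairing_jsum//; congr ((_ * _)%:E); rewrite !mulr_sumr.
apply: eq_bigr => i _; rewrite !mulr_sumr; apply: eq_bigr => i' _.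
by rewrite -(hW i); ring.
Qed.

(** Only coefficients [a] for the function and [b] for the probe remain to be chosen. Since weight
    times scale^lam is the same [W] on every cell, it leaves the pairing as a factor in front of the
    Gram form. *)
Lemma family_width_ge : exists2 c1, 0 < c1 & forall n dl, 0 < dl ->
  (forall y : 'I_n -> pt R d, exists (E I : finType) (kp : E -> 'I_d -> nat)
     (lev : I -> E) nu k (a b : I -> R) (m V Z W : R),
    [/\ wf_family kp lev nu k, in_range kp lev nu, 0 < m, 1 <= V & 0 < Z] /\
    [/\ forall e, energy p lev k a e <= m `^ p,
        forall r, theta = r%:E -> \sum_e energy p lev k a e `^ Num.min 1 (r / p)
          <= m `^ (p * Num.min 1 (r / p)) * V `^ r,
        forall t, atomic_sum x0 rho w kp lev nu alpha a (y t) = 0 &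
        (\int[lebm R d]_x (`|probe x0 rho w kp lev nu lam b x| `^ q')%:E <= (Z `^ q')%:E)%E] /\
    (forall i, weight kp alpha (lev i) * (\prod_(j < d) scale rho kp (lev i) j ^+ lam j) = W) /\
    dl * (m * V * Z) < c1 * (W * \sum_i \sum_i' a i * b i' * gram x0 rho w kp lev nu lam i i')) ->
  (dl%:E <= recovery_width D lam (Kball D p theta alpha) q n)%E.
Proof.
have [c1 c10 hK] := kball_scaled x0 rho0 rho1 jw sw p1 th1 al0.
exists c1 => // n dl dl0 H; apply: (recovery_width_ge oD q0 q'0 qq' dl0) => y _.
have [E [I [kp [lev [nu [k [a [b [m [V [Z [W]]]]]]]]]]]] := H y.
move=> [[wf nur m0 V1 Z0] [[hE hS hy hZ] [hW hX]]].
have V0 : 0 < V by exact: lt_le_trans V1.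
pose t := c1 / (m * V).
have t0 : 0 < t by rewrite divr_gt0// mulr_gt0.
have tmV : t * m * V <= c1.
  by rewrite le_eqVlt; apply/orP; left; apply/eqP; rewrite /t; field; rewrite !gt_eqF.
set G := \sum_i _ in hX.
have zs s : forall i, atomic_sum x0 rho w kp lev nu alpha (fun i => s * a i) (y i) = 0.
  move=> i; rewrite -[RHS](mulr0 s) -(hy i) /atomic_sum mulr_sumr.
  by apply: eq_bigr => j _; rewrite -!mulrA.
exists (atomic_sum x0 rho w kp lev nu alpha (fun i => t * a i)),
  (atomic_sum x0 rho w kp lev nu alpha (fun i => t * - a i)),
  (probe x0 rho w kp lev nu lam b), Z, (t * (W * G)); split; [split|split; split].
- exact: hK wf m0 V1 t0 hE hS tmV.
- have En e : energy p lev k (fun i => - a i) e = energy p lev k a e.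
    by apply: eq_bigr => i _; rewrite normrN.
  apply: hK wf m0 V1 t0 _ _ tmV => [e|r thr]; first by rewrite En.
  by under eq_bigr do rewrite En; exact: hS.
- exact: zs.
- move=> i; rewrite -[RHS](zs (- t) i); congr (atomic_sum _ _ _ _ _ _ _ _ _).
  by apply/funext => i'; rewrite mulrN mulNr.
- exact: (@probe_test_fun _ _ x0 rho w rho0 rho1 jw sw _ _ _ _ _ _ marg).
- exact: measurable_probe.
- by [].
- apply: le_trans hZ; apply: ge0_le_integral_raw => // x *; by rewrite lee_fin powR_ge0.
- exact: pairing_atomic.
- rewrite (_ : (fun i => t * - a i) = (fun i => - t * a i)); last first.
    by apply/funext => i; rewrite mulrN mulNr.
  by rewrite (pairing_atomic _ _ _ nur hW) mulNr.
- rewrite /t mulrAC ltr_pdivlMr ?mulr_gt0// -mulrA.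
  by rewrite (mulrC Z).
Qed.

End Reduction.

Section RandomChoice.
Variables (R : realType) (d : nat).
Variables (x0 : 'I_d -> R) (rho : R) (w : 'I_d -> nat -> R -> R) (lam : 'I_d -> nat).
Hypotheses (rho0 : 0 < rho) (rho1 : rho <= 1).
Hypotheses (jw : forall j, jet (w j)) (sw : forall j, supp01 (w j)).
Hypothesis wm0 : wmass w lam != 0.

Definition is_proj (I : finType) (P : I -> I -> R) :=
  (forall i j, P i j = P j i) /\ (forall i j, \sum_k P i k * P k j = P i j).

Lemma proj_contract (I : finType) (P : I -> I -> R) v : is_proj P ->
  \sum_j (\sum_i P i j * v i) ^+ 2 <= \sum_i v i ^+ 2.
Proof.
move=> [sP iP]; set u := fun j => \sum_i P i j * v i.
have Pu i : \sum_j P i j * u j = u i.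
  rewrite /u; under eq_bigr do rewrite mulr_sumr.
  rewrite exchange_big/=; apply: eq_bigr => k _.
  under eq_bigr => j _ do rewrite mulrA (sP k j).
  by rewrite -mulr_suml iP sP.
have uv : \sum_j u j ^+ 2 = \sum_i v i * u i.
  transitivity (\sum_j \sum_i v i * (P i j * u j)).
    apply: eq_bigr => j _; rewrite expr2 {1}/u mulr_suml; apply: eq_bigr => i _.
    by ring.
  by rewrite exchange_big/=; apply: eq_bigr => i _; rewrite -mulr_sumr Pu.
have : 0 <= \sum_i (v i - u i) ^+ 2 by apply: sumr_ge0 => i _; exact: sqr_ge0.
rewrite (_ : \sum_i (v i - u i) ^+ 2 = \sum_i v i ^+ 2 - \sum_i v i * u i *+ 2 + \sum_i u i ^+ 2).
  by rewrite sumrMnl -uv; lra.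
by rewrite -sumrB -big_split; apply: eq_bigr => i _ /=; ring.
Qed.

Lemma proj_diag (I : finType) (P : I -> I -> R) i : is_proj P ->
  \sum_j P i j ^+ 2 = P i i.
Proof. by move=> [sP iP]; rewrite -iP; apply: eq_bigr => j _; rewrite expr2 (sP j i). Qed.

Lemma proj_diag_le1 (I : finType) (P : I -> I -> R) i : is_proj P -> P i i <= 1.
Proof.
move=> hP; have h := proj_diag i hP.
have : P i i ^+ 2 <= P i i.
  by rewrite -[leRHS]h (bigD1 i)//= lerDl sumr_ge0// => j _; exact: sqr_ge0.
have : 0 <= P i i by rewrite -h sumr_ge0// => j _; exact: sqr_ge0.
move=> h0 h1; have [//|h2] := leP (P i i) 1; exfalso.
by move: h1; rewrite expr2 leNgt ltr_pMl ?h2 ?(lt_trans ltr01 h2).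
Qed.

(** At a fixed point, moving the projection from the signs to the atom values gives a sign sum to
    which Khinchine's inequality applies. As P contracts, its square sum is at most a multiple of
    the number of active cells there. For q' > 2 the power q'/2 of that number costs #|E|^(q'/2 -
    1). *)
Lemma probe_moment (q' : R) : 0 < q' -> exists2 C, 0 < C &
  forall (E I : finType) (kp : E -> 'I_d -> nat) (lev : I -> E) nu k (P : I -> I -> R) x,
  wf_family kp lev nu k -> is_proj P ->
  \sum_(e : {ffun I -> bool})
     `|probe x0 rho w kp lev nu lam (fun i => \sum_j P i j * sgnf R e j) x| `^ q'
  <= C * #|{ffun I -> bool}|%:R * #|E|%:R `^ Num.max (q' / 2 - 1) 0
     * \sum_i active x0 rho kp lev nu i x.
Proof.
move=> q'0; have [C C0 hC] := @khinchine_upper R q' q'0.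
have [M M0 hM] := atom_bound x0 rho jw sw lam.
exists (C * M `^ q'); first by rewrite mulr_gt0// powR_gt0.
move=> E I kp lev nu k P x wf hP.
pose v i := atom x0 rho w kp lev nu lam i x.
rewrite (eq_bigr (fun e => `|\sum_j (\sum_i P i j * v i) * sgnf R e j| `^ q')); last first.
  move=> e _; congr (`|_| `^ _); rewrite /probe.
  under eq_bigr do rewrite mulr_suml.
  rewrite exchange_big/=; apply: eq_bigr => j _; rewrite mulr_suml; apply: eq_bigr => i _.
  by rewrite /v; ring.
apply: (le_trans (hC _ _)); set N := #|_|%:R; set S := \sum_i active _ _ _ _ _ _ _.
have S0 : 0 <= S by apply: sumr_ge0 => i _; exact: active_ge0.
have vS : \sum_i v i ^+ 2 <= M ^+ 2 * S.
  rewrite /S mulr_sumr; apply: ler_sum => i _.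
  have := hM E I kp lev nu i x; rewrite -/(v i).
  have [->|->] := active_bool x0 rho kp lev nu i x.
    by rewrite !mulr0 normr_le0 => /eqP ->; rewrite expr0n.
  by rewrite !mulr1 => h; rewrite -[v i ^+ 2]real_normK ?num_real// lerXn2r ?nnegrE ?(ltW M0).
apply: (@le_trans _ _ (C * N * (M ^+ 2 * S) `^ (q' / 2))).
  rewrite ler_wpM2l ?mulr_ge0 ?(ltW C0)//.
  apply: ge0_ler_powR; rewrite ?nnegrE ?divr_ge0 ?(ltW q'0) ?mulr_ge0 ?(ltW M0)//.
    by apply: sumr_ge0 => j _; exact: sqr_ge0.
  exact: (le_trans (proj_contract v hP) vS).
rewrite powRM ?sqr_ge0// -powR_mulrn ?(ltW M0)// -powRrM (_ : 2%:R * (q' / 2) = q'); last by field.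
have := powR_sum_active x0 rho0 x wf (divr_gt0 q'0 (ltr0Sn R 1)).
rewrite -/S => h.
have CM : 0 <= C * N * M `^ q' by rewrite !mulr_ge0 ?powR_ge0 ?(ltW C0).
have := ler_wpM2l CM h; rewrite !mulrA => h2; apply: (le_trans h2).
by rewrite le_eqVlt; apply/orP; left; apply/eqP; ring.
Qed.

End RandomChoice.

Section Choice.
Variables (R : realType) (d : nat).
Local Notation RR := (measurableTypeR R).
Variables (x0 : 'I_d -> R) (rho : R) (w : 'I_d -> nat -> R -> R) (lam : 'I_d -> nat).
Hypotheses (rho0 : 0 < rho) (rho1 : rho <= 1).
Hypotheses (jw : forall j, jet (w j)) (sw : forall j, supp01 (w j)).
Hypothesis wm0 : wmass w lam != 0.

Lemma sum_signs_sq (I : finType) (P : I -> I -> R) : is_proj P ->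
  \sum_(e : {ffun I -> bool}) \sum_i (\sum_j P i j * sgnf R e j) ^+ 2
  = #|{ffun I -> bool}|%:R * \sum_i P i i.
Proof.
move=> hP; rewrite exchange_big mulr_sumr /=; apply: eq_bigr => i _.
under eq_bigr do rewrite expr2 mulr_suml.
rewrite exchange_big /= -(proj_diag i hP) mulr_sumr; apply: eq_bigr => j _.
transitivity (\sum_j' P i j * P i j' * \sum_(e : {ffun I -> bool}) sgnf R e j * sgnf R e j').
  under eq_bigr do rewrite mulr_sumr.
  rewrite exchange_big /=; apply: eq_bigr => j' _; rewrite mulr_sumr.
  by apply: eq_bigr => e _; ring.
under eq_bigr do rewrite sum_sign_pair.
rewrite (bigD1 j)//= big1 ?addr0; first by rewrite eqxx mul1r mulrC expr2.
by move=> j' /negbTE jj; rewrite eq_sym jj mul0r mulr0.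
Qed.

(** [A] is meant as the q-th power of a bound for the norm of the function. The pairing averages at
    least to the trace of P times the cell volume, because the squares of the projected signs
    average to that trace; one choice of signs then serves the function and the probe together. *)
Lemma random_choice (q q' : R) : 0 < q -> 0 < q' -> q^-1 + q'^-1 = 1 ->
  exists2 c, 0 < c &
  forall (E I : finType) (kp : E -> 'I_d -> nat) (lev : I -> E) nu k (P : I -> I -> R)
    (A : {ffun I -> bool} -> R) (A0 T : R),
  wf_family kp lev nu k -> is_proj P -> (forall e, 0 <= A e) -> 0 < A0 ->
  \sum_e A e <= #|{ffun I -> bool}|%:R * A0 -> 0 < T -> T <= \sum_i P i i ->
  exists (e : {ffun I -> bool}) (Z : R),
    let a := fun i => \sum_j P i j * sgnf R e j in
    [/\ 0 < Z,
      (\int[lebm R d]_x (`|probe x0 rho w kp lev nu lam a x| `^ q')%:E <= (Z `^ q')%:E)%E &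
      c * (2^-1 ^+ k * T) * ((A e + A0) `^ q^-1 * Z)
      <= (\sum_i \sum_i' a i * a i' * gram x0 rho w kp lev nu lam i i')
         * (A0 `^ q^-1 * (#|E|%:R `^ Num.max (q' / 2 - 1) 0 * (#|I|%:R * 2^-1 ^+ k)) `^ q'^-1)].
Proof.
move=> q0 q'0 qq'.
have [C C0 hC] := probe_moment x0 lam rho0 jw sw q'0.
have w20 : 0 < wmass w lam ^+ 2 by rewrite lt_neqAle eq_sym sqrf_eq0 wm0 sqr_ge0.
have r0 : 0 < rho ^+ d by exact: exprn_gt0.
pose u := 2 `^ q^-1 * (2 * (C * rho ^+ d)) `^ q'^-1.
have u0 : 0 < u by rewrite mulr_gt0 ?powR_gt0// mulr_gt0// mulr_gt0.
exists (wmass w lam ^+ 2 * rho ^+ d / u); first by rewrite divr_gt0// mulr_gt0.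
move=> E I kp lev nu k P A A0 T wf hP A_ge0 A00 hA T0 hT.
have [i0 _] : exists i : I, true.
  apply: contrapT => /forallNP H; move: T0; rewrite ltNge => /negP; apply.
  by apply: (le_trans hT); rewrite big1// => i; case: (H i).
have I0 : 0 < #|I|%:R :> R by rewrite ltr0n; apply/card_gt0P; exists i0.
have E0 : 0 < #|E|%:R :> R by rewrite ltr0n; apply/card_gt0P; exists (lev i0).
have k0 : 0 < 2^-1 ^+ k :> R by rewrite exprn_gt0.
set S := _ * (#|I|%:R * _).
have S0 : 0 < S by rewrite !mulr_gt0 ?powR_gt0.
pose a (e : {ffun I -> bool}) i := \sum_j P i j * sgnf R e j.
pose F e : \bar R := (\int[lebm R d]_x (`|probe x0 rho w kp lev nu lam (a e) x| `^ q')%:E)%E.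
have F0 e : (0 <= F e)%E by apply: integral_ge0 => x _; rewrite lee_fin powR_ge0.
have mF e : measurable_fun [set: d.-tuple RR]
    (fun x => (`|probe x0 rho w kp lev nu lam (a e) x| `^ q')%:E).
  apply/measurable_EFinP; apply: (measurableT_comp (measurable_powR _)).
  apply: measurableT_comp => //; exact: measurable_probe.
set N := #|{ffun I -> bool}|%:R in hA *.
have N0 : 0 < N by rewrite ltr0n; apply/card_gt0P; exists [ffun=> true].
pose B0 := C * rho ^+ d * S.
have B00 : 0 < B0 by apply: mulr_gt0 S0; exact: mulr_gt0.
have hF : (\sum_e F e <= (N * B0)%:E)%E.
  rewrite /F -ge0_integral_sum//.
  apply: (@le_trans _ _ (\int[lebm R d]_x (\sum_i (C * N * #|E|%:R `^ Num.max (q' / 2 - 1) 0)%:E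
      * (active x0 rho kp lev nu i x)%:E))%E).
    apply: ge0_le_integral_raw => x.
    - by move=> _; apply: sume_ge0 => e _; rewrite lee_fin powR_ge0.
    - apply: sume_ge0 => i _; rewrite -EFinM lee_fin !mulr_ge0 ?powR_ge0 ?(ltW C0) ?active_ge0//.
    - move=> _; rewrite sumEFin -ge0_sume_distrr ?sumEFin -?EFinM ?lee_fin; last first.
        by move=> i _; rewrite lee_fin active_ge0.
      exact: hC wf hP.
  rewrite ge0_integral_sum//; last 2 first.
  - move=> i; apply: measurable_funeM; apply/measurable_EFinP; exact: measurable_active.
  - move=> i x _; rewrite -EFinM lee_fin !mulr_ge0 ?powR_ge0 ?(ltW C0) ?active_ge0//.
  rewrite (eq_bigr (fun=> ((C * N * #|E|%:R `^ Num.max (q' / 2 - 1) 0) * (rho ^+ d * 2^-1 ^+ k))%:E)).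
    rewrite sumEFin lee_fin sumr_const -[_ *+ _]mulr_natr le_eqVlt; apply/orP; left; apply/eqP.
    by rewrite /B0 /S -/N; ring.
  move=> i _; rewrite ge0_integralZl//.
  - by rewrite (integral_active _ _ _ wf).
  - apply/measurable_EFinP; exact: measurable_active.
  - by move=> x _; rewrite lee_fin active_ge0.
  - by rewrite lee_fin !mulr_ge0 ?powR_ge0 ?(ltW C0).
have Ffin e : (F e \is a fin_num).
  rewrite ge0_fin_numE//; apply: le_lt_trans (ltry (N * B0)).
  apply: le_trans hF; rewrite (bigD1 e)//= leeDl// sume_ge0//.
pose B e := fine (F e).
have FB e : F e = (B e)%:E by rewrite fineK.
have B_ge0 e : 0 <= B e by rewrite -lee_fin -FB.
have hB : \sum_e B e <= N * B0.
  by rewrite -lee_fin -sumEFin; under eq_bigr do rewrite -FB.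
pose X e := \sum_i \sum_i' a e i * a e i' * gram x0 rho w kp lev nu lam i i'.
have hX : N * (wmass w lam ^+ 2 * (rho ^+ d * 2^-1 ^+ k) * T) <= \sum_e X e.
  apply: (@le_trans _ _ (\sum_e wmass w lam ^+ 2 * (rho ^+ d * 2^-1 ^+ k) * \sum_i a e i ^+ 2)).
    rewrite -mulr_sumr sum_signs_sq// -/N mulrCA.
    rewrite ler_wpM2l ?(mulr_ge0 (ltW w20) (mulr_ge0 (ltW r0) (ltW k0)))//.
    by rewrite ler_wpM2l// ltW.
  by apply: ler_sum => e _; exact: (gram_ge x0 rho0 jw sw lam wf).
have T2 : (0 < #|{ffun I -> bool}|)%N by apply/card_gt0P; exists [ffun=> true].
have x00 : 0 < wmass w lam ^+ 2 * (rho ^+ d * 2^-1 ^+ k) * T.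
  by apply: mulr_gt0 T0; apply: (mulr_gt0 w20); exact: mulr_gt0.
have [e he] := average_selection T2 q0 q'0 qq' A_ge0 B_ge0 A00 B00 x00 hA hB hX.
exists e, ((B e + B0) `^ q'^-1); split.
- by rewrite powR_gt0// ltr_wpDl.
- rewrite -/(F e) FB lee_fin -powRrM mulVf ?gt_eqF// powRr1 ?lerDl ?(ltW B00)//.
  by rewrite addr_ge0// ltW.
- have -> : wmass w lam ^+ 2 * rho ^+ d / u * (2^-1 ^+ k * T)
      = wmass w lam ^+ 2 * (rho ^+ d * 2^-1 ^+ k) * T / u by ring.
  rewrite mulrAC ler_pdivrMr//; apply: (le_trans he).
  rewrite -/(X e) -mulrA le_eqVlt; apply/orP; left; apply/eqP; congr (_ * _).
  rewrite powRM ?(ltW A00)// (_ : 2 * B0 = (2 * (C * rho ^+ d)) * S); last by rewrite /B0; ring.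
  rewrite [(_ * S) `^ _]powRM ?(ltW S0) ?mulr_ge0 ?(ltW C0) ?(ltW r0)//.
  by rewrite /u; ring.
Qed.

End Choice.

(** * Dyadic levels and the three ranges of exponents *)

Section Levels.
Variables (R : realType) (d : nat).

Definition level_system (E : finType) (kp : E -> 'I_d -> nat) k (J : pred 'I_d) :=
  [/\ forall e e', kp e =1 kp e' -> e = e', forall e, (\sum_(j < d) kp e j)%N = k &
      forall e j, ~~ J j -> kp e j = 0%N].

Lemma single_level k (J : pred 'I_d) j0 : J j0 ->
  level_system (fun (_ : unit) j => if j == j0 then k else 0%N) k J.
Proof.
move=> Jj0; split; first by case; case.
  by move=> _; rewrite -big_mkcond big_pred1_eq.
by move=> _ j; case: eqP => // ->; rewrite Jj0.
Qed.

(* Coordinate [j0] absorbs what the other exponents leave of [d * k']. *)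
Lemma exists_levels k' (J : pred 'I_d) j0 : J j0 ->
  exists (E : finType) (kp : E -> 'I_d -> nat),
    level_system kp (d * k') J /\ #|E| = (k'.+1 ^ #|J|.-1)%N.
Proof.
move=> Jj0; pose A := [pred j | (j != j0) && J j].
have cA : #|A| = #|J|.-1.
  rewrite [in RHS](cardD1 j0) unfold_in Jj0 add1n /=; apply: eq_card => j.
  by rewrite !inE.
pose E := {e : {ffun 'I_d -> 'I_k'.+1} | e \in pffun_on ord0 A predT}.
have eA (e : E) j : ~~ A j -> val e j = ord0.
  move=> nA; have /pffun_onP[/supportP h _] := valP e; exact: h.
pose s (e : E) := (\sum_(j < d | j != j0) val e j)%N.
have sk e : (s e <= d * k')%N.
  apply: (@leq_trans (\sum_(j < d | j != j0) k')%N).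
    by apply: leq_sum => j _; rewrite -ltnS.
  apply: (@leq_trans (\sum_(j < d) k')%N); last by rewrite sum_nat_const card_ord.
  by rewrite [leqRHS](bigID (fun j => j != j0)) leq_addr.
exists E, (fun e j => if j == j0 then (d * k' - s e)%N else val e j); split; last first.
  rewrite card_sig (_ : #|_| = #|pffun_on (ord0 : 'I_k'.+1) A predT|)//.
  by rewrite card_pffun_on card_ord cA.
split.
- move=> e e' h; apply: val_inj; apply/ffunP => j; apply: val_inj.
  have [->|jj] := eqVneq j j0; first by rewrite !eA//= eqxx.
  by have := h j; rewrite (negbTE jj).
- move=> e; rewrite (bigD1 j0)//= eqxx.
  rewrite (eq_bigr (fun j => val e j : nat)); last by move=> j /negbTE ->.
  by rewrite subnK.
- move=> e j nJ; case: eqP => [jj|/eqP jj]; first by rewrite jj Jj0 in nJ.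
  by rewrite eA//= jj.
Qed.

(** A direction in J contributes its scale to the power - mu, while the others are not refined. Only
    the sum of the exponents survives, so all shapes share one value. *)
Lemma weight_scale (E : finType) (kp : E -> 'I_d -> nat) k (J : pred 'I_d) (alpha : 'I_d -> R)
    (lam : 'I_d -> nat) (mu rho : R) e :
  level_system kp k J -> 0 < rho -> (forall j, J j -> alpha j - (lam j)%:R = mu) ->
  weight kp alpha e * (\prod_(j < d) scale rho kp e j ^+ lam j)
  = (2 ^+ k) `^ (- mu) * rho^-1 ^+ (\sum_(j < d) lam j)%N.
Proof.
move=> [_ sk zJ] rho0 hJ; rewrite -(sk e) /weight.
have -> : (2 ^+ (\sum_(j < d) kp e j)%N) `^ (- mu) = \prod_(j < d) (2 ^+ kp e j : R) `^ (- mu).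
  by rewrite -prodrXr powR_prod// => j; rewrite exprn_ge0.
rewrite -prodrXr -!big_split /=; apply: eq_bigr => j _.
rewrite /scale exprMn mulrA; congr (_ * _).
have p2 : 0 < 2 ^+ kp e j :> R by exact: exprn_gt0.
rewrite -[_ ^+ lam j]powR_mulrn ?(ltW p2)// -powRD; last by rewrite (gt_eqF p2) implybT.
have [Jj|nJ] := boolP (J j); last by rewrite zJ// expr0 !powR1.
by rewrite -(hJ j Jj); congr (_ `^ _); ring.
Qed.

Section Cells.
Variables (E : finType) (kp : E -> 'I_d -> nat) (k : nat) (J : pred 'I_d).
Hypothesis ls : level_system kp k J.

(** No exponent exceeds k, so the positions of all levels fit into one type with the common bound
    2^k. *)
Definition cells_at e : pred {ffun 'I_d -> 'I_(2 ^ k)} :=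
  fun v => [forall j, (v j < 2 ^ kp e j)%N].

Lemma card_cells_at e : #|cells_at e| = (2 ^ k)%N.
Proof.
have [_ sk _] := ls.
rewrite (@eq_card _ _ (family (fun j => [pred x : 'I_(2 ^ k) | (x < 2 ^ kp e j)%N]))); last first.
  move=> v; rewrite [LHS]unfold_in /cells_at; apply/forallP/familyP => h j; exact: h.
rewrite card_family foldrE big_map -[X in (2 ^ X)%N](sk e) expn_sum big_enum /=.
apply: eq_bigr => j _; rewrite -sum1_card -(big_ord_widen _ (fun=> 1%N)).
  by rewrite sum1_card card_ord.
by rewrite -expn_sum leq_pexp2l// (bigD1 j)//= leq_addr.
Qed.

Definition cells := {c : E * {ffun 'I_d -> 'I_(2 ^ k)} | cells_at c.1 c.2}.
Definition cell_lev (i : cells) := (val i).1.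
Definition cell_nu (i : cells) j : int := Posz ((val i).2 j).

Lemma card_cells : #|{: cells}| = (2 ^ k * #|E|)%N.
Proof.
rewrite card_sig -sum1_card -(pair_big_dep xpredT (fun e v => cells_at e v) (fun _ _ => 1%N)) /=.
rewrite (eq_bigr (fun=> (2 ^ k)%N)); last by move=> e _; rewrite sum1_card card_cells_at.
by rewrite sum_nat_const mulnC.
Qed.

Lemma cells_wf : wf_family kp cell_lev cell_nu k.
Proof.
have [inj sk _] := ls; split => // i i' hl hn; apply: val_inj.
move: hl hn; rewrite /cell_lev /cell_nu; case: (val i) (val i') => [e v] [e' v'] /= -> h.
congr pair; apply/ffunP => j; apply: val_inj; by have [] := h j.
Qed.

Lemma cells_range : in_range kp cell_lev cell_nu.
Proof. by move=> i j; rewrite /cell_nu /= ltz_nat; have /forallP/(_ j) := valP i. Qed.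

End Cells.

Section FreeCells.
Variables (E : finType) (kp : E -> 'I_d -> nat) (k : nat) (J : pred 'I_d).
Hypothesis ls : level_system kp k J.
Variables (x0 : 'I_d -> R) (rho : R) (w : 'I_d -> nat -> R -> R).
Hypotheses (rho0 : 0 < rho) (sw : forall j, supp01 (w j)).

(** A node lies in at most one of the 2^k cells of a level, so fewer than 2^k nodes leave a cell of
    each level free. *)
Lemma free_cells n (y : 'I_n -> pt R d) : (n < 2 ^ k)%N ->
  exists nu : E -> 'I_d -> int,
  [/\ wf_family kp id nu k, in_range kp id nu &
      forall m e t, atom x0 rho w kp id nu m e (y t) = 0].
Proof.
move=> nk; have [inj sk _] := ls.
pose u e t j := 2 ^+ kp e j * ((coord (y t) j - x0 j) / rho).
have /boolp.choice[v hv] : forall e, exists v : {ffun 'I_d -> 'I_(2 ^ k)},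
    cells_at kp e v /\ forall t, \prod_(j < d) cell (u e t j - (v j : nat)%:Z%:~R) = 0.
  move=> e; apply: contrapT => /forallNP H.
  have : (\sum_(v | cells_at (k := k) kp e v) \sum_(t < n)
      \prod_(j < d) cell (u e t j - (v j : nat)%:Z%:~R) : R) <= n%:R.
    rewrite exchange_big /=.
    apply: (@le_trans _ _ (\sum_(t < n) 1)); last by rewrite sumr_const card_ord.
    apply: ler_sum => t _.
    apply: (@sum_prod_cell_le1 R _ (cells_at (k := k) kp e) d
      (fun v j => (v j : nat)%:Z)) => v v' _ _ h.
    by apply/ffunP => j; apply: val_inj; have [] := h j.
  apply/negP; rewrite -ltNge.
  apply: (@lt_le_trans _ _ (\sum_(v | cells_at (k := k) kp e v) 1)).
    by rewrite sumr_const (card_cells_at ls) ltr_nat.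
  apply: ler_sum => v cv.
  have [t /eqP ht] : exists t, \prod_(j < d) cell (u e t j - (v j : nat)%:Z%:~R) <> 0.
    by apply: contrapT => /forallNP h; apply: (H v); split => // t; apply: contrapT; exact: h.
  have cell_ge (t' : 'I_n) : 0 <= \prod_(j < d) cell (u e t' j - (v j : nat)%:Z%:~R).
    by apply: prodr_ge0 => j _; exact: cell_ge0.
  rewrite (bigD1 t)//= -[leLHS]addr0; apply: lerD; last exact: sumr_ge0.
  have : \prod_(j < d) cell (u e t j - (v j : nat)%:Z%:~R) = 0 \/
     \prod_(j < d) cell (u e t j - (v j : nat)%:Z%:~R) = 1 :> R.
    elim/big_rec : _ => [|j z _]; first by right.
    by rewrite /cell; case: (_ && _); rewrite ?mul1r ?mul0r//; left.
  by case=> [/eqP|->]; rewrite ?(negbTE ht).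
exists (fun e j => (v e j : nat)%:Z); split.
- by split.
- by move=> e j; rewrite /= ltz_nat; have [/forallP/(_ j)] := hv e.
- move=> m e t; have [_ /(_ t)] := hv e.
  move=> /eqP; rewrite prodf_seq_eq0 => /hasP[j _ /= cj].
  rewrite /atom /tens (bigD1 j)//= sw ?mul0r//.
  apply: contraTN cj => /andP[h1 h2].
  have -> : u e t j - (v e j : nat)%:Z%:~R
      = scale rho kp e j * coord (y t) j - offset x0 rho kp id (fun e j => (v e j : nat)%:Z) e j.
    by rewrite /u /offset /scale; field; rewrite gt_eqF.
  by rewrite /cell (ltW h1) h2 oner_eq0.
Qed.

End FreeCells.
End Levels.

(** * The level belonging to n *)

Section Numerology.
Variable R : realType.

Lemma powR_two_sided (c C s : R) : 0 < c -> 0 < C -> exists2 b, 0 < b &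
  forall x y : R, 0 < y -> c * y <= x -> x <= C * y -> b * y `^ s <= x `^ s.
Proof.
move=> c0 C0; exists (Num.min (c `^ s) (C `^ s)); first by rewrite lt_min !powR_gt0.
move=> x y y0 h1 h2.
have x0 : 0 < x by apply: lt_le_trans h1; exact: mulr_gt0.
have [s0|s0] := leP 0 s.
  apply: (@le_trans _ _ ((c * y) `^ s)).
    by rewrite powRM ?(ltW c0) ?(ltW y0)// ler_wpM2r ?powR_ge0// ge_min lexx.
  by apply: ge0_ler_powR; rewrite ?nnegrE ?(mulr_ge0 (ltW c0) (ltW y0)) ?(ltW x0).
apply: (@le_trans _ _ ((C * y) `^ s)).
  by rewrite powRM ?(ltW C0) ?(ltW y0)// ler_wpM2r ?powR_ge0// ge_min lexx orbT.
have [r sE r0] : exists2 r, s = - r & 0 <= r.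
  by exists (- s); rewrite ?opprK ?oppr_ge0 ?(ltW s0).
rewrite sE !powRN lef_pV2 ?posrE ?powR_gt0 ?mulr_gt0//.
by apply: ge0_ler_powR; rewrite ?nnegrE ?(mulr_ge0 (ltW C0) (ltW y0)) ?(ltW x0).
Qed.

Lemma numerology (d g : nat) : (0 < d)%N -> exists c C : R, [/\ 0 < c, 0 < C &
  forall n, (2 <= n)%N -> exists k',
   [/\ (n.*2 <= 2 ^ (d * k') * k'.+1 ^ g)%N,
       (2 ^ (d * k') * k'.+1 ^ g)%:R <= C * n%:R,
       c * ln n%:R <= k'.+1%:R & k'.+1%:R <= C * ln n%:R]].
Proof.
move=> d0; pose N k' := (2 ^ (d * k') * k'.+1 ^ g)%N.
have N_ge k' : (2 ^ k' <= N k')%N.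
  apply: (@leq_trans (2 ^ (d * k'))); first by rewrite leq_pexp2l// leq_pmull.
  by rewrite leq_pmulr// expn_gt0.
have ln20 : 0 < ln 2 :> R by rewrite ln_gt0// ltr1n.
pose C1 : R := 2 ^+ (d + g).+1.
(* If k' + 1 is the chosen level, then 2^k' < 2n <= n^2, whence (k' + 2) ln 2 <= 2 ln n + 2 ln 2 <=
   4 ln n. *)
pose C2 : R := 4 / ln 2.
have C10 : 0 < C1 by exact: exprn_gt0.
have C20 : 0 < C2 by rewrite divr_gt0.
have dg0 : 0 < (d + g)%:R * ln 2 :> R by rewrite mulr_gt0// ltr0n addn_gt0 d0.
exists (((d + g)%:R * ln 2)^-1), (C1 + C2); split; rewrite ?invr_gt0 ?addr_gt0//.
move=> n n2.
have n0 : 0 < n%:R :> R by rewrite ltr0n (leq_trans _ n2).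
have lnn : ln 2 <= ln n%:R :> R by rewrite ler_ln ?posrE// ler_nat.
have ex : exists k', (n.*2 <= N k')%N.
  by exists n.*2; apply: leq_trans (N_ge _); rewrite ltnW// ltn_expl.
case: (ex_minnP ex) => -[|k'] hk min.
  by exfalso; move: hk; rewrite /N muln0 expn0 exp1n; lia.
have hk' : (N k' < n.*2)%N by rewrite ltnNge; apply/negP => /min; rewrite ltnn.
exists k'.+1; split => //.
- apply: (@le_trans _ _ (C1 * n%:R)); last by rewrite ler_wpM2r ?(ltW n0)// lerDl ltW.
  rewrite /C1 -natrX -natrM ler_nat.
  apply: (@leq_trans (2 ^ (d + g) * N k')).
    have -> : (2 ^ (d + g) * N k' = 2 ^ (d * k'.+1) * (2 * k'.+1) ^ g)%N.
      by rewrite /N mulnS !expnD expnMn; lia.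
    rewrite leq_mul2l; apply/orP; right; case: (g) => // g'.
    by rewrite leq_exp2r//; lia.
  by rewrite expnS -mulnA mulnCA mul2n leq_mul2l ltnW ?orbT.
- rewrite mulrC ler_pdivrMr//.
  have : (n <= 2 ^ ((d + g) * k'.+1))%N.
    apply: (@leq_trans (N k'.+1)); first by rewrite (leq_trans _ hk)// -addnn leq_addr.
    rewrite /N mulnDl expnD leq_mul2l; apply/orP; right.
    by rewrite mulnC expnM; case: (g) => // g'; rewrite leq_exp2r// ltn_expl.
  rewrite -(ler_nat R) => h.
  have : ln n%:R <= ln (2 ^ ((d + g) * k'.+1))%:R :> R.
    by rewrite ler_ln ?posrE// ltr0n expn_gt0.
  rewrite natrX lnXn// => h2; apply: (le_trans h2).
  rewrite -[_ *+ _]mulr_natr natrM [leLHS](_ : _ = k'.+1%:R * ((d + g)%:R * ln 2)); last by ring.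
  by rewrite ler_wpM2r ?(ltW dg0)// ler_nat.
- apply: (@le_trans _ _ (C2 * ln n%:R)); last first.
    by rewrite ler_wpM2r ?lerDr ?(ltW C10)// (le_trans (ltW ln20)).
  have : (2 ^ k' <= n ^ 2)%N.
    apply: (leq_trans (N_ge _)); apply: (leq_trans (ltnW hk')).
    by rewrite -mul2n expnS expn1 leq_mul2r n2 orbT.
  rewrite -(ler_nat R) => h.
  have : ln (2 ^ k')%:R <= ln (n ^ 2)%:R :> R.
    by rewrite ler_ln ?posrE// ltr0n expn_gt0// (leq_trans _ n2).
  rewrite !natrX !lnXn// -[ln 2 *+ _]mulr_natr -[ln n%:R *+ _]mulr_natr => h2.
  rewrite /C2 mulrAC ler_pdivlMr// -addn2 natrD mulrDl; lra.
Qed.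

End Numerology.

(** * Lower bounds in the three ranges *)

Section Cases.
Variables (R : realType) (d : nat).
Local Notation RR := (measurableTypeR R).
Variables (x0 : 'I_d -> R) (rho : R) (w : 'I_d -> nat -> R -> R).
Hypotheses (rho0 : 0 < rho) (rho1 : rho <= 1).
Hypotheses (jw : forall j, jet (w j)) (sw : forall j, supp01 (w j)).
Variables (D : set (pt R d)) (marg : R).
Hypotheses (oD : is_open D) (marg0 : 0 < marg).
Hypothesis cubeD : forall x, cube x0 rho x -> boxnbhd x marg `<=` D.
Variables (alpha : 'I_d -> R) (p : R) (theta : \bar R) (q q' : R) (lam : 'I_d -> nat).
Hypotheses (p1 : 1 <= p) (th1 : (1 <= theta)%E) (al0 : forall j, 0 < alpha j).
Hypotheses (q0 : 0 < q) (q'0 : 0 < q') (qq' : q^-1 + q'^-1 = 1).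
Hypothesis wm0 : wmass w lam != 0.

Let p0 : 0 < p. Proof. exact: lt_le_trans p1. Qed.

(** Only the total energy is controlled. With sg = min(1, r/p), concavity spreads it over the levels
    at the price #|E|^(1 - sg), and 1 - sg = r (1/r - 1/p)_+. *)
Lemma energy_total (E I : finType) (lev : I -> E) k (a : I -> R) m :
  (0 < #|E|)%N -> 0 < m -> 2^-1 ^+ k * \sum_i `|a i| `^ p <= m `^ p ->
  (forall e, energy p lev k a e <= m `^ p) /\
  forall r, theta = r%:E -> \sum_e energy p lev k a e `^ Num.min 1 (r / p)
    <= m `^ (p * Num.min 1 (r / p)) * (#|E|%:R `^ posp (inv_theta theta - p^-1)) `^ r.
Proof.
move=> E0 m0 hm.
have tot : \sum_e energy p lev k a e = 2^-1 ^+ k * \sum_i `|a i| `^ p.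
  by rewrite mulr_sumr [RHS](partition_big lev xpredT).
split=> [e|r thr].
  apply: le_trans hm; rewrite -tot (bigD1 e)//= lerDl sumr_ge0// => *; exact: energy_ge0.
have r1 : 1 <= r by rewrite -lee_fin -thr.
have r0 : 0 < r by exact: lt_le_trans r1.
set sg := Num.min 1 (r / p).
have sg0 : 0 < sg by rewrite lt_min ltr01 divr_gt0.
have sg1 : sg <= 1 by rewrite ge_min lexx.
apply: (le_trans (sum_powR_concave sg0 sg1 _)) => [e|]; first exact: energy_ge0.
rewrite -!powRrM mulrC.
have -> : posp (inv_theta theta - p^-1) * r = 1 - sg.
  rewrite thr /posp /sg /=.
  have -> : Num.max (r^-1 - p^-1) 0 * r = Num.max ((r^-1 - p^-1) * r) (0 * r).
    by rewrite maxr_pMl ?(ltW r0).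
  have -> : (r^-1 - p^-1) * r = 1 - r / p by field; rewrite !gt_eqF.
  by rewrite mul0r; case: (leP (1 - r / p) 0) => h; case: (leP 1 (r / p)) => h'; lra.
rewrite ler_wpM2r ?powR_ge0//.
rewrite powRrM; apply: ge0_ler_powR; rewrite ?nnegrE ?powR_ge0 ?(ltW sg0) ?tot//.
by rewrite mulr_ge0// ?exprn_ge0// sumr_ge0// => *; exact: powR_ge0.
Qed.

Lemma card_powR_ge1 (E : finType) s : (0 < #|E|)%N -> 0 <= s -> 1 <= #|E|%:R `^ s :> R.
Proof.
move=> E0 s0; rewrite -[leLHS](powRr0 (#|E|%:R : R)).
by apply: ler_powR => //; rewrite ler1n.
Qed.

Lemma random_width : exists2 c, 0 < c &
  forall n (E I : finType) (kp : E -> 'I_d -> nat) (lev : I -> E) k (A0 T V W : R),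
  0 < A0 -> 0 < T -> 1 <= V -> 0 < W -> (0 < #|I|)%N ->
  (forall i, weight kp alpha (lev i) * (\prod_(j < d) scale rho kp (lev i) j ^+ lam j) = W) ->
  (forall y : 'I_n -> pt R d, exists nu P (A : {ffun I -> bool} -> R),
    [/\ wf_family kp lev nu k, in_range kp lev nu, is_proj P & T <= \sum_i P i i] /\
    [/\ forall e, 0 <= A e, \sum_e A e <= #|{ffun I -> bool}|%:R * A0 &
     forall s : {ffun I -> bool},
      let a := fun i => \sum_j P i j * sgnf R s j in
      let m := (A s + A0) `^ q^-1 in
      [/\ forall e, energy p lev k a e <= m `^ p,
        forall r, theta = r%:E -> \sum_e energy p lev k a e `^ Num.min 1 (r / p)
          <= m `^ (p * Num.min 1 (r / p)) * V `^ r &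
        forall t, atomic_sum x0 rho w kp lev nu alpha a (y t) = 0]]) ->
  ((c * W * (2^-1 ^+ k * T) /
     (V * (A0 `^ q^-1 * (#|E|%:R `^ Num.max (q' / 2 - 1) 0 * (#|I|%:R * 2^-1 ^+ k)) `^ q'^-1)))%:E
   <= recovery_width D lam (Kball D p theta alpha) q n)%E.
Proof.
have [c1 c10 h1] := family_width_ge rho0 rho1 jw sw oD marg0 cubeD lam p1 th1 al0 q0 q'0 qq'.
have [c2 c20 h2] := random_choice x0 rho0 jw sw wm0 q0 q'0 qq'.
(* The factor 1/2 turns the weak inequality of the random choice into the strict one that is
   required. *)
exists (c1 * c2 / 2); first by rewrite divr_gt0// mulr_gt0.
move=> n E I kp lev k A0 T V W A00 T0 V1 W0 I0 hW H.
have V0 : 0 < V by exact: lt_le_trans V1.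
have [i0 _] := card_gt0P I0.
have E0 : 0 < #|E|%:R :> R by rewrite ltr0n; apply/card_gt0P; exists (lev i0).
have k0 : 0 < 2^-1 ^+ k :> R by rewrite exprn_gt0.
set U := A0 `^ _ * _.
have U0 : 0 < U.
  apply: mulr_gt0; rewrite powR_gt0//; apply: mulr_gt0; rewrite ?powR_gt0//.
  by apply: mulr_gt0 k0; rewrite ltr0n.
have c120 : 0 < c1 * c2 / 2 by rewrite divr_gt0// mulr_gt0.
apply: h1.
  apply: divr_gt0; last exact: mulr_gt0.
  by apply: mulr_gt0; apply: mulr_gt0.
move=> y; have [nu [P [A [[wf nur hP hT] [A_ge0 hA hs]]]]] := H y.
have [s [Z /= [Z0 hZ hX]]] := h2 _ _ _ _ _ _ _ _ _ _ wf hP A_ge0 A00 hA T0 hT.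
have [hE hS hy] := hs s.
set a := (fun i => \sum_j P i j * sgnf R s j) in hE hS hy hZ hX.
have m0 : 0 < (A s + A0) `^ q^-1 by rewrite powR_gt0// ltr_wpDl.
exists E, I, kp, lev, nu, k, a, a, ((A s + A0) `^ q^-1), V, Z, W.
split; [by split|split; [by split|split => //]].
move: hX; rewrite -/U; set m := (A s + A0) `^ _ in m0 *; set X := \sum_i _ => hX.
have X0 : 0 < X.
  rewrite -(pmulr_lgt0 _ U0); apply: lt_le_trans hX.
  by rewrite !mulr_gt0.
have -> : c1 * c2 / 2 * W * (2^-1 ^+ k * T) / (V * U) * (m * V * Z)
    = c1 * W / 2 * ((c2 * (2^-1 ^+ k * T) * (m * Z)) / U).
  by field; rewrite !gt_eqF.
apply: (@le_lt_trans _ _ (c1 * W / 2 * X)).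
  by rewrite ler_wpM2l ?ler_pdivrMr// divr_ge0// mulr_ge0 ?ltW.
rewrite mulrA ltr_pM2r// ltr_pdivrMr// ltr_pMr ?mulr_gt0// ltr1n//.
Qed.

Variables (J : pred 'I_d) (mu : R).
Hypothesis hJ : forall j, J j -> alpha j - (lam j)%:R = mu.

Let rs := rho^-1 ^+ (\sum_(j < d) lam j)%N.
Let rs0 : 0 < rs. Proof. by rewrite exprn_gt0 ?invr_gt0. Qed.

Let pow2V k : 2^-1 ^+ k = (2 ^+ k) `^ (-1) :> R.
Proof. by rewrite powR_inv1 ?exprn_ge0// exprVn. Qed.

Local Notation width := (recovery_width D lam (Kball D p theta alpha) q).
Local Notation tau := (Num.max (q' / 2 - 1) 0).

(** The p-energy of the projected signs is at most C L on average, by Khinchine and because diagonal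
    entries of a projection are at most 1. As q/p <= 1, concavity turns this into a bound for the
    average of its power q/p. *)
Lemma width_ge_all_cells : q <= p -> exists2 c, 0 < c &
  forall n (E : finType) (kp : E -> 'I_d -> nat) k, level_system kp k J -> (0 < #|E|)%N ->
  (n.*2 <= 2 ^ k * #|E|)%N ->
  ((c * (2 ^+ k) `^ (- mu) * #|E|%:R `^ (q^-1 - p^-1 - tau / q'
      - posp (inv_theta theta - p^-1)))%:E <= width n)%E.
Proof.
move=> qp; have [C C0 hC] := @khinchine_upper R p p0.
have [c1 c10 h1] := random_width.
have Cp0 : 0 < C `^ p^-1 by exact: powR_gt0.
exists (c1 * rs / 2 / C `^ p^-1); first by rewrite divr_gt0// divr_gt0// mulr_gt0.
move=> n E kp k ls E0 hN.
set L := #|E|%:R; have L0 : 0 < L :> R by rewrite ltr0n.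
pose I : finType := cells kp k.
have cI : #|I|%:R = 2 ^+ k * L :> R by rewrite (card_cells ls) natrM natrX.
have k0 : 0 < 2 ^+ k :> R by rewrite exprn_gt0.
have kI : 2^-1 ^+ k * #|I|%:R = L.
  by rewrite cI exprVn mulrA mulVf ?mul1r// gt_eqF.
have I0 : (0 < #|I|)%N by rewrite (card_cells ls) muln_gt0 expn_gt0.
pose A0 := (C * L) `^ (q / p).
(* Since 2n <= #|I|, the projection keeps at least half of the full trace. *)
pose T : R := #|I|%:R / 2.
pose V : R := L `^ posp (inv_theta theta - p^-1).
have A00 : 0 < A0 by rewrite powR_gt0// mulr_gt0.
have T0 : 0 < T by rewrite divr_gt0// ltr0n.
have V1 : 1 <= V by apply: card_powR_ge1 => //; rewrite /posp le_max lexx orbT.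
have W0 : 0 < (2 ^+ k) `^ (- mu) * rs by rewrite mulr_gt0// powR_gt0.
have := h1 n E I kp (@cell_lev _ _ kp k) k A0 T V ((2 ^+ k) `^ (- mu) * rs) A00 T0 V1 W0 I0.
have hW (i : I) : weight kp alpha (cell_lev i) * (\prod_(j < d) scale rho kp (cell_lev i) j ^+ lam j)
    = (2 ^+ k) `^ (- mu) * rs by exact: weight_scale ls rho0 hJ.
move=> /(_ hW) h.
have {h} := h _; rewrite (_ : _ / (V * _) = c1 * rs / 2 / C `^ p^-1 * (2 ^+ k) `^ (- mu) *
   L `^ (q^-1 - p^-1 - tau / q' - posp (inv_theta theta - p^-1))); last first.
  set e := q^-1 - _ - _ - _.
  rewrite -/L [#|I|%:R * _]mulrC kI /T mulrA kI /A0 -powRrM.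
  rewrite (_ : q / p * q^-1 = p^-1); last by field; rewrite !gt_eqF.
  rewrite (_ : L `^ tau * L = L `^ (tau + 1)); last first.
    by rewrite powRD ?powRr1 ?(ltW L0)// (gt_eqF L0) implybT.
  rewrite powRM ?(ltW C0) ?(ltW L0)// -powRrM.
  have E1 : L = L `^ e * (V * L `^ p^-1 * L `^ ((tau + 1) / q')).
    rewrite /V -!powRD; last 3 first.
    - by rewrite (gt_eqF L0) implybT.
    - by rewrite (gt_eqF L0) implybT.
    - by rewrite (gt_eqF L0) implybT.
    rewrite -[LHS]powRr1 ?(ltW L0)//; congr (_ `^ _); rewrite -[LHS]qq' /e.
    by set ta := Num.max _ _; set po := posp _; field; rewrite !gt_eqF.
  have V0 : 0 < V by exact: lt_le_trans V1.
  rewrite [X in X / 2]E1; set x1 := L `^ p^-1; set x2 := L `^ ((tau + 1) / q').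
  have x10 : 0 < x1 by exact: powR_gt0.
  have x20 : 0 < x2 by exact: powR_gt0.
  by field; rewrite !gt_eqF.
apply=> y.
pose c t (i : I) := weight kp alpha (cell_lev i)
  * atom x0 rho w kp (@cell_lev _ _ kp k) (@cell_nu _ _ kp k) (fun=> 0%N) i (y t).
have [P [sP iP cP tP]] := exists_projection c.
have hP : is_proj P by split.
pose a (s : {ffun I -> bool}) i := \sum_j P i j * sgnf R s j.
pose S s := 2^-1 ^+ k * \sum_i `|a s i| `^ p.
have S0 s : 0 <= S s.
  by rewrite mulr_ge0 ?exprn_ge0// sumr_ge0// => *; exact: powR_ge0.
exists (@cell_nu _ _ kp k), P, (fun s => S s `^ (q / p)); split; split.
- exact: cells_wf ls.
- exact: cells_range.
- by [].
- apply: le_trans tP; rewrite /T.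
  have : (n.*2)%:R <= #|I|%:R :> R by rewrite ler_nat (card_cells ls).
  rewrite -mul2n natrM; lra.
- by move=> s; exact: powR_ge0.
- have qp0 : 0 < q / p by rewrite divr_gt0.
  have qp1 : q / p <= 1 by rewrite ler_pdivrMr// mul1r.
  apply: (le_trans (sum_powR_concave qp0 qp1 S0)).
  set N := #|_|%:R; have N0 : 0 < N :> R by rewrite ltr0n; apply/card_gt0P; exists [ffun=> true].
  have hS : \sum_s S s <= N * (C * L).
    rewrite -mulr_sumr exchange_big /= (_ : N * (C * L) = 2^-1 ^+ k * \sum_(i : I) (C * N)); last first.
      by rewrite sumr_const -[C * N *+ _]mulr_natr -kI; ring.
    rewrite ler_wpM2l ?exprn_ge0//.
    apply: ler_sum => i _; apply: (le_trans (hC _ _)).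
    rewrite ler_piMr ?mulr_ge0 ?(ltW C0)//.
    rewrite (proj_diag i hP); apply: (@le_trans _ _ (1 `^ (p / 2))); last by rewrite powR1.
    apply: ge0_ler_powR; rewrite ?nnegrE ?divr_ge0 ?(ltW p0)//; last exact: proj_diag_le1.
    by rewrite -(proj_diag i hP) sumr_ge0// => *; exact: sqr_ge0.
  apply: (@le_trans _ _ (N `^ (1 - q / p) * (N * (C * L)) `^ (q / p))).
    rewrite ler_wpM2l ?powR_ge0//; apply: ge0_ler_powR; rewrite ?nnegrE ?(ltW qp0)//.
      exact: sumr_ge0.
    by rewrite mulr_ge0 ?(ltW N0)// mulr_ge0 ?(ltW C0) ?(ltW L0).
  rewrite [(N * _) `^ _]powRM ?(ltW N0) ?mulr_ge0 ?(ltW C0) ?(ltW L0)// mulrA -powRD.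
    by rewrite subrK powRr1// ltW.
  by rewrite (gt_eqF N0) implybT.
move=> s /=; rewrite -/(a s).
have AA : 0 <= S s `^ (q / p) + A0 by rewrite addr_ge0 ?powR_ge0 ?(ltW A00).
have m0 : 0 < (S s `^ (q / p) + A0) `^ q^-1 by rewrite powR_gt0// ltr_wpDl ?powR_ge0.
have hm : S s <= ((S s `^ (q / p) + A0) `^ q^-1) `^ p.
  rewrite -powRrM -[leLHS](powRr1 (S0 s)) -(_ : q / p * (q^-1 * p) = 1); last first.
    by field; rewrite !gt_eqF.
  rewrite powRrM; apply: ge0_ler_powR; rewrite ?nnegrE ?powR_ge0// ?lerDl ?(ltW A00)//.
  by rewrite mulr_ge0 ?invr_ge0 ?(ltW q0) ?(ltW p0).
have [hE hr] := energy_total (@cell_lev _ _ kp k) E0 m0 hm.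
split => // t; rewrite /atomic_sum.
transitivity (\sum_i \sum_j c t i * P i j * sgnf R s j).
  apply: eq_bigr => i _; rewrite -!mulrA -/(c t i) mulrC mulr_sumr.
  by apply: eq_bigr => j _; rewrite mulrA.
rewrite exchange_big big1//= => j _.
by rewrite -mulr_suml cP mul0r.
Qed.

(** The atoms already vanish at the nodes, so P is the identity, and every level has energy exactly
    2^-k whatever the signs. Hence A = 0, and summing #|E| equal terms in l_theta costs V =
    #|E|^(1/theta). *)
Lemma width_ge_free_cells : exists2 c, 0 < c &
  forall n (E : finType) (kp : E -> 'I_d -> nat) k, level_system kp k J -> (0 < #|E|)%N ->
  (n < 2 ^ k)%N ->
  ((c * (2 ^+ k) `^ (- (mu + q^-1 - p^-1))
      * #|E|%:R `^ (q^-1 - tau / q' - inv_theta theta))%:E <= width n)%E.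
Proof.
have [c1 c10 h1] := random_width.
exists (c1 * rs); first by rewrite mulr_gt0.
move=> n E kp k ls E0 hn.
set L := #|E|%:R; have L0 : 0 < L :> R by rewrite ltr0n.
have k0 : 0 < 2 ^+ k :> R by rewrite exprn_gt0.
set K := 2 ^+ k in k0 *; have kK : 2^-1 ^+ k = K `^ (-1) by exact: pow2V.
have K0 s : 0 < K `^ s by exact: powR_gt0.
pose A0 := (K `^ (-1)) `^ (q / p).
pose V : R := L `^ inv_theta theta.
have A00 : 0 < A0 by rewrite powR_gt0.
have it0 : 0 <= inv_theta theta.
  case: (theta) th1 => [r|//|//] /= r1; rewrite lee_fin in r1.
  by rewrite invr_ge0 (le_trans _ r1).
have V1 : 1 <= V by apply: card_powR_ge1.
have W0 : 0 < K `^ (- mu) * rs by rewrite mulr_gt0.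
have h := h1 n E E kp id k A0 L V (K `^ (- mu) * rs) A00 L0 V1 W0 E0
  (fun e => weight_scale e ls rho0 hJ) _.
rewrite (_ : c1 * rs * _ * _ = (c1 * (K `^ (- mu) * rs) * (2^-1 ^+ k * L) /
   (V * (A0 `^ q^-1 * (L `^ tau * (L * 2^-1 ^+ k)) `^ q'^-1)))).
  apply: h => y.
  have [nu [wf nur hat]] := free_cells ls x0 rho0 sw y hn.
  have aE (s : {ffun E -> bool}) : (fun i => \sum_j (i == j)%:R * sgnf R s j) = sgnf R s.
    apply/funext => i; rewrite (bigD1 i)//= eqxx mul1r big1 ?addr0// => j /negbTE ij.
    by rewrite eq_sym ij mul0r.
  exists nu, (fun i j => (i == j)%:R), (fun=> 0); split; split.
  - exact: wf.
  - exact: nur.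
  - split=> [i j|i j]; first by rewrite eq_sym.
    rewrite (bigD1 i)//= eqxx mul1r big1 ?addr0// => k' /negbTE ik.
    by rewrite eq_sym ik mul0r.
  - by under eq_bigr do rewrite eqxx; rewrite sumr_const.
  - by [].
  - by rewrite sumr_const mul0rn mulr_ge0// ltW.
  move=> s /=; rewrite aE add0r.
  have mp : (A0 `^ q^-1) `^ p = 2^-1 ^+ k.
    by rewrite /A0 -!powRrM kK; congr (_ `^ _); field; rewrite !gt_eqF.
  have en e : energy p id k (sgnf R s) e = 2^-1 ^+ k.
    rewrite /energy (eq_bigl (pred1 e))// big_pred1_eq.
    by rewrite normr_sign powR1 mulr1.
  split=> [e|r thr|t]; first by rewrite en mp.
    under eq_bigr do rewrite en; rewrite sumr_const.
    have r1 : r != 0 by rewrite gt_eqF// (lt_le_trans ltr01)// -lee_fin -thr.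
    have mps z : (A0 `^ q^-1) `^ (p * z) = (2^-1 ^+ k) `^ z by rewrite -mp -[RHS]powRrM.
    rewrite mps.
    have -> : V `^ r = L by rewrite /V -powRrM thr /= mulVf// powRr1// ltW.
    by rewrite /L mulr_natr.
  by rewrite /atomic_sum big1// => i _; rewrite hat mulr0.
rewrite kK /A0 /V.
set ta := tau; set v := inv_theta theta.
rewrite (_ : L `^ ta * (L * K `^ (-1)) = L `^ (ta + 1) * K `^ (-1)); last first.
  by rewrite powRD ?powRr1 ?(ltW L0)// ?(gt_eqF L0) ?implybT// mulrA.
rewrite powRM ?powR_ge0// -!powRrM.
have E1 : L = L `^ (q^-1 - ta / q' - v) * (L `^ v * L `^ ((ta + 1) / q')).
  rewrite -!powRD ?(gt_eqF L0) ?implybT//.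
  rewrite -[LHS]powRr1 ?(ltW L0)//; congr (_ `^ _); rewrite -[LHS]qq'.
  by field; rewrite !gt_eqF.
have E2 : K `^ (- mu) * K `^ (-1) = K `^ (- (mu + q^-1 - p^-1)) *
    (K `^ (-1 * (q / p / q)) * K `^ (-1 * q'^-1)).
  rewrite -!powRD ?(gt_eqF k0) ?implybT//; congr (_ `^ _).
  rewrite -[in LHS]qq'; field; by rewrite !gt_eqF.
have -> : c1 * (K `^ (- mu) * rs) * (K `^ (-1) * L)
   = c1 * rs * (K `^ (- mu) * K `^ (-1)) * L by ring.
rewrite E2 [X in _ = _ * X / _]E1.
set x1 := K `^ (-1 * (q / p / q)); set x2 := K `^ (-1 * q'^-1).
set x3 := L `^ v; set x4 := L `^ ((ta + 1) / q').
have x10 : 0 < x1 by exact: powR_gt0.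
have x20 : 0 < x2 by exact: powR_gt0.
have x30 : 0 < x3 by exact: powR_gt0.
have x40 : 0 < x4 by exact: powR_gt0.
by field; rewrite !gt_eqF.
Qed.

Lemma atom_moment : exists2 C, 0 < C &
  forall (E I : finType) (kp : E -> 'I_d -> nat) (lev : I -> E) nu k i, wf_family kp lev nu k ->
  (\int[lebm R d]_x (`|atom x0 rho w kp lev nu lam i x| `^ q')%:E <= (C * 2^-1 ^+ k)%:E)%E.
Proof.
have [M M0 hM] := atom_bound x0 rho jw sw lam.
exists (M `^ q' * rho ^+ d); first by rewrite mulr_gt0 ?powR_gt0 ?exprn_gt0.
move=> E I kp lev nu k i wf.
apply: (@le_trans _ _ (\int[lebm R d]_x ((M `^ q')%:E * (active x0 rho kp lev nu i x)%:E))%E).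
  apply: ge0_le_integral_raw => x.
  - by move=> _; rewrite lee_fin powR_ge0.
  - by rewrite -EFinM lee_fin mulr_ge0 ?powR_ge0 ?active_ge0.
  move=> _; rewrite -EFinM lee_fin; have := hM E I kp lev nu i x.
  have [->|->] := active_bool x0 rho kp lev nu i x.
    by rewrite !mulr0 normr_le0 => /eqP ->; rewrite normr0 powR0// gt_eqF.
  rewrite !mulr1 => h; apply: ge0_ler_powR; rewrite ?nnegrE ?(ltW q'0) ?(ltW M0)//.
have m_act : measurable_fun [set: d.-tuple RR] (fun x => (active x0 rho kp lev nu i x)%:E).
  by apply/measurable_EFinP; exact: measurable_active.
have act0 (x : d.-tuple RR) : [set: d.-tuple RR] x -> (0 <= (active x0 rho kp lev nu i x)%:E)%E.
  by move=> _; rewrite lee_fin active_ge0.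
have M0' : (0 <= (M `^ q')%:E)%E by rewrite lee_fin powR_ge0.
rewrite (ge0_integralZl _ measurableT m_act act0 M0') (integral_active _ _ _ wf)//.
by rewrite -EFinM mulrA.
Qed.

(* Averaged over [i], the pairing of the [i]-th column of the projection with the single
   atom [phi_i] is at least half of the Gram bound, as the projection keeps half the trace. *)
Lemma width_ge_projected_cell : 2 <= p -> exists2 c, 0 < c &
  forall n (E : finType) (kp : E -> 'I_d -> nat) k, level_system kp k J -> (0 < #|E|)%N ->
  (n.*2 <= 2 ^ k * #|E|)%N ->
  ((c * (2 ^+ k) `^ (- (mu + q^-1 - p^-1))
      * #|E|%:R `^ (- posp (inv_theta theta - p^-1)))%:E <= width n)%E.
Proof.
move=> p2.
have [c1 c10 h1] := family_width_ge rho0 rho1 jw sw oD marg0 cubeD lam p1 th1 al0 q0 q'0 qq'.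
have [C C0 hC] := atom_moment.
have w20 : 0 < wmass w lam ^+ 2 by rewrite lt_neqAle eq_sym sqrf_eq0 wm0 sqr_ge0.
have r0 : 0 < rho ^+ d by exact: exprn_gt0.
pose Zr := C `^ q'^-1.
have Zr0 : 0 < Zr by rewrite powR_gt0.
exists (c1 / 2 * rs * (wmass w lam ^+ 2 * rho ^+ d / 2) / Zr).
  by apply: divr_gt0 => //; apply: mulr_gt0; [rewrite mulr_gt0// divr_gt0|rewrite divr_gt0// mulr_gt0].
move=> n E kp k ls E0 hN.
set L := #|E|%:R; have L0 : 0 < L :> R by rewrite ltr0n.
pose I : finType := cells kp k.
have k0 : 0 < 2 ^+ k :> R by rewrite exprn_gt0.
set K := 2 ^+ k in k0 *; have kK : 2^-1 ^+ k = K `^ (-1) by exact: pow2V.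
have K0 s : 0 < K `^ s by exact: powR_gt0.
have I0 : (0 < #|I|)%N by rewrite (card_cells ls) muln_gt0 expn_gt0.
have I0R : 0 < #|I|%:R :> R by rewrite ltr0n.
pose V : R := L `^ posp (inv_theta theta - p^-1).
have V1 : 1 <= V by apply: card_powR_ge1 => //; rewrite /posp le_max lexx orbT.
have V0 : 0 < V by exact: lt_le_trans V1.
pose W := K `^ (- mu) * rs; have W0 : 0 < W by rewrite mulr_gt0.
pose m := (K `^ (-1)) `^ p^-1; have m0 : 0 < m by rewrite powR_gt0.
pose Z := Zr * (K `^ (-1)) `^ q'^-1; have Z0 : 0 < Z by rewrite mulr_gt0// powR_gt0.
pose g0 := wmass w lam ^+ 2 * (rho ^+ d * 2^-1 ^+ k).
have g00 : 0 < g0 by apply: (mulr_gt0 w20); rewrite mulr_gt0// kK.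
rewrite (_ : _ * K `^ _ * _ = c1 / 2 * W * (g0 / 2) / (m * V * Z)); last first.
  rewrite [L `^ _]powRN -/V /W /g0 /m /Z kK -!powRrM.
  have E2 : K `^ (- mu) * K `^ (-1) = K `^ (- (mu + q^-1 - p^-1)) *
      (K `^ (-1 * p^-1) * K `^ (-1 * q'^-1)).
    rewrite -!powRD ?(gt_eqF k0) ?implybT//; congr (_ `^ _).
    rewrite -[in LHS]qq'; ring.
  have -> : c1 / 2 * (K `^ (- mu) * rs) * (wmass w lam ^+ 2 * (rho ^+ d * K `^ (-1)) / 2)
    = c1 / 2 * rs * (wmass w lam ^+ 2 * rho ^+ d / 2) * (K `^ (- mu) * K `^ (-1)) by ring.
  rewrite E2; set x1 := K `^ (-1 * p^-1); set x2 := K `^ (-1 * q'^-1).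
  have x10 : 0 < x1 by exact: powR_gt0.
  have x20 : 0 < x2 by exact: powR_gt0.
  by field; rewrite !gt_eqF.
apply: h1.
  apply: divr_gt0; last by apply: mulr_gt0 => //; apply: mulr_gt0.
  by apply: mulr_gt0; [apply: mulr_gt0 => //|]; apply: divr_gt0.
move=> y.
pose c t (i : I) := weight kp alpha (cell_lev i)
  * atom x0 rho w kp (@cell_lev _ _ kp k) (@cell_nu _ _ kp k) (fun=> 0%N) i (y t).
have [P [sP iP cP tP]] := exists_projection c.
have hP : is_proj P by split.
have wf : wf_family kp (@cell_lev _ _ kp k) (@cell_nu _ _ kp k) k := cells_wf ls.
pose G := gram x0 rho w kp (@cell_lev _ _ kp k) (@cell_nu _ _ kp k) lam.
have [i0 hi0] : exists i0 : I, g0 / 2 <= \sum_i P i i0 * G i i0.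
  apply: contrapT => /forallNP H.
  have lt i : \sum_i' P i' i * G i' i < g0 / 2 by rewrite ltNge; apply/negP; exact: H.
  have : \sum_i \sum_i' P i' i * G i' i < g0 / 2 * #|I|%:R.
    have [i1 _] := card_gt0P I0.
    rewrite mulr_natr -sumr_const.
    rewrite (bigD1 i1)//= [ltRHS](bigD1 i1)//=; apply: ltr_leD; first exact: lt.
    by apply: ler_sum => i _; exact/ltW/lt.
  apply/negP; rewrite -leNgt.
  apply: (@le_trans _ _ (g0 * \sum_i P i i)).
    rewrite -mulrA ler_wpM2l ?(ltW g00)//; apply: le_trans tP.
    have : (n.*2)%:R <= #|I|%:R :> R by rewrite ler_nat (card_cells ls).
    rewrite -mul2n natrM; lra.
  (* As P is symmetric and idempotent, the trace of P times the Gram matrix is the sum over the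
     columns of P of their quadratic forms, to which the Gram bound applies. *)
  have -> : \sum_i \sum_i' P i' i * G i' i
      = \sum_j \sum_i \sum_i' P i j * P i' j * G i i'.
    rewrite [RHS]exchange_big [LHS]exchange_big /=; apply: eq_bigr => i _.
    rewrite [RHS]exchange_big /=; apply: eq_bigr => i' _.
    rewrite -mulr_suml; congr (_ * _); rewrite -iP.
    by apply: eq_bigr => j _; rewrite (sP j i').
  have -> : \sum_i P i i = \sum_j \sum_i P i j ^+ 2.
    rewrite exchange_big /=; apply: eq_bigr => i _; rewrite -(proj_diag i hP)//.
  rewrite mulr_sumr; apply: ler_sum => j _.
  exact: (gram_ge x0 rho0 jw sw lam wf (fun i => P i j)).
pose b (i : I) : R := (i == i0)%:R.
(* Entries of a projection are at most 1 in absolute value, so for p >= 2 the p-th powers lie below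
   the squares, and the squares of a column sum to a diagonal entry. *)
have hm : 2^-1 ^+ k * \sum_i `|P i i0| `^ p <= m `^ p.
  rewrite /m -powRrM mulVf ?gt_eqF// powRr1 ?powR_ge0// -kK ler_piMr ?exprn_ge0//.
  apply: le_trans (proj_diag_le1 i0 hP); rewrite -(proj_diag i0 hP).
  apply: ler_sum => i _; rewrite (sP i0 i).
  have P1 : `|P i i0| <= 1.
    rewrite -(@ler_pXn2r _ 2)// ?nnegrE// real_normK ?num_real// expr1n.
    apply: le_trans (proj_diag_le1 i hP); rewrite -(proj_diag i hP).
    by rewrite (bigD1 i0)//= lerDl sumr_ge0// => *; exact: sqr_ge0.
  rewrite -[leRHS]real_normK ?num_real// -powR_mulrn//.
  have [->|Pn] := eqVneq (P i i0) 0.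
    by rewrite normr0 !powR0 ?gt_eqF//.
  apply: (@le_trans _ _ (`|P i i0| `^ 2%:R)) => //.
  have Pp : 0 < `|P i i0| by rewrite normr_gt0.
  rewrite -[p](subrK 2) powRD; last by rewrite (gt_eqF Pp) implybT.
  rewrite ler_piMl ?powR_ge0//; apply: (@le_trans _ _ (1 `^ (p - 2))); last by rewrite powR1.
  by apply: ge0_ler_powR; rewrite ?nnegrE ?subr_ge0.
have [hE hr] := energy_total (@cell_lev _ _ kp k) E0 m0 hm.
exists E, I, kp, (@cell_lev _ _ kp k), (@cell_nu _ _ kp k), k, (fun i => P i i0), b, m, V, Z, W.
split; first by split => //; exact: cells_range.
split; last first.
  split; first by move=> i; exact: (weight_scale _ ls rho0 hJ).
  have -> : \sum_i \sum_i' P i i0 * b i' * G i i' = \sum_i P i i0 * G i i0.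
    apply: eq_bigr => i _; rewrite (bigD1 i0)//= /b eqxx mulr1 big1 ?addr0//.
    by move=> i' /negbTE ->; rewrite mulr0 mul0r.
  have mVZ0 : 0 < m * V * Z by exact: mulr_gt0 (mulr_gt0 m0 V0) Z0.
  apply: (@le_lt_trans _ _ (c1 / 2 * W * (g0 / 2))).
    by rewrite le_eqVlt; apply/orP; left; apply/eqP; apply: divfK; rewrite gt_eqF.
  have := ler_wpM2l (ltW (mulr_gt0 c10 W0)) hi0.
  have : 0 < c1 * W * (g0 / 2) by apply: mulr_gt0; [exact: mulr_gt0|exact: divr_gt0].
  rewrite [c1 * (W * _)]mulrA; set X := \sum_i _; set Y := c1 * W * X.
  have -> : c1 / 2 * W * (g0 / 2) = (c1 * W * (g0 / 2)) / 2 by ring.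
  lra.
split => //.
- move=> t; rewrite /atomic_sum -[RHS](cP t i0).
  by apply: eq_bigr => i _; rewrite /c; ring.
have pb x : probe x0 rho w kp (@cell_lev _ _ kp k) (@cell_nu _ _ kp k) lam b x
    = atom x0 rho w kp (@cell_lev _ _ kp k) (@cell_nu _ _ kp k) lam i0 x.
  rewrite /probe (bigD1 i0)//= /b eqxx mul1r big1 ?addr0//.
  by move=> i' /negbTE ->; rewrite mul0r.
rewrite (eq_integral (fun x => (`|atom x0 rho w kp (@cell_lev _ _ kp k) (@cell_nu _ _ kp k) lam i0 x| `^ q')%:E)).
  apply: (le_trans (hC _ _ _ _ _ _ _ wf)); rewrite lee_fin le_eqVlt; apply/orP; left; apply/eqP.
  rewrite /Z /Zr kK powRM ?powR_ge0// -!powRrM mulVf ?gt_eqF// powRr1 ?(ltW C0)//.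
  by rewrite mulr1.
by move=> x _; rewrite pb.
Qed.

End Cases.

(** * Rates in terms of n *)

Section Exponents.
Variable R : realType.

(** With L = (k'+1)^g one has (2^k)^(-s) L^e = (2^k L)^(-s) L^(s+e), where 2^k L is comparable to n
    and L to (ln n)^g. This is how the smoothness s enters the logarithmic exponent. *)
Lemma rate_transfer (c C s e : R) g : 0 < c -> 0 < C -> exists2 b, 0 < b &
  forall n k k', (2 <= n)%N -> n%:R <= (2 ^ k * k'.+1 ^ g)%:R :> R ->
  (2 ^ k * k'.+1 ^ g)%:R <= C * n%:R ->
  c * ln n%:R <= k'.+1%:R -> k'.+1%:R <= C * ln n%:R ->
  b * n%:R `^ (- s) * ln n%:R `^ (g%:R * (s + e))
  <= (2 ^+ k) `^ (- s) * (k'.+1 ^ g)%:R `^ e.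
Proof.
move=> c0 C0.
have [b1 b10 h1] := powR_two_sided (- s) (@ltr01 R) C0.
have [b2 b20 h2] := powR_two_sided (g%:R * (s + e)) c0 C0.
exists (b1 * b2); first exact: mulr_gt0.
move=> n k k' n2; set L := (k'.+1 ^ g)%N => N1 N2 k1 k2.
have n0 : 0 < n%:R :> R by rewrite ltr0n (leq_trans _ n2).
have ln0 : 0 < ln n%:R :> R by rewrite ln_gt0// ltr1n.
have L0 : 0 < L%:R :> R by rewrite ltr0n expn_gt0.
have K0 : 0 < 2 ^+ k :> R by rewrite exprn_gt0.
have e1 := h1 _ _ n0 _ N2; rewrite mul1r in e1; have {}e1 := e1 N1.
have e2 := h2 _ _ ln0 k1 k2.
have -> : (2 ^+ k) `^ (- s) * L%:R `^ e = (2 ^ k * L)%:R `^ (- s) * k'.+1%:R `^ (g%:R * (s + e)).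
  rewrite natrM natrX powRM ?(ltW K0) ?(ltW L0)// -mulrA; congr (_ * _).
  rewrite [k'.+1%:R `^ _]powRrM powR_mulrn// -natrX -powRD; last by rewrite (gt_eqF L0) implybT.
  by congr (_ `^ _); ring.
rewrite -[leLHS]mulrA mulrACA; apply: ler_pM => //.
all: by rewrite mulr_ge0 ?powR_ge0// ltW.
Qed.

(** Since (q'/2 - 1)/q' = 1/q - 1/2, the overlap loss for the probe is present exactly for q < 2,
    that is, when Q = 2 differs from q. *)
Lemma dual_exponent (q q' : R) : 0 < q -> 0 < q' -> q^-1 + q'^-1 = 1 ->
  Num.max (q' / 2 - 1) 0 / q' = posp (q^-1 - (Num.max 2 q)^-1).
Proof.
move=> q0 q'0 qq'.
rewrite -[X in _ / X]invrK -[LHS]/(_ * _) invrK maxr_pMl ?invr_ge0 ?(ltW q'0)// mul0r.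
have -> : (q' / 2 - 1) / q' = q^-1 - 2^-1.
  have -> : (q' / 2 - 1) / q' = 2^-1 - q'^-1 by field; rewrite gt_eqF.
  by lra.
rewrite /posp; case: (leP 2 q) => h; last by [].
rewrite subrr maxxx; apply/max_idPr; rewrite subr_le0 lef_pV2 ?posrE//.
Qed.

End Exponents.

Theorem theorem3p4p3 (R : realType) (d : nat) (m : 'I_d -> nat)
    (D : set (pt R d)) (alpha : 'I_d -> R) (p : R) (theta : \bar R) (q : R)
    (lam : 'I_d -> nat) (mu : R) :
  (0 < d)%N ->
  is_domain D -> is_bounded D -> m_type m D ->
  (forall j, 0 < alpha j) ->
  1 <= p -> (1 <= theta)%E -> 1 < q ->
  (forall j, (lam j <= m j)%N) ->
  (forall j, alpha j - p^-1 > 0) ->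
  (forall j, alpha j - (lam j)%:R - posp (p^-1 - q^-1) > 0) ->
  (* mu = min_j (alpha_j - lambda_j) *)
  (forall j, mu <= alpha j - (lam j)%:R) ->
  (exists j, mu = alpha j - (lam j)%:R) ->
  let gamma : nat := #|[pred j : 'I_d | alpha j - (lam j)%:R == mu]| in
  let Q := Num.max 2 q in
  let K := Kball D p theta alpha in
  exists2 c : R, 0 < c &
    forall n : nat, (2 <= n)%N ->
      ((q <= p \/ (2 <= p /\ p < q)) ->
        ((c * n%:R `^ (- (mu - posp (p^-1 - q^-1)))
           * ln n%:R `^ ((gamma%:R - 1) *
                (mu - (p^-1 - q^-1) - posp (inv_theta theta - p^-1)
                    - posp (q^-1 - Q^-1))))%:E
         <= recovery_width D lam K q n)%E)
      /\
      (p < Num.min 2 q ->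
        ((c * n%:R `^ (- (mu - posp (p^-1 - q^-1)))
           * ln n%:R `^ ((gamma%:R - 1) * posp (Q^-1 - inv_theta theta)))%:E
         <= recovery_width D lam K q n)%E).
Proof.
move=> d0 [oD _ Dn0] _ _ al0 p1 th1 q1 _ _ _ _ [j0 mu0] gamma Q K.
have q0 : 0 < q by exact: lt_trans q1.
have p0 : 0 < p by exact: lt_le_trans p1.
pose q' := q / (q - 1).
have q'0 : 0 < q' by rewrite divr_gt0// subr_gt0.
have qq' : q^-1 + q'^-1 = 1 by rewrite /q'; field; rewrite !gt_eqF ?subr_gt0.
have [x0 [rho [marg [rho0 rho1 marg0 cubeD]]]] := cube_in_domain oD Dn0.
have /boolp.choice[w hw] : forall j : 'I_d, exists w : nat -> R -> R,
    [/\ jet w, supp01 w & w (lam j) 2^-1 != 0].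
  by move=> j; exact: wavelet_exists.
have jw j : jet (w j) by have [] := hw j.
have sw j : supp01 (w j) by have [] := hw j.
have wm0 : wmass w lam != 0.
  by apply/prodf_neq0 => j _; have [_ _ h] := hw j; rewrite mulf_neq0.
pose J := [pred j : 'I_d | alpha j - (lam j)%:R == mu].
have hJ j : J j -> alpha j - (lam j)%:R = mu by move=> /eqP.
have Jj0 : J j0 by rewrite /= -mu0.
pose g := #|J|.-1.
have gE : gamma%:R - 1 = g%:R :> R.
  have : (0 < gamma)%N by apply/card_gt0P; exists j0.
  by rewrite /g -/gamma; case: (gamma) => // g' _ /=; rewrite -natr1 addrK.
have tauE := dual_exponent q0 q'0 qq'.
have width1 := width_ge_all_cells rho0 rho1 jw sw oD marg0 cubeD p1 th1 al0 q0 q'0 qq' wm0 hJ.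
have width2 := width_ge_projected_cell rho0 rho1 jw sw oD marg0 cubeD p1 th1 al0 q0 q'0 qq' wm0 hJ.
have [c3 c30 width3] := width_ge_free_cells rho0 rho1 jw sw oD marg0 cubeD p1 th1 al0 q0 q'0 qq' wm0 hJ.
rewrite gE -/Q in tauE *.
have [c [C [c0 C0 num]]] := numerology R g d0.
have partA : exists2 c, 0 < c & forall n, (2 <= n)%N ->
    (q <= p \/ (2 <= p /\ p < q)) ->
    ((c * n%:R `^ (- (mu - posp (p^-1 - q^-1))) * ln n%:R `^ (g%:R *
       (mu - (p^-1 - q^-1) - posp (inv_theta theta - p^-1) - posp (q^-1 - Q^-1))))%:E
     <= recovery_width D lam K q n)%E.
  have [qp|pq] := leP q p.
    have [cw cw0 hcw] := width1 qp.
    set v := posp (inv_theta theta - p^-1).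
    have [b b0 hb] := rate_transfer mu (q^-1 - p^-1 - posp (q^-1 - Q^-1) - v) g c0 C0.
    exists (cw * b) => [|n n2 _]; first exact: mulr_gt0.
    have [k' [N1 N2 k1 k2]] := num n n2.
    have [E [kp [ls cE]]] := exists_levels k' Jj0.
    have nN : n%:R <= (2 ^ (d * k') * k'.+1 ^ g)%:R :> R.
      by rewrite ler_nat (leq_trans _ N1)// -addnn leq_addr.
    have E0 : (0 < #|E|)%N by rewrite cE expn_gt0.
    have N1' : (n.*2 <= 2 ^ (d * k') * #|E|)%N by rewrite cE.
    apply: le_trans (hcw n E kp (d * k')%N ls E0 N1').
    rewrite tauE cE lee_fin -!mulrA ler_wpM2l ?(ltW cw0)//.
    have := hb n (d * k')%N k' n2 nN N2 k1 k2; rewrite -/g.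
    have -> : posp (p^-1 - q^-1) = 0.
      by apply/max_idPr; rewrite subr_le0 lef_pV2 ?posrE.
    rewrite subr0 -mulrA (_ : mu - _ - _ - _ = mu + (q^-1 - p^-1 - posp (q^-1 - Q^-1) - v))//.
    by rewrite /v; ring.
  have [p2|p2] := leP 2 p; last first.
    (* With p < q and p < 2 neither alternative holds, so any constant will do. *)
    by exists 1 => // n _ [//|[//]].
  have [cw cw0 hcw] := width2 p2.
  have -> : posp (p^-1 - q^-1) = p^-1 - q^-1.
    by apply/max_idPl; rewrite subr_ge0 lef_pV2 ?posrE// ltW.
  have -> : posp (q^-1 - Q^-1) = 0.
    by rewrite /Q (max_idPr _) ?subrr /posp ?maxxx// (le_trans p2)// ltW.
  set v := posp (inv_theta theta - p^-1).
  have [b b0 hb] := rate_transfer (mu + q^-1 - p^-1) (- v) g c0 C0.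
  exists (cw * b) => [|n n2 _]; first exact: mulr_gt0.
  have [k' [N1 N2 k1 k2]] := num n n2.
  have [E [kp [ls cE]]] := exists_levels k' Jj0.
  have nN : n%:R <= (2 ^ (d * k') * k'.+1 ^ g)%:R :> R.
    by rewrite ler_nat (leq_trans _ N1)// -addnn leq_addr.
  have E0 : (0 < #|E|)%N by rewrite cE expn_gt0.
  have N1' : (n.*2 <= 2 ^ (d * k') * #|E|)%N by rewrite cE.
  apply: le_trans (hcw n E kp (d * k')%N ls E0 N1').
  rewrite cE lee_fin -!mulrA ler_wpM2l ?(ltW cw0)//.
  have := hb n (d * k')%N k' n2 nN N2 k1 k2; rewrite -/g -mulrA.
  rewrite (_ : mu - (p^-1 - q^-1) = mu + q^-1 - p^-1); last by ring.
  by rewrite subr0.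
have partB : exists2 c, 0 < c & forall n, (2 <= n)%N -> p < Num.min 2 q ->
    ((c * n%:R `^ (- (mu - posp (p^-1 - q^-1)))
       * ln n%:R `^ (g%:R * posp (Q^-1 - inv_theta theta)))%:E
     <= recovery_width D lam K q n)%E.
  (* With exponent 0 the level is fixed by 2^k comparable to n alone; the logarithms come
     separately, from the number of shapes. *)
  have [c' [C' [c'0 C'0 num']]] := numerology R 0 d0.
  set s := mu + q^-1 - p^-1.
  have [b b0 hb] := rate_transfer s 0 0 c'0 C'0.
  have [b2 b20 hb2] := powR_two_sided (g%:R * posp (Q^-1 - inv_theta theta)) c'0 C'0.
  exists (c3 * b * b2) => [|n n2 p2q]; first by rewrite !mulr_gt0.
  have pq : p < q by move: p2q; rewrite lt_min => /andP[].
  have -> : posp (p^-1 - q^-1) = p^-1 - q^-1.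
    by apply/max_idPl; rewrite subr_ge0 lef_pV2 ?posrE// ltW.
  have [k' [N1 N2 k1 k2]] := num' n n2.
  have nN : n%:R <= (2 ^ (d * k') * k'.+1 ^ 0)%:R :> R.
    by rewrite ler_nat (leq_trans _ N1)// -addnn leq_addr.
  have := hb n (d * k')%N k' n2 nN N2 k1 k2.
  rewrite mul0r !powRr0 !mulr1 => rate.
  have ln0 : 0 < ln n%:R :> R by rewrite ln_gt0// ltr1n.
  have := hb2 _ _ ln0 k1 k2; set t := g%:R * _ => logs.
  have nk : (n < 2 ^ (d * k'))%N.
    by move: N1; rewrite expn0 muln1; apply: leq_trans; rewrite -addnn -addn1 leq_add2l ltnW.
  have tau2 : q^-1 - Num.max (q' / 2 - 1) 0 / q' = Q^-1.
    have Qq : posp (q^-1 - Q^-1) = q^-1 - Q^-1.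
      apply/max_idPl; rewrite subr_ge0 lef_pV2 ?posrE ?lt_max ?q0 ?orbT//.
      by rewrite le_max lexx orbT.
    by rewrite tauE Qq; ring.
  suff [E [kp [ls E0 hL]]] : exists (E : finType) (kp : E -> 'I_d -> nat),
      [/\ level_system kp (d * k')%N J, (0 < #|E|)%N &
          k'.+1%:R `^ t <= #|E|%:R `^ (Q^-1 - inv_theta theta)].
    apply: le_trans (width3 n E kp (d * k')%N ls E0 nk).
    rewrite tau2 lee_fin -/s (_ : mu - (p^-1 - q^-1) = s); last by rewrite /s; ring.
    rewrite (_ : c3 * b * b2 * n%:R `^ (- s) * ln n%:R `^ t
      = c3 * (b * n%:R `^ (- s)) * (b2 * ln n%:R `^ t)); last by ring.
    apply: ler_pM.
    - by rewrite mulr_ge0 ?(ltW c30)// mulr_ge0 ?powR_ge0 ?(ltW b0).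
    - by rewrite mulr_ge0 ?powR_ge0 ?(ltW b20).
    - by rewrite ler_wpM2l ?(ltW c30).
    - exact: le_trans logs hL.
  (* If the exponent of the number of shapes is nonnegative, all shapes are used; otherwise a single
     shape is better, which accounts for the positive part. *)
  have [Qt|Qt] := leP 0 (Q^-1 - inv_theta theta).
    have [E [kp [ls cE]]] := exists_levels k' Jj0.
    exists E, kp; split => //; first by rewrite cE expn_gt0.
    by rewrite /t /posp (max_idPl Qt) powRrM powR_mulrn// cE natrX.
  exists unit, (fun _ j => if j == j0 then (d * k')%N else 0%N); split.
  - exact: single_level.
  - by rewrite card_unit.
  - by rewrite card_unit powR1 /t /posp (max_idPr (ltW Qt)) mulr0 powRr0.
have [ca ca0 hA] := partA; have [cb cb0 hB] := partB.
exists (Num.min ca cb); first by rewrite lt_min ca0.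
have mono (c1 c2 x y : R) : 0 <= x -> 0 <= y -> c1 <= c2 -> ((c1 * x * y)%:E <= (c2 * x * y)%:E)%E.
  by move=> x_ge0 y_ge0 c12; rewrite lee_fin !ler_wpM2r.
move=> n n2; split => h.
- by apply: le_trans (hA n n2 h); apply: mono; rewrite ?powR_ge0// ge_min lexx.
- by apply: le_trans (hB n n2 h); apply: mono; rewrite ?powR_ge0// ge_min lexx orbT.
Qed.
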